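(* Let $E$ be a separable Banach space and let $(X_n)_n$ be a sequence of Gaussian random variables with values in $E$, converging in law to a random variable $X$. Then, for every speed function $g$, the sequence $(g_n^{-1/2}X_n)_n$ satisfies a Large Deviation Principle with speed $g$ and rate function $$I(x)=\frac12\|x\|_{\mathcal H}^2,$$ where $\|\cdot\|_{\mathcal H}$ denotes the Reproducing Kernel Hilbert Space norm of the law of the random variable $X-\mathbb{E}[X]$, with the understanding that $\|x\|_{\mathcal H}=+\infty$ if $x\notin\mathcal H$.
   Context: $E'$ denotes the topological dual of $E$. An $E$-valued random variable $Y$ is Gaussian (not necessarily centered) if $\langle\theta,Y\rangle$ is a (possibly degenerate) real Gaussian random variable for every $\theta\in E'$. The limit in law $X$ of the $X_n$ is again Gaussian. A speed function is a function $g:\mathbb{N}\to\mathbb{R}^+$, $n\mapsto g_n>0$, such that $\lim_{n\to\infty}g_n=+\infty$. A sequence $(Y_n)_n$ of $E$-valued random variables satisfies a Large Deviation Principle with speed $g$ and rate function $I:E\to[0,+\infty]$ (lower semicontinuous) if for every closed set $F\subset E$, $\limsup_{n\to\infty}\frac1{g_n}\log \mathbb{P}(Y_n\in F)\le-\inf_{x\in F}I(x)$, and for every open set $G\subset E$, $\liminf_{n\to\infty}\frac1{g_n}\log \mathbb{P}(Y_n\in G)\ge-\inf_{x\in G}I(x)$ (with $\inf\emptyset=+\infty$ and $\log 0=-\infty$). Reproducing Kernel Hilbert Space of a centered Gaussian probability $\mu$ on $E$: for each $\theta\in E'$ the function $z\mapsto\langle\theta,z\rangle$ belongs to $L^2(\mu)$;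 let $\overline{E}'_\mu$ be the closure in $L^2(\mu)$ of the set of these functions. $\mathcal H\subset E$ is the set of all vectors $h=\int_E z\,\phi(z)\,d\mu(z)$ (Bochner integral) with $\phi\in\overline{E}'_\mu$, and for such $h$ one sets $\|h\|_{\mathcal H}=\|\phi\|_{L^2(\mu)}=\bigl(\int_E\phi(z)^2\,d\mu(z)\bigr)^{1/2}$, which does not depend on the choice of $\phi$ representing $h$. *)

(* Defs.v *)
From HB Require Import structures.
From mathcomp Require Import all_boot all_order all_algebra.
From mathcomp Require Import all_classical all_reals all_analysis.

Set Implicit Arguments.
Unset Strict Implicit.
Unset Printing Implicit Defensive.

Import Order.TTheory GRing.Theory Num.Theory.
Import numFieldNormedType.Exports.

Local Open Scope classical_set_scope.
Local Open Scope ring_scope.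

Definition separable (T : topologicalType) : Prop :=
  exists2 D : set T, countable D & dense D.

Notation borel E := (g_sigma_algebraType (@open E)).

Section borel_random_variables.
Context d (Omega : measurableType d) (R : realType) (E : completeNormedModType R).

Definition rv_scale (c : R) (X : Omega -> E) : Omega -> borel E := fun w => c *: X w.

Definition rv_sub (X : Omega -> E) (a : E) : Omega -> borel E := fun w => X w - a.

Lemma measurable_continuous_comp (f : E -> E) (X : {mfun Omega >-> borel E}) :
  continuous f -> measurable_fun [set: Omega] (fun w => f (X w) : borel E).
Proof.
move=> /continuousP cf; apply: (@measurability _ _ Omega (borel E) _ _ (@open E)) => //.
move=> _ [B oB <-].
have := @measurable_funPT _ _ _ _ X measurableT (f @^-1` B).
rewrite !setTI; apply.
by apply: sub_sigma_algebra; exact: cf.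
Qed.

HB.instance Definition _ (c : R) (X : {mfun Omega >-> borel E}) :=
  isMeasurableFun.Build _ _ Omega (borel E) (rv_scale c X)
    (measurable_continuous_comp X (@scaler_continuous _ E c)).

Lemma continuous_subr (a : E) : continuous (fun x : E => x - a).
Proof. by move=> x; apply: cvgB; [exact: cvg_id | exact: cvg_cst]. Qed.

HB.instance Definition _ (X : {mfun Omega >-> borel E}) (a : E) :=
  isMeasurableFun.Build _ _ Omega (borel E) (rv_sub X a)
    (measurable_continuous_comp X (@continuous_subr a)).

End borel_random_variables.

Section gaussian.
Context d (Omega : measurableType d) (R : realType) (P : probability Omega R).

Definition real_gaussian (Z : Omega -> R) : Prop :=
  exists m : R,
    (forall A : set R, measurable A -> P (Z @^-1` A) = \d_m A) \/
    (exists2 sigma : R, 0 < sigma &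
       forall A : set R, measurable A -> P (Z @^-1` A) = normal_prob m sigma A).

Definition gaussian (E : completeNormedModType R) (X : {RV P >-> borel E}) : Prop :=
  forall theta : {linear E -> R^o}, continuous theta ->
    real_gaussian (fun w => theta (X w)).

End gaussian.

Definition cvg_in_law (R : realType) (E : completeNormedModType R)
    (d : nat -> measure_display) (Omega : forall n, measurableType (d n))
    (P : forall n, probability (Omega n) R)
    (X : forall n, {RV (P n) >-> borel E})
    (d' : measure_display) (Omega' : measurableType d')
    (P' : probability Omega' R) (X' : {RV P' >-> borel E}) : Prop :=
  forall f : E -> R, continuous f -> (exists M : R, forall x, `|f x| <= M) ->
    'E_(P n)[fun w => f (X n w)]%E @[n --> \oo] --> 'E_P'[fun w => f (X' w)]%E.

Section bochner.
Context d (T : measurableType d) (R : realType) (mu : probability T R).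
Context (E : completeNormedModType R).
Implicit Types (f s : T -> E) (y : E).

Definition simple_fun s : Prop :=
  measurable_fun [set: T] (s : T -> borel E) /\ finite_set (range s).

Definition simple_integral s : E :=
  \sum_(y \in range s) fine (mu (s @^-1` [set y])) *: y.

Definition is_bochner_integral f y : Prop :=
  measurable_fun [set: T] (f : T -> borel E) /\
  exists s : nat -> T -> E,
    [/\ forall n, simple_fun (s n),
        (\int[mu]_t (`|f t - s n t|)%:E)%E @[n --> \oo] --> 0%E &
        simple_integral (s n) @[n --> \oo] --> y].

(* Takes the value 0 if f is not Bochner integrable. *)
Definition bochner_integral f : E := xget 0 [set y | is_bochner_integral f y].

End bochner.

Section rkhs.
Context (R : realType) (E : completeNormedModType R).
Variable mu : probability (borel E) R.

(* The closure in L^2(mu) of the topological dual of E; its elements are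
   given by their representatives, square integrable functions. *)
Definition dual_closure : set (borel E -> R) :=
  [set phi | phi \in Lfun mu 2%:E /\
    forall e : R, 0 < e ->
      exists2 theta : {linear E -> R^o}, continuous theta &
        ('N[mu]_2%:E[EFin \o (fun z => phi z - theta z)%R] < e%:E)%E].

Definition rkhs_repr (h : E) : set (borel E -> R) :=
  [set phi | dual_closure phi /\
    is_bochner_integral mu (fun z : borel E => phi z *: (z : E)) h].

Definition rkhs : set E := [set h | rkhs_repr h !=set0].

(* The L^2(mu) norm of a phi representing h (for mu a centered Gaussian measure
   it is the same for all of them), and +oo if h is not in rkhs. *)
Definition rkhs_norm (h : E) : \bar R :=
  xget +oo%E [set 'N[mu]_2%:E[EFin \o phi] | phi in rkhs_repr h]%E.

End rkhs.

Definition speed (R : realType) (g : nat -> R) : Prop :=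
  (forall n, 0 < g n) /\ g n @[n --> \oo] --> +oo.

Definition LDP (R : realType) (E : completeNormedModType R)
    (d : nat -> measure_display) (Omega : forall n, measurableType (d n))
    (P : forall n, probability (Omega n) R)
    (Y : forall n, {RV (P n) >-> borel E}) (g : nat -> R) (I : E -> \bar R) : Prop :=
  [/\ forall x, (0 <= I x)%E,
      lower_semicontinuous I,
      forall F : set E, closed F ->
        (limn_esup (fun n => (g n)^-1%:E * lne (P n (Y n @^-1` F)))
           <= - ereal_inf [set I x | x in F])%E &
      forall G : set E, open G ->
        (- ereal_inf [set I x | x in G]
           <= limn_einf (fun n => (g n)^-1%:E * lne (P n (Y n @^-1` G))))%E].

(* Main.v *)
Require Import Defs.
From HB Require Import structures.
From mathcomp Require Import all_boot all_order all_algebra finmap.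
From mathcomp Require Import all_classical all_reals all_analysis.
From mathcomp Require Import measurable_realfun zify ring lra.

Set Implicit Arguments.
Unset Strict Implicit.
Unset Printing Implicit Defensive.

Import Order.TTheory GRing.Theory Num.Theory.
Import numFieldNormedType.Exports.

Local Open Scope classical_set_scope.
Local Open Scope ring_scope.

(** The proof follows the Gartner-Ellis method, in which everything is explicit for
    Gaussian laws.  Write $q(\theta)$ for the variance of $\langle\theta, X\rangle$.
    Since $\mathbb{E}\, e^{\langle\theta, X_n\rangle}$ depends only on the mean $m_n$
    and the variance $v_n$ of $\langle\theta, X_n\rangle$, the logarithm of the Laplace
    transform of $g_n^{-1/2} X_n$ at $g_n\theta$, divided by $g_n$, equals
    $g_n^{-1/2} m_n + v_n/2$.  It tends to $q(\theta)/2$ provided that means and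
    variances converge to those of $X$ (scaled_laplace_cvg).

    Exponential tightness and the convergence of moments both come from Fernique's
    theorem (fernique), applied to one absolutely convex set $A$ to which all the $X_n$
    give a large mass: the mass outside $c\,2^{k/2} A$ is doubly exponentially small
    in $k$.  With $A$ compact (abs_convex_tight) this is exponential tightness at every
    speed (exponential_tightness); with $A$ a ball it bounds the fourth moments of the
    norms uniformly (fourth_moment_bound), so that convergence in law carries over to
    means and variances (gaussian_moments_cvg).  Fernique's argument rests on the
    invariance of $\nu \otimes \nu$ under rotations for a centered Gaussian law $\nu$
    (rotation_invariance), that is, on the fact that a law is determined by its
    characteristic functional.  The latter is proved by showing that the functions by
    which two laws with the same characteristic functional may be multiplied without
    losing the coincidence form an algebra that contains the indicators of half-spaces
    (multiplier_half_space).

    Upper bounds for closed sets follow by covering a compact part with finitely many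
    half-spaces and applying the exponential Chebyshev inequality (closed_upper_bound).
    Lower bounds for open sets hold near each point
    $x_\theta = \int z\,\theta(z)\,d\mu(z)$ with $\theta$ in the dual, where $\mu$ is the law
    of $X - \mathbb{E} X$: the law tilted by $\theta$ concentrates at $x_\theta$, by the
    same upper bound, because $x_\theta$ is an exposed point of the rate
    (exposed_lower_bound).

    It remains to recognize the rate.  The Legendre transform
    $\sup_\theta (\theta(x) - q(\theta)/2)$ equals $\|x\|_{\mathcal H}^2/2$: if $\phi$
    represents $x$, completing the square gives
    $\theta(x) - q(\theta)/2 = (\|\phi\|^2 - \|\phi-\theta\|^2)/2$ in $L^2(\mu)$
    (rkhs_repr_square), and if the supremum is finite, a maximizing sequence converges
    in $L^2(\mu)$ to a function that represents $x$ (riesz_rkhs).  Finally the points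
    $x_\theta$ are dense for the purposes of the lower bound (exposed_points_dense). *)

(** * Integrals of real functions *)

Section real_integrals.
Context d (T : measurableType d) (R : realType) (mu : {measure set T -> \bar R}).
Implicit Types (f g : T -> R) (c : R).
Local Notation intg f := (mu.-integrable [set: T] (EFin \o f)).

Lemma integrable_add f g : intg f -> intg g -> intg (fun x => f x + g x).
Proof. by move=> fi gi; exact: (integrableD measurableT fi gi). Qed.

Lemma integrable_sub f g : intg f -> intg g -> intg (fun x => f x - g x).
Proof. by move=> fi gi; exact: (integrableB measurableT fi gi). Qed.

Lemma integrable_scale c f : intg f -> intg (fun x => c * f x).
Proof. by move=> fi; exact: (integrableZl measurableT c fi). Qed.

Lemma integrable_dominated f g : measurable_fun setT f ->
  (forall x, `|f x| <= g x) -> intg g -> intg f.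
Proof.
move=> mf fg; apply: (le_integrable measurableT); first exact/measurable_EFinP.
by move=> x _ /=; rewrite lee_fin (le_trans (fg x))// ler_norm.
Qed.

Lemma Rintegral_EFin f : intg f -> (\int[mu]_x (f x)%:E)%E = (\int[mu]_x f x)%:E.
Proof. by move=> fi; rewrite fineK//; exact: integrable_fin_num. Qed.

Lemma ge0_integral_le f g : measurable_fun setT f -> measurable_fun setT g ->
  (forall x, 0 <= f x) -> (forall x, f x <= g x) ->
  (\int[mu]_x (f x)%:E <= \int[mu]_x (g x)%:E)%E.
Proof.
move=> mf mg f0 fg.
apply: (@ge0_le_integral _ _ _ mu setT measurableT (EFin \o f) (EFin \o g)).
- by move=> x _; rewrite lee_fin.
- exact/measurable_EFinP.
- exact/measurable_EFinP.
- by move=> x _; rewrite lee_fin.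
Qed.

Lemma ge0_integral_scale c f : measurable_fun setT f -> (forall x, 0 <= f x) ->
  0 <= c -> (\int[mu]_x (c%:E * (f x)%:E) = c%:E * \int[mu]_x (f x)%:E)%E.
Proof.
move=> mf f0 c0; rewrite ge0_integralZl_EFin//; last exact/measurable_EFinP.
by move=> x _; rewrite lee_fin.
Qed.

End real_integrals.

Section real_integrals_probability.
Context d (T : measurableType d) (R : realType) (P : probability T R).
Implicit Types (f g : T -> R) (c : R).
Local Notation intg f := (P.-integrable [set: T] (EFin \o f)).

Lemma integrable_const c : intg (fun=> c).
Proof. exact: finite_measure_integrable_cst. Qed.

Lemma Rintegral_const c : \int[P]_x c = c.
Proof. by rewrite Rintegral_cst//= probability_setT mulr1. Qed.

Lemma integrable_bounded f c : measurable_fun setT f -> (forall x, `|f x| <= c) ->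
  intg f.
Proof. by move=> mf fc; apply: (integrable_dominated mf fc); exact: integrable_const. Qed.

Lemma Rintegral_indic (A : set T) : measurable A -> \int[P]_x \1_A x = fine (P A).
Proof. by move=> mA; rewrite /Rintegral integral_indic// setIT. Qed.

Lemma probability_le_fine (A : set T) c : measurable A ->
  (P A <= c%:E)%E = (fine (P A) <= c).
Proof. by move=> mA; rewrite -{1}(fineK (fin_num_measure P _ mA)) lee_fin. Qed.

Lemma fine_probability_setC (A : set T) : measurable A ->
  fine (P (~` A)) = 1 - fine (P A).
Proof. by move=> mA; rewrite probability_setC// fineB// fin_num_measure. Qed.

Lemma bounded_convergence (u : nat -> T -> R) (v : T -> R) c :
  (forall n, measurable_fun setT (u n)) -> measurable_fun setT v ->
  (forall n x, `|u n x| <= c) -> (forall x, u n x @[n --> \oo] --> v x) ->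
  \int[P]_x u n x @[n --> \oo] --> \int[P]_x v x.
Proof.
move=> mu mv uc uv.
have [] := @dominated_convergence _ _ _ P setT measurableT
  (fun n => EFin \o u n) (EFin \o v) (EFin \o cst c).
- by move=> n; exact/measurable_EFinP.
- exact/measurable_EFinP.
- by apply: aeW => x _; apply: cvg_EFin; [exact: nearW|exact: uv].
- exact: integrable_const.
- by apply: aeW => x n _ /=; rewrite lee_fin.
move=> vi _ L; have ui n : intg (u n) by exact: integrable_bounded (mu n) (uc n).
by apply/fine_cvg; rewrite -Rintegral_EFin in L *.
Qed.

End real_integrals_probability.

Section pushforward_integrals.
Context d d' (T : measurableType d) (T' : measurableType d') (R : realType).
Context (P : {measure set T -> \bar R}) (P' : {measure set T' -> \bar R}) (Z : T -> T').
Hypothesis mZ : measurable_fun setT Z.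
Hypothesis PZ : forall A, measurable A -> P' A = P (Z @^-1` A).

(** The law $P'$ of $Z$ is given by its values only, so that the same lemmas serve
    for image measures, however they are presented. *)
Lemma ge0_integral_law (f : T' -> \bar R) : measurable_fun setT f ->
  (forall x, 0 <= f x)%E -> (\int[P']_x f x = \int[P]_x f (Z x))%E.
Proof.
move=> mf f0; have := ge0_integral_pushforward mZ P measurableT mf (fun x _ => f0 x).
by rewrite preimage_setT => <-; apply: eq_measure_integral => A mA _; exact: PZ.
Qed.

Lemma integrable_law (f : T' -> R) : measurable_fun setT f ->
  P'.-integrable setT (EFin \o f) <-> P.-integrable setT (EFin \o (f \o Z)).
Proof.
move=> mf; have mn : measurable_fun setT (fun x => `|f x|%:E).
  by apply/measurable_EFinP; exact: measurableT_comp.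
have E : (\int[P']_x `|(f x)%:E| = \int[P]_x `|(f (Z x))%:E|)%E.
  exact: (ge0_integral_law mn).
split=> /integrableP[_ fi]; apply/integrableP; split.
- by apply/measurable_EFinP; exact: measurableT_comp.
- by rewrite /= -E.
- exact/measurable_EFinP.
- by rewrite [X in (X < _)%E]E.
Qed.

Lemma Rintegral_law (f : T' -> R) : measurable_fun setT f ->
  P'.-integrable setT (EFin \o f) -> \int[P']_x f x = \int[P]_x f (Z x).
Proof.
move=> mf fi; rewrite /Rintegral; congr fine.
have mf' : measurable_fun setT (EFin \o f) by exact/measurable_EFinP.
have fZ : P.-integrable (Z @^-1` setT) ((EFin \o f) \o Z).
  by rewrite preimage_setT; exact/integrable_law.
have := integral_pushforward mZ mf' fZ measurableT.
by rewrite preimage_setT => <-; apply: eq_measure_integral => A mA _; exact: PZ.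
Qed.

End pushforward_integrals.

(** * The topological dual and norming functionals *)

Section dual_space.
Context (R : realType) (E : normedModType R).
Implicit Types (f g : E -> R) (x y : E).

(** A predicate on plain functions, so that pointwise combinations of functionals
    can be formed without bundling. *)
Definition dual f : Prop :=
  (forall (a : R) x y, f (a *: x + y) = a * f x + f y) /\ continuous f.

Lemma dualD f x y : dual f -> f (x + y) = f x + f y.
Proof. by move=> [lf _]; rewrite -[x]scale1r lf mul1r scale1r. Qed.

Lemma dual0 f : dual f -> f 0 = 0.
Proof.
by move=> df; have := dualD 0 0 df; rewrite addr0 => /eqP; rewrite -subr_eq subrr => /eqP.
Qed.

Lemma dualZ f a x : dual f -> f (a *: x) = a * f x.
Proof. by move=> df; rewrite -[a *: x]addr0 df.1 dual0// addr0. Qed.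

Lemma dualN f x : dual f -> f (- x) = - f x.
Proof. by move=> df; rewrite -scaleN1r dualZ// mulN1r. Qed.

Lemma dualB f x y : dual f -> f (x - y) = f x - f y.
Proof. by move=> df; rewrite dualD// dualN. Qed.

Lemma dual_add f g : dual f -> dual g -> dual (fun x => f x + g x).
Proof.
move=> [lf cf] [lg cg]; split; first by move=> a x y; rewrite lf lg; ring.
by move=> x; apply: (@cvgD _ R^o); [exact: cf | exact: cg].
Qed.

Lemma dual_scale f (c : R) : dual f -> dual (fun x => c * f x).
Proof.
move=> [lf cf]; split; first by move=> a x y; rewrite lf; ring.
by move=> x; apply: cvgM; [exact: cvg_cst | exact: cf].
Qed.

Lemma dual_sub f g : dual f -> dual g -> dual (fun x => f x - g x).
Proof.
move=> df dg.
have -> : (fun x => f x - g x) = (fun x => f x + (-1) * g x).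
  by apply/funext => x; rewrite mulN1r.
exact/dual_add/dual_scale.
Qed.

Lemma dual_linear f : dual f ->
  exists F : {linear E -> R^o}, (F : E -> R) = f.
Proof.
move=> [lf _].
pose m := GRing.isLinear.Build R E R^o _ (f : E -> R^o) lf.
pose F : {linear E -> R^o} := HB.pack (f : E -> R^o) m.
by exists F.
Qed.

Lemma linear_dual (F : {linear E -> R^o}) : continuous F -> dual (F : E -> R).
Proof. by move=> cF; split => // a x y; rewrite linearP. Qed.

Lemma dual_bounded f : dual f -> exists2 C : R, 0 < C & forall x, `|f x| <= C * `|x|.
Proof.
move=> df; have [F Ff] := dual_linear df.
have cF : continuous F by move: df.2; rewrite -Ff.
have /linear_boundedP := (linear_bounded_continuous F).2 cF.
rewrite Ff => FC.
have [r [r0 fr]] : exists r : R, 0 < r /\ forall x, `|f x| <= r * `|x|.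
  apply: (@filter_ex _ (+oo)); apply: filterI => //.
  by apply: nbhs_pinfty_gt; rewrite num_real.
by exists r.
Qed.

Lemma bounded_dual f (C : R) :
  (forall (a : R) x y, f (a *: x + y) = a * f x + f y) ->
  (forall x, `|f x| <= C * `|x|) -> dual f.
Proof.
move=> lf fC; split => //.
pose m := GRing.isLinear.Build R E R^o _ (f : E -> R^o) lf.
pose F : {linear E -> R^o} := HB.pack (f : E -> R^o) m.
suff : continuous F by [].
apply/linear_bounded_continuous/linear_boundedP => /=.
near=> r => x; apply: (le_trans (fC x)); apply: ler_wpM2r => //.
Unshelve. all: by end_near. Qed.

End dual_space.

Section hahn_banach.
Context (R : realType) (E : normedModType R).

(** A subspace of E * R all of whose points lie below the graph of the norm is
    automatically the graph of a linear functional dominated by the norm. *)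
Let below_norm (G : set (E * R)) : Prop :=
  (forall (a : R) u v, G u -> G v -> G (a *: u.1 + v.1, a * u.2 + v.2)) /\
  (forall u, G u -> u.2 <= `|u.1|).

Let extend (G : set (E * R)) (v : E) (c : R) : set (E * R) :=
  [set w | exists u t, G u /\ w = (u.1 + t *: v, u.2 + t * c)].

Lemma below_norm_scale G u (a : R) : below_norm G -> G u -> G (a *: u.1, a * u.2).
Proof.
move=> [lG _] Gu.
have G0 : G (0, 0).
  by have := lG (-1) u u Gu Gu; rewrite scaleN1r addNr mulN1r addNr.
by have := lG a u (0, 0) Gu G0; rewrite /= !addr0.
Qed.

(** One-dimensional extension.  By the triangle inequality the lower bounds
    $u_2 - \|u_1 - v\|$ for a value at $v$ lie below the upper bounds
    $\|w_1 + v\| - w_2$. *)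
Lemma extend_below_norm G v : below_norm G -> G !=set0 ->
  exists c, below_norm (extend G v c).
Proof.
move=> bG [u0 Gu0]; have [lG Gn] := bG.
pose A := [set u.2 - `|u.1 - v| | u in G].
have ub u w : G u -> G w -> u.2 - `|u.1 - v| <= `|w.1 + v| - w.2.
  move=> Gu Gw; rewrite lerBrDr addrAC lerBlDr.
  have := Gn _ (lG 1 u w Gu Gw); rewrite /= scale1r mul1r => /le_trans; apply.
  have -> : u.1 + w.1 = (w.1 + v) + (u.1 - v) by rewrite addrACA subrr addr0 addrC.
  exact: ler_normD.
have supA : has_sup A.
  split; first by exists (u0.2 - `|u0.1 - v|), u0.
  by exists (`|u0.1 + v| - u0.2) => _ [u Gu <-]; exact: ub.
exists (sup A); split.
  move=> a _ _ [u [t [Gu ->]]] [w [s [Gw ->]]]; exists (a *: u.1 + w.1, a * u.2 + w.2), (a * t + s).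
  split; first exact: lG.
  rewrite /=; congr (_, _); last by ring.
  by rewrite scalerDr scalerDl scalerA addrACA.
have lo u : G u -> u.2 - sup A <= `|u.1 - v|.
  move=> Gu; rewrite lerBlDr addrC -lerBlDr.
  by apply: ub_le_sup => //; [exact: supA.2 | exists u].
have hi u : G u -> u.2 + sup A <= `|u.1 + v|.
  move=> Gu; rewrite addrC -lerBrDr; apply: ge_sup; first exact: supA.1.
  by move=> _ [w Gw <-]; exact: ub.
move=> _ [u [t [Gu ->]]] /=.
have [t0|t0|->] := ltgtP t 0; last by rewrite scale0r mul0r !addr0; exact: Gn.
- have t0' : 0 < - t by rewrite oppr_gt0.
  have := lo _ (below_norm_scale (- t)^-1 bG Gu).
  rewrite -(ler_pM2l t0') /= mulrBr mulrA divff ?gt_eqF// mul1r mulNr opprK.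
  move=> /le_trans; apply.
  rewrite -[X in X * _](gtr0_norm t0') -normrZ scalerBr scalerA divff ?gt_eqF//.
  by rewrite scale1r scaleNr opprK.
- have := hi _ (below_norm_scale t^-1 bG Gu).
  rewrite -(ler_pM2l t0) /= mulrDr mulrA divff ?gt_eqF// mul1r.
  move=> /le_trans; apply.
  rewrite -[X in X * _](gtr0_norm t0) -normrZ scalerDr scalerA divff ?gt_eqF//.
  by rewrite scale1r.
Qed.

(** The Hahn-Banach theorem for a single vector, by Zorn's lemma: a maximal subspace
    below the norm that contains the graph over the line of x0 projects onto E. *)
Theorem norming_functional (x0 : E) :
  exists f : E -> R, [/\ dual f, f x0 = `|x0| & forall x, `|f x| <= `|x|].
Proof.
pose line : set (E * R) := [set u | exists t, u = (t *: x0, t * `|x0|)].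
have line0 : line (0, 0) by exists 0; rewrite scale0r mul0r.
have line_below : below_norm line.
  split=> [a _ _ [t ->] [s ->]|_ [t ->]] /=.
    by exists (a * t + s); rewrite scalerDl scalerA mulrDl mulrA.
  by rewrite normrZ ler_wpM2r// ler_norm.
(* the line is adjoined here because the union of the empty chain is empty *)
pose P (G : set (E * R)) := below_norm (line `|` G).
have [G [PG Gmax]] : exists G, P G /\ forall B, G `<` B -> ~ P B.
  apply: Zorn_bigcup => F FP Ftot; split; last first.
    move=> u [lu|[X FX Xu]]; first exact: line_below.2.
    by apply: (FP _ FX).2; right.
  move=> a u v.
  (* any two points lie in a common member of the chain *)
  have step X (FX : F X) : (line `|` X) u -> (line `|` X) v ->
      (line `|` \bigcup_(X in F) X) (a *: u.1 + v.1, a * u.2 + v.2).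
    move=> Xu Xv; have [?|?] := (FP _ FX).1 a u v Xu Xv; first by left.
    by right; exists X.
  move=> [lu|[X FX Xu]] [lv|[Y FY Yv]].
  - by left; exact: line_below.1.
  - by apply: (step Y FY); [left|right].
  - by apply: (step X FX); [right|left].
  - have [XY|YX] := Ftot _ _ FX FY.
      by apply: (step Y FY); right => //; exact: XY.
    by apply: (step X FX); right => //; exact: YX.
pose H := line `|` G.
have total v : exists r, H (v, r).
  apply: contrapT => nv.
  have [|c bc] := extend_below_norm v PG; first by exists (0, 0); left.
  have GH : H `<=` extend H v c.
    by move=> [u r] Hu; exists (u, r), 0; rewrite scale0r mul0r !addr0.
  have vc : extend H v c (v, c).
    by exists (0, 0), 1; split; [left|rewrite scale1r mul1r !add0r].
  apply: (Gmax (extend H v c)).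
    split; first by move=> u Gu; apply: GH; right.
    by move=> /(_ _ vc) Gvc; apply: nv; exists c; right.
  rewrite /P setUidr//; by move=> u lu; apply: GH; left.
have [lH Hn] : below_norm H by [].
have uniq v r s : H (v, r) -> H (v, s) -> r = s.
  have le r' s' : H (v, r') -> H (v, s') -> r' <= s'.
    move=> Hr Hs; have := Hn _ (lH (-1) _ _ Hs Hr).
    by rewrite /= scaleN1r addNr normr0 mulN1r addrC subr_le0.
  by move=> Hr Hs; apply/eqP; rewrite eq_le !le.
pose f v := projT1 (cid (total v)).
have Hf v : H (v, f v) by exact: projT2 (cid (total v)).
have lf a x y : f (a *: x + y) = a * f x + f y.
  by apply: (@uniq (a *: x + y)) => //; exact: (lH a (x, f x) (y, f y)).
have fle x : f x <= `|x| by exact: (Hn (x, f x)).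
have fn x : `|f x| <= `|x|.
  rewrite ler_norml fle andbT lerNl.
  have -> : - f x = f (- x).
    rewrite -(scaleN1r x); apply: (@uniq (-1 *: x)) => //.
    by have := below_norm_scale (-1) (conj lH Hn) (Hf x); rewrite mulN1r.
  by rewrite (le_trans (fle _))// normrN.
exists f; split => //.
- by apply: (@bounded_dual _ _ _ 1) => // x; rewrite mul1r.
- by apply: (@uniq x0) => //; left; exists 1; rewrite scale1r mul1r.
Qed.

Lemma dual_separates (x y : E) : (forall f, dual f -> f x = f y) -> x = y.
Proof.
move=> xy; have [f [df fxy _]] := norming_functional (x - y).
by apply/subr0_eq/normr0_eq0; rewrite -fxy dualB// xy// subrr.
Qed.

End hahn_banach.

(** * Borel sets of a separable Banach space *)

Section borel_sets.
Context (R : realType) (E : completeNormedModType R).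

Lemma open_borel (A : set E) : open A -> measurable (A : set (borel E)).
Proof. by move=> oA; exact: sub_sigma_algebra. Qed.

Lemma closed_borel (A : set E) : closed A -> measurable (A : set (borel E)).
Proof.
move=> cA; rewrite -(setCK A); apply: measurableC.
by apply: open_borel; exact: closed_openC.
Qed.

Lemma continuous_borel (h : E -> R) :
  continuous h -> measurable_fun [set: borel E] (h : borel E -> R).
Proof.
move=> /continuousP ch; apply: (measurability _ (RGenOInfty.measurableE R)) => //.
move=> _ [_ [x ->] <-]; rewrite setTI.
by apply: open_borel; apply: ch; exact: interval_open.
Qed.

Lemma dual_measurable (f : E -> R) :
  dual f -> measurable_fun [set: borel E] (f : borel E -> R).
Proof. by move=> df; apply: continuous_borel; exact: df.2. Qed.

Lemma norm_measurable : measurable_fun [set: borel E] (fun x : borel E => `|x : E|).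
Proof. by apply: continuous_borel => x; exact: norm_continuous. Qed.

Lemma closed_norm_ball (a : E) (r : R) : closed [set x : E | `|x - a| <= r].
Proof.
have -> : [set x : E | `|x - a| <= r] = (fun x : E => `|x - a|) @^-1` [set y | y <= r] by [].
apply: (closed_comp (f := fun x : E => `|x - a|)); last exact: closed_le.
move=> x _; apply: cvg_norm; apply: cvgB; [exact: cvg_id | exact: cvg_cst].
Qed.

End borel_sets.

Section separable_normed_spaces.
Context (R : realType) (E : completeNormedModType R).

Definition dense_seq (D : nat -> E) : Prop :=
  forall (x : E) (e : R), 0 < e -> exists k, `|x - D k| < e.

Lemma separable_dense_seq : separable E -> exists D : nat -> E, dense_seq D.
Proof.
move=> [D cD dD].
have [x0 Dx0] : D !=set0.
  by have [|x [_ Dx]] := dD setT _ openT; [exists 0 | exists x].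
have [f fD] : exists f : nat -> E, D `<=` range f.
  have /pfcard_geP [D0|[f]] := cD; first by move: Dx0; rewrite D0.
  exists f => x Dx; have [k _ fk] := @surj _ _ _ _ f x Dx.
  by exists k.
exists f => x e e0.
have [|y [xy /fD [k _ fk]]] := dD (ball x e) _ (ball_open x e).
  by exists x; exact: ballxx.
by exists k; rewrite fk; move: xy; rewrite -ball_normE.
Qed.

(** The functional that norms a vector nearly norms the vectors close to it. *)
Lemma norming_sequence (D : nat -> E) : dense_seq D ->
  exists f : nat -> E -> R, (forall k, dual (f k)) /\
    forall x r, `|x| <= r <-> forall k, f k x <= r.
Proof.
move=> dD.
pose f k := projT1 (cid (norming_functional (D k))).
have Hf k : [/\ dual (f k), f k (D k) = `|D k| & forall x, `|f k x| <= `|x|].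
  exact: projT2 (cid (norming_functional (D k))).
exists f; split=> [k|x r]; first by have [] := Hf k.
split=> [xr k|fr].
  by have [_ _ /(_ x)] := Hf k; move=> /(le_trans (ler_norm _))/le_trans; exact.
apply/ler_addgt0Pr => e e0.
have [|k xk] := dD x (e / 2); first by rewrite divr_gt0.
have [df fD fn] := Hf k.
have : `|x| <= `|D k| + `|x - D k| by rewrite -[X in `|X|](subrK (D k)) addrC ler_normD.
have : f k (D k - x) <= `|x - D k|.
  by rewrite (le_trans (ler_norm _))// (le_trans (fn _))// distrC.
have := fr k.
rewrite (dualB _ _ df) fD.
lra.
Qed.

(** Half-spaces generate the Borel sets: by separability and the existence of
    norming functionals, a closed ball is a countable intersection of
    half-spaces, and an open set a countable union of closed balls. *)
Lemma half_spaces_generate_borel (A : set (set E)) : separable E ->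
  sigma_algebra setT A ->
  (forall f c, dual f -> A [set x | f x <= c]) ->
  forall B : set (borel E), measurable B -> A B.
Proof.
move=> /separable_dense_seq [D dD] [A0 AC AU] Ahalf.
have AI (F : (set E)^nat) : (forall n, A (F n)) -> A (\bigcap_n F n).
  move=> AF; rewrite -[X in A X]setCK setC_bigcap -setTD; apply: (AC).
  by apply: AU => n; rewrite -setTD; exact: AC.
have [f [df fnorm]] := norming_sequence dD.
have Aball a r : A [set x | `|x - a| <= r].
  have -> : [set x | `|x - a| <= r] = \bigcap_n [set x | f n x <= r + f n a].
    apply/seteqP; split=> x /=.
      by move=> /fnorm fr n _ /=; have := fr n; rewrite dualB// lerBlDr.
    by move=> fr; apply/fnorm => n; rewrite dualB// lerBlDr; exact: fr.
  by apply: AI => n; exact: Ahalf.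
apply: smallest_sub; first by split.
move=> U oU.
pose F (k j : nat) : set E :=
  if `[< [set x | `|x - D k| <= j.+1%:R^-1] `<=` U >]
  then [set x | `|x - D k| <= j.+1%:R^-1] else set0.
have -> : U = \bigcup_k \bigcup_j F k j.
  apply/seteqP; split=> [x Ux|x [k _ [j _]]]; last first.
    by rewrite /F; case: asboolP => // FU /FU.
  have /nbhs_ballP [e /= e0 xeU] : nbhs x U by exact: open_nbhs_nbhs.
  have [j je] : exists j : nat, j.+1%:R^-1 < e / 2.
    have := near_infty_natSinv_lt (PosNum (divr_gt0 e0 (@ltr0n R 2))).
    by move=> [j _ /(_ j (leqnn j))] ?; exists j.
  have [|k xk] := dD x j.+1%:R^-1; first by rewrite invr_gt0.
  exists k => //; exists j => //; rewrite /F; case: asboolP => [_|]; first exact: ltW.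
  case=> y /= yk; apply: xeU; rewrite -ball_normE /=.
  have : `|x - y| <= `|x - D k| + `|D k - y|.
    by rewrite -[X in `|X|](_ : (x - D k) + (D k - y) = _) ?ler_normD// addrA subrK.
  rewrite (distrC (D k)) => h; apply: (le_lt_trans h); move: xk yk je => /=.
  by set a := `|_ - _|; set b := `|_ - _|; set r := _^-1; lra.
apply: (AU) => k; apply: (AU) => j; rewrite /F; case: asboolP => _ //.
Qed.

(** Pettis's measurability criterion; the sets with measurable preimage form a
    sigma-algebra that contains the half-spaces. *)
Lemma weakly_measurable d (T : measurableType d) (f : T -> E) : separable E ->
  (forall g, dual g -> measurable_fun [set: T] (g \o f)) ->
  measurable_fun [set: T] (f : T -> borel E).
Proof.
move=> sE mf _ B mB; rewrite setTI.
apply: (@half_spaces_generate_borel [set B | measurable (f @^-1` B)]) => //.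
  split=> /=.
  - by rewrite preimage_set0.
  - by move=> A mA; rewrite setTD preimage_setC; exact: measurableC.
  - by move=> F mF; rewrite preimage_bigcup; exact: bigcupT_measurable.
move=> g c dg /=.
have := mf g dg measurableT `]-oo, c]%classic (measurable_itv _).
by rewrite setTI set_itvE.
Qed.

End separable_normed_spaces.

(** * Moments of real Gaussian variables *)

Section pointwise_derivatives.
Context (R : realType).
Implicit Types (f g : R -> R) (x a b : R).

Lemma is_derive_mul f g x a b : is_derive x (1 : R) f a -> is_derive x (1 : R) g b ->
  is_derive x (1 : R) (fun y => f y * g y) (a * g x + f x * b).
Proof.
move=> df dg; have H : is_derive x (1 : R) (fun y => f y * g y) _ := is_deriveM df dg.
by apply: (is_derive_eq H); rewrite /GRing.scale /= addrC [g x * a]mulrC.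
Qed.

Lemma is_derive_affine (c d x : R) : is_derive x (1 : R) (fun y => c * y + d) c.
Proof.
have H1 : is_derive x (1 : R) (fun y => c * y) (0 * x + c * 1).
  exact: (is_derive_mul (is_derive_cst _ _ _) (is_derive_id _ _)).
have H : is_derive x (1 : R) (fun y => c * y + d) (0 * x + c * 1 + 0).
  by apply: is_deriveD.
by apply: (is_derive_eq H); rewrite mul0r add0r mulr1 addr0.
Qed.

Lemma is_derive_expR_comp f x a : is_derive x (1 : R) f a ->
  is_derive x (1 : R) (fun y => expR (f y)) (a * expR (f x)).
Proof.
move=> df; have H : is_derive x (1 : R) (fun y => expR (f y)) (expR (f x) * a).
  exact: (@is_derive1_comp _ expR f).
by apply: (is_derive_eq H); rewrite mulrC.
Qed.

End pointwise_derivatives.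

Section normal_law.
Context (R : realType) (m s : R).
Hypothesis s0 : 0 < s.
Local Notation lam := (@lebesgue_measure R).
Local Notation N := (normal_prob m s).
Local Notation p := (normal_pdf m s).

Lemma normal_prob_RN (f : R -> R) :
  measurable_fun setT f -> N.-integrable setT (EFin \o f) ->
  (\int[N]_x (f x)%:E = \int[lam]_x (f x * p x)%:E)%E.
Proof.
move=> mf fi.
rewrite -(Radon_Nikodym_change_of_variables (normal_prob_dominates m s))//=.
apply: ae_eq_integral => //.
- apply: emeasurable_funM => //; first by apply/measurable_EFinP.
  apply: (measurable_int lam).
  by apply: Radon_Nikodym_integrable; exact: normal_prob_dominates.
- by apply/measurable_EFinP; apply: measurable_funM => //; exact: measurable_normal_pdf.
- under [X in ae_eq _ _ _ X]eq_fun do rewrite EFinM.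
  apply: ae_eqe_mul2l => /=.
  rewrite Radon_NikodymE//=; first exact: normal_prob_dominates.
  move=> dom.
  case: cid => /= h [h1 h2 h3].
  apply: integral_ae_eq => //=.
  + by apply/measurable_EFinP; exact: measurable_normal_pdf.
  + by move=> A _ mA; rewrite -h3.
Qed.

(** The formula for integrable functions extends by truncation; it is needed for
    exponentials before they are known to be integrable. *)
Lemma ge0_normal_prob_RN (f : R -> R) :
  measurable_fun setT f -> (forall x, 0 <= f x) ->
  (\int[N]_x (f x)%:E = \int[lam]_x (f x * p x)%:E)%E.
Proof.
move=> mf f0.
pose g n x := Num.min (f x) n%:R.
have mg n : measurable_fun setT (g n) by apply: measurable_minr.
have g0 n x : 0 <= g n x by rewrite le_min f0 ler0n.
have gi n : N.-integrable setT (EFin \o g n).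
  apply: (@le_integrable _ _ _ _ _ _ _ (EFin \o cst n%:R)) => //.
  - apply/measurable_EFinP. exact: mg.
  - move=> x _ /=; rewrite lee_fin !ger0_norm ?ler0n//.
    by rewrite ge_min lexx orbT.
  - exact: finite_measure_integrable_cst.
have gnd x : {homo g^~ x : a b / (a <= b)%N >-> a <= b}.
  by move=> a b ab; rewrite /g le_min !ge_min lexx/= ler_nat ab orbT.
have gf x : \forall n \near \oo, g n x = f x.
  near=> n; rewrite /g; apply/min_idPl.
  by near: n; exact: nbhs_infty_ger.
have gcvg x : (g n x)%:E @[n --> \oo] --> (f x)%:E.
  by apply: cvg_near_cst; apply: filterS (gf x) => n ->.
transitivity (limn (fun n => \int[N]_x (g n x)%:E)%E).
  have -> : (fun x => (f x)%:E) = (fun x => limn (fun n => (g n x)%:E)).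
    by apply/funext => x; apply/esym/cvg_lim => //.
  rewrite monotone_convergence//.
  - by move=> n; apply/measurable_EFinP; exact: mg.
  - by move=> n x _; rewrite lee_fin.
  - by move=> x _ a b ab; rewrite lee_fin gnd.
under eq_fun do rewrite normal_prob_RN//.
have p0 x : 0 <= p x by exact: normal_pdf_ge0.
have -> : (fun x => (f x * p x)%:E) = (fun x => limn (fun n => (g n x * p x)%:E)).
  apply/funext => x; apply/esym/cvg_lim => //.
  by apply: cvg_near_cst; apply: filterS (gf x) => n ->.
rewrite monotone_convergence//.
- by move=> n; apply/measurable_EFinP; apply: measurable_funM; [exact: mg|exact: measurable_normal_pdf].
- by move=> n x _; rewrite lee_fin mulr_ge0.
- by move=> x _ a b ab; rewrite lee_fin ler_wpM2r// gnd.
Unshelve. all: by end_near. Qed.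

(** The exponential factor shifts the mean of the normal density. *)
Lemma normal_expR (t : R) :
  (\int[N]_x (expR (t * x))%:E = (expR (t * m + t ^+ 2 * s ^+ 2 / 2))%:E)%E.
Proof.
rewrite ge0_normal_prob_RN; last 2 first.
- by apply: measurableT_comp => //; exact: measurable_funM.
- by move=> x; exact: expR_ge0.
have s0' : s != 0 by rewrite gt_eqF.
transitivity (\int[lam]_x ((expR (t * m + t ^+ 2 * s ^+ 2 / 2))%:E *
    (normal_pdf (m + t * s ^+ 2) s x)%:E))%E.
  apply: eq_integral => x _; rewrite -EFinM; congr EFin.
  rewrite !normal_pdfE// mulrCA [RHS]mulrCA; congr (_ * _).
  rewrite /normal_fun -!expRD; congr expR.
  by field.
rewrite integralZl//; last exact: integrable_normal_pdf.
by rewrite integral_normal_pdf mule1.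
Qed.

(** Functions of this growth are integrable, by the Laplace transform, and vanish
    at both ends when multiplied by the density; this is what integration by parts
    asks for. *)
Let growth (f : R -> R) := exists C, forall x, `|f x| <= C * (expR x + expR (- x)).

Lemma growth_integrable (f : R -> R) : measurable_fun setT f -> growth f ->
  N.-integrable setT (EFin \o f).
Proof.
move=> mf [C fC].
have ie (t : R) : N.-integrable setT (EFin \o (fun x => expR (t * x))).
  apply/integrableP; split.
    by apply/measurable_EFinP; apply: measurableT_comp => //; exact: measurable_funM.
  under eq_integral do rewrite /= ger0_norm ?expR_ge0//.
  by rewrite normal_expR ltry.
apply: (@le_integrable _ _ _ N setT measurableT (EFin \o f)
    (EFin \o (fun x => C * (expR (1 * x) + expR (-1 * x))))) => //.
- by apply/measurable_EFinP.
- move=> x _ /=; rewrite lee_fin mul1r mulN1r.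
  exact: le_trans (fC x) (ler_norm _).
  apply: (@integrableZl _ _ _ N setT measurableT C (EFin \o (fun x => expR (1 * x) + expR (-1 * x)))) => //=.
  by apply: (@integrableD _ _ _ N setT measurableT (fun x => (expR (1 * x))%:E)
    (fun x => (expR (-1 * x))%:E)); exact: ie.
Qed.

(** The inequality $(n - c - 1)^2 \ge 0$ replaces the quadratic exponent by an affine
    one, so that a geometric sequence dominates. *)
Lemma normal_pdf_cvg0 (c : R) : normal_pdf c s n%:R @[n --> \oo] --> (0 : R).
Proof.
have s0' : s != 0 by rewrite gt_eqF.
pose k := (s ^+ 2 *+ 2)^-1.
have k0 : 0 < k by rewrite invr_gt0 pmulrn_lgt0 ?exprn_gt0.
pose b n := normal_peak s * expR (k * (1 + 2 * c)) * expR (- (2 * k)) ^+ n.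
apply: (@squeeze_cvgr _ _ _ _ (cst 0) b); last 2 first.
- exact: cvg_cst.
- rewrite -(mulr0 (normal_peak s * expR (k * (1 + 2 * c)))).
  apply: cvgM; first exact: cvg_cst.
  apply: cvg_expr; rewrite ger0_norm ?expR_ge0// -expR0 ltr_expR.
  by rewrite oppr_lt0 mulr_gt0.
apply: nearW => n /=; rewrite normal_pdf_ge0/= normal_pdfE// /b -mulrA.
apply: ler_wpM2l; first exact: normal_peak_ge0.
rewrite /normal_fun -expRM_natl -expRD ler_expR -/k.
have : 0 <= k * (n%:R - c - 1) ^+ 2 by rewrite mulr_ge0 ?sqr_ge0 1?ltW.
by move=> h; rewrite -subr_ge0 (_ : _ - _ = k * (n%:R - c - 1) ^+ 2)//; ring.
Qed.

Lemma normal_pdfN (c x : R) : normal_pdf c s (- x) = normal_pdf (- c) s x.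
Proof.
have s0' : s != 0 by rewrite gt_eqF.
rewrite !normal_pdfE// /normal_fun.
by rewrite (_ : - x - c = - (x - - c)) ?sqrrN// opprD !opprK.
Qed.

(** An exponential times the density is a multiple of a shifted density. *)
Lemma growth_vanish (G : R -> R) : growth G ->
  G n%:R * p n%:R @[n --> \oo] --> (0 : R) /\
  G (- n%:R) * p (- n%:R) @[n --> \oo] --> (0 : R).
Proof.
move=> [C GC].
have s0' : s != 0 by rewrite gt_eqF.
have tilt (t x : R) : expR (t * x) * p x =
    expR (t * m + t ^+ 2 * s ^+ 2 / 2) * normal_pdf (m + t * s ^+ 2) s x.
  rewrite !normal_pdfE// mulrCA [RHS]mulrCA; congr (_ * _).
  by rewrite /normal_fun -!expRD; congr expR; field.
pose B x := C * (expR (1 * m + 1 ^+ 2 * s ^+ 2 / 2) * normal_pdf (m + 1 * s ^+ 2) s x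
  + expR (-1 * m + (-1) ^+ 2 * s ^+ 2 / 2) * normal_pdf (m + -1 * s ^+ 2) s x).
have GB x : `|G x * p x| <= B x.
  have -> : B x = C * (expR x + expR (- x)) * p x.
    by rewrite /B -(tilt 1 x) -(tilt (-1) x) mul1r mulN1r -mulrDl mulrA.
  rewrite normrM (ger0_norm (normal_pdf_ge0 m s x)).
  by apply: ler_wpM2r (GC x); exact: normal_pdf_ge0.
have vanish (a b c1 c2 : R) (F : nat -> R) :
    (forall n, `|F n| <= C * (a * normal_pdf c1 s n%:R + b * normal_pdf c2 s n%:R)) ->
    F n @[n --> \oo] --> (0 : R).
  move=> FB.
  pose D n := C * (a * normal_pdf c1 s n%:R + b * normal_pdf c2 s n%:R).
  have D0 : D n @[n --> \oo] --> (0 : R).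
    have -> : (0 : R) = C * (a * 0 + b * 0) by rewrite !mulr0 addr0 mulr0.
    apply: cvgM; first exact: cvg_cst.
    by apply: (@cvgD _ R^o); apply: cvgM; [exact: cvg_cst|exact: normal_pdf_cvg0|
      exact: cvg_cst|exact: normal_pdf_cvg0].
  apply: (@squeeze_cvgr _ _ _ _ (fun n => - D n) D) => //.
    by apply: nearW => n; rewrite -ler_norml; exact: FB.
  by rewrite -(oppr0 R); apply: (@cvgN _ R^o).
split; first by apply: vanish => n; exact: GB.
apply: vanish => n; apply: (le_trans (GB _)).
by rewrite /B !normal_pdfN.
Qed.

(** The fundamental theorem of calculus on $[-n, n]$ and dominated convergence. *)
Lemma integral_derive_eq0 (F f : R -> R) :
  (forall x, is_derive x (1 : R) F (f x)) -> continuous f ->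
  lam.-integrable setT (EFin \o f) ->
  F n%:R @[n --> \oo] --> (0 : R) -> F (- n%:R) @[n --> \oo] --> (0 : R) ->
  (\int[lam]_x (f x)%:E = 0)%E.
Proof.
move=> dF cf fi Fp Fn.
have cF : continuous F.
  move=> x; apply: differentiable_continuous; apply/derivable1_diffP.
  by have [] := dF x.
have FTC (n : nat) : (\int[lam]_(x in `[(- n.+1%:R)%R, n.+1%:R]) (f x)%:E =
    (F n.+1%:R)%:E - (F (- n.+1%:R))%:E)%E.
  apply: continuous_FTC2.
  - by have : (0 : R) < n.+1%:R by []; lra.
  - exact: continuous_subspaceT.
  - split.
    + by move=> x _; have [] := dF x.
    + exact/cvg_at_right_filter/cF.
    + exact/cvg_at_left_filter/cF.
  - by move=> x _; rewrite derive1E; have [_ ->] := dF x.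
pose h (n : nat) x := (f x * \1_(`[- n.+1%:R, n.+1%:R]%classic : set R) x)%:E.
have mf : measurable_fun setT (EFin \o f) by exact: measurable_int fi.
have mh n : measurable_fun setT (h n).
  by apply/measurable_EFinP/measurable_funM; first exact/measurable_EFinP.
have [] := @dominated_convergence _ _ _ lam setT measurableT h (EFin \o f) (abse \o (EFin \o f)) mh mf.
- apply: aeW => x _ /=; apply: cvg_near_cst.
  near=> n; congr EFin; rewrite indicE mem_set ?mulr1//= in_itv/= -ler_norml.
  apply: (@le_trans _ _ n%:R); last by rewrite ler_nat.
  by near: n; exact: nbhs_infty_ger.
- exact: integrable_abse.
- apply: aeW => x n _ /=; rewrite lee_fin normrM ler_piMr//.
  by rewrite indicE; case: (_ \in _); rewrite ?normr1 ?normr0.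
move=> _ _ L1; apply: (cvg_unique _ L1) => //.
have hF n : (\int[lam]_x h n x = (F n.+1%:R - F (- n.+1%:R))%:E)%E.
  rewrite EFinB -FTC [RHS]integral_mkcond.
  apply: eq_integral => x _; rewrite /h patchE indicE.
  by case: (_ \in _); rewrite ?mulr1 ?mulr0.
rewrite (_ : (fun n => _) = (fun n => (F n.+1%:R - F (- n.+1%:R))%:E)); last first.
  by apply/funext => n; exact: hF.
apply: cvg_EFin; first by apply: nearW.
rewrite -(subr0 (0 : R)); apply: (@cvgB _ R^o).
  exact: (cvg_comp _ _ (cvg_addnl 1) Fp).
exact: (cvg_comp _ _ (cvg_addnl 1) Fn).
Unshelve. all: by end_near. Qed.

(** Stein's identity: the derivative of the product of G and the density has zero
    total mass. *)
Lemma normal_ibp (G g : R -> R) :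
  (forall x, is_derive x (1 : R) G (g x)) -> continuous g ->
  growth G -> growth g -> growth (fun x => (x - m) * G x) ->
  (\int[N]_x ((x - m) * G x) = s ^+ 2 * \int[N]_x (g x))%R.
Proof.
move=> dG cg gG gg gmG.
have cG : continuous G.
  move=> x; apply: differentiable_continuous; apply/derivable1_diffP.
  by have [] := dG x.
have s0' : s != 0 by rewrite gt_eqF.
have dp x : is_derive x (1 : R) p (- (x - m) / s ^+ 2 * p x).
  have -> : p = fun y => normal_peak s *
      expR (- (s ^+ 2 *+ 2)^-1 * ((1 * y + - m) * (1 * y + - m)) ).
    apply/funext => y; rewrite normal_pdfE// /normal_fun; congr (_ * expR _).
    by rewrite mul1r mulNr mulrC mulNr.
  have A := is_derive_affine 1 (- m) x.
  have B := is_derive_mul (is_derive_cst (- (s ^+ 2 *+ 2)^-1) x 1) (is_derive_mul A A).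
  have D := is_derive_mul (is_derive_cst (normal_peak s) x 1) (is_derive_expR_comp B).
  apply: (is_derive_eq D).
  rewrite /= !mul0r !add0r -[s ^+ 2 *+ 2]mulr_natr; set e := expR _.
  by field.
pose h x := g x - s ^- 2 * ((x - m) * G x).
have gh : growth h.
  move: gg gmG => [C1 gC] [C2 mGC]; exists (C1 + s ^- 2 * C2) => x.
  rewrite mulrDl; apply: (le_trans (ler_normB _ _)); apply: lerD => //.
  have k0 : 0 <= s ^- 2 by rewrite invr_ge0 sqr_ge0.
  by rewrite normrM -mulrA (ger0_norm k0); exact: ler_wpM2l.
have cmG : continuous (fun x => (x - m) * G x).
  move=> x; apply: cvgM; last exact: cG.
  by apply: (@cvgB _ R^o); [exact: cvg_id|exact: cvg_cst].
have ch : continuous h.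
  move=> x; apply: (@cvgB _ R^o); first exact: cg.
  by apply: cvgM; [exact: cvg_cst | exact: cmG].
have mh := continuous_measurable_fun ch.
have hN := growth_integrable mh gh.
have hp : lam.-integrable setT (EFin \o (fun x => h x * p x)).
  apply/integrableP; split.
    by apply/measurable_EFinP/measurable_funM => //; exact: measurable_normal_pdf.
  have [_] := integrableP _ _ _ hN.
  rewrite [X in (X < _)%E](_ : _ = \int[N]_x (`|h x|)%:E)%E; last by apply: eq_integral.
  rewrite ge0_normal_prob_RN//; last exact: measurableT_comp.
  congr (_ < _)%E; apply: eq_integral => x _ /=.
  by rewrite normrM (ger0_norm (normal_pdf_ge0 _ _ _)).
have [v1 v2] := growth_vanish gG.
have dF x : is_derive x (1 : R) (fun x => G x * p x) (h x * p x).
  apply: (is_derive_eq (is_derive_mul (dG x) (dp x))).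
  by rewrite /h; field.
have chp : continuous (fun x => h x * p x).
  by move=> x; apply: cvgM; [exact: ch|exact: continuous_normal_pdf].
have h0 := integral_derive_eq0 dF chp hp v1 v2.
have gi := growth_integrable (continuous_measurable_fun cg) gg.
have mGi := growth_integrable (continuous_measurable_fun cmG) gmG.
have : \int[N]_x h x = 0 by rewrite /Rintegral normal_prob_RN// h0.
rewrite RintegralB//; last first.
  exact: (@integrableZl _ _ _ N setT measurableT (s ^- 2) _ mGi).
rewrite RintegralZl// => /subr0_eq ->.
by rewrite mulrA mulfV ?mul1r// expf_neq0.
Qed.

(** Since $e^y \ge (1 + y/2)^2$ for $y \ge 0$. *)
Lemma quadratic_growth (f : R -> R) (A : R) :
  (forall x, `|f x| <= A * (1 + x ^+ 2)) -> growth f.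
Proof.
move=> fA.
have D2 (x : R) : 1 + x ^+ 2 <= 5 * (expR x + expR (- x)).
  have e (y : R) : 0 <= y -> 1 + y + y ^+ 2 / 4 <= expR y.
    move=> y0; have -> : expR y = expR (y / 2) ^+ 2.
      by rewrite -expRM_natl; congr expR; field.
    apply: (@le_trans _ _ ((1 + y / 2) ^+ 2)).
      by rewrite [leRHS](_ : _ = 1 + y + y ^+ 2 / 4)//; field.
    by rewrite ler_pXn2r ?nnegrE ?expR_ge0 ?expR_ge1Dx// addr_ge0// divr_ge0.
  have := expR_ge0 x; have := expR_ge0 (- x).
  have [x0|x0] := leP 0 x; first by have := e _ x0; nra.
  have := e (- x); rewrite sqrrN oppr_ge0 => /(_ (ltW x0)); nra.
exists (5 * `|A|) => x; apply: (le_trans (fA x)).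
apply: (@le_trans _ _ (`|A| * (1 + x ^+ 2))).
  by apply: ler_wpM2r; [rewrite addr_ge0// sqr_ge0|exact: ler_norm].
by rewrite -mulrA mulrCA; exact: ler_wpM2l.
Qed.

Let centered_bound (x : R) : `|x - m| <= (2 + 2 * m ^+ 2) * (1 + x ^+ 2).
Proof.
have : `|x - m| <= 1 + (x - m) ^+ 2.
  by rewrite -[X in _ <= 1 + X]real_normK ?num_real//; have := sqr_ge0 (`|x - m| - 1); nra.
have := sqr_ge0 (x + m); have := sqr_ge0 m; have := sqr_ge0 x; nra.
Qed.

Let centered_sqr_bound (x : R) : `|(x - m) * (x - m)| <= (2 + 2 * m ^+ 2) * (1 + x ^+ 2).
Proof.
rewrite -expr2 ger0_norm ?sqr_ge0//.
have := sqr_ge0 (x + m); have := sqr_ge0 m; have := sqr_ge0 x; nra.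
Qed.

Let centered_mul_bound (f : R -> R) : (forall x, `|f x| <= 1) ->
  growth (fun x => (x - m) * f x).
Proof.
move=> f1; apply: quadratic_growth => x; apply: le_trans (centered_bound x).
by rewrite normrM ler_piMr.
Qed.

Let bounded_growth (f : R -> R) (C : R) : (forall x, `|f x| <= C) -> growth f.
Proof.
move=> fC; apply: (@quadratic_growth _ C) => x; apply: (le_trans (fC x)).
have C0 : 0 <= C := le_trans (normr_ge0 _) (fC x).
by rewrite mulrDr mulr1 lerDl mulr_ge0// sqr_ge0.
Qed.

Lemma normal_mean : \int[N]_x (x - m) = 0.
Proof.
have d1 (x : R) : is_derive x (1 : R) (fun _ : R => 1 : R) (0 : R) by exact: is_derive_cst.
have c0 : continuous (fun _ : R => 0 : R) by move=> x; exact: cvg_cst.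
have g1 : growth (fun _ : R => 1 : R) by apply: (@bounded_growth _ 1) => x; rewrite normr1.
have g0 : growth (fun _ : R => 0 : R) by apply: (@bounded_growth _ 1) => x; rewrite normr0.
have := normal_ibp d1 c0 g1 g0; rewrite Rintegral_cst// mul0r mulr0.
under eq_Rintegral do rewrite mulr1.
by apply; apply: centered_mul_bound => x; rewrite normr1.
Qed.

Lemma normal_variance : \int[N]_x ((x - m) * (x - m)) = s ^+ 2.
Proof.
have d1 (x : R) : is_derive x (1 : R) (fun x : R => x - m) (1 : R).
  have -> : (fun y : R => y - m) = (fun y => 1 * y + - m).
    by apply/funext => y; rewrite mul1r.
  exact: is_derive_affine.
have c1 : continuous (fun _ : R => 1 : R) by move=> x; exact: cvg_cst.
have g1 : growth (fun _ : R => 1 : R) by apply: (@bounded_growth _ 1) => x; rewrite normr1.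
have := normal_ibp d1 c1 (quadratic_growth centered_bound) g1
  (quadratic_growth centered_sqr_bound).
have N1 : N setT = 1%E by exact: integral_normal_pdf.
by rewrite Rintegral_cst// mul1r /= N1 mulr1.
Qed.

Lemma normal_integrable_sqr : N.-integrable setT (EFin \o (fun x => x ^+ 2)).
Proof.
apply: growth_integrable; first exact: measurable_funX.
by apply: (@quadratic_growth _ 1) => x; rewrite ger0_norm ?sqr_ge0// mul1r lerDr.
Qed.

Lemma normal_integrable_id : N.-integrable setT (EFin \o id).
Proof.
apply: growth_integrable => //.
apply: (@quadratic_growth _ 1) => x; rewrite mul1r /=.
by rewrite -[X in _ <= 1 + X]real_normK ?num_real//; have := sqr_ge0 (`|x| - 1); nra.
Qed.

Let measurable_dilate (k : R -> R) (b : R) : continuous k ->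
  measurable_fun setT (fun x : R => k (b * (x - m))).
Proof.
move=> ck; apply: (measurableT_comp (continuous_measurable_fun ck)).
by apply: measurable_funM => //; exact: measurable_funB.
Qed.

(** Here k stands for cos or sin, which both satisfy $k'' = -k$.  By differentiation
    under the integral sign and Stein's identity, $b \mapsto \mathbb{E}\,k(b(x - m))$
    solves $y' = -s^2 b\,y$. *)
Let normal_char_ode (k k' : R -> R) :
  (forall x, is_derive x (1 : R) k (k' x)) ->
  (forall x, is_derive x (1 : R) k' (- k x)) ->
  (forall x, `|k x| <= 1) -> (forall x, `|k' x| <= 1) ->
  \int[N]_x k (x - m) = k 0 * expR (- s ^+ 2 / 2).
Proof.
move=> dk dk' k1 k'1.
have ck : continuous k.
  move=> x; apply: differentiable_continuous; apply/derivable1_diffP.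
  by have [] := dk x.
have ck' : continuous k'.
  move=> x; apply: differentiable_continuous; apply/derivable1_diffP.
  by have [] := dk' x.
pose K b := \int[N]_x k (b * (x - m)).
have intabs : N.-integrable setT (EFin \o (fun x : R => `|x - m|)).
  apply: growth_integrable; first by apply: measurableT_comp => //; exact: measurable_funB.
  by apply: quadratic_growth => x; rewrite normr_id; exact: centered_bound.
have dxm (b x : R) : is_derive x (1 : R) (fun x => b * (x - m)) b.
  have -> : (fun y : R => b * (y - m)) = (fun y => b * y + - (b * m)).
    by apply/funext => y; rewrite mulrBr.
  exact: is_derive_affine.
have dbx (b y : R) : is_derive b (1 : R) (fun b => k (b * y)) (k' (b * y) * y).
  have A : is_derive b (1 : R) (fun b => b * y) y.
    have := is_derive_affine y 0 b.
    by rewrite (_ : (fun z => _) = (fun b => b * y))//; apply/funext => z; rewrite addr0 mulrC.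
  exact: (@is_derive1_comp _ k (fun b => b * y)).
have dK (b : R) : is_derive b (1 : R) K (- (s ^+ 2 * b * K b)).
  have Ib : (`]b - 1, b + 1[%classic : set R) b by rewrite /= in_itv/=; lra.
  have iK x : (`]b - 1, b + 1[%classic : set R) x ->
      N.-integrable setT (EFin \o (fun y : R => k (x * (y - m)))).
    move=> _; apply: growth_integrable; first exact: measurable_dilate.
    by apply: (@bounded_growth _ 1) => y.
  have derK (x y : R) : (`]b - 1, b + 1[%classic : set R) x -> setT y ->
      derivable (fun x : R => k (x * (y - m))) x 1.
    by move=> _ _; have [] := dbx x (y - m).
  have ub (x y : R) : (`]b - 1, b + 1[%classic : set R) x -> setT y ->
     `|partial1of2 (fun x y => k (x * (y - m))) x y| <= `|y - m|.
    move=> _ _; rewrite partial1of2E; have [_ ->] := dbx x (y - m).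
    by rewrite normrM ler_piMl.
  split; first exact: (derivable_under_integral measurableT Ib iK derK _ intabs ub).
  rewrite -derive1E (differentiation_under_integral measurableT Ib iK derK _ intabs ub)//.
  transitivity (\int[N]_x ((x - m) * k' (b * (x - m)))).
    apply: eq_Rintegral => x _; rewrite partial1of2E.
    by have [_ ->] := dbx b (x - m); rewrite mulrC.
  have dG (x : R) : is_derive x (1 : R) (fun x => k' (b * (x - m))) (- b * k (b * (x - m))).
    have H : is_derive x (1 : R) (fun x => k' (b * (x - m))) (- k (b * (x - m)) * b).
      exact: (@is_derive1_comp _ k' (fun x => b * (x - m))).
    by apply: (is_derive_eq H); rewrite mulrC mulrN mulNr.
  rewrite (normal_ibp dG); last 4 first.
  - move=> x; apply: cvgM; first exact: cvg_cst.
    apply: (@continuous_comp _ _ _ (fun x : R => b * (x - m)) k); last exact: ck.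
    apply: differentiable_continuous; apply/derivable1_diffP.
    by have [] := dxm b x.
  - exact: (@bounded_growth _ 1).
  - apply: (@bounded_growth _ `|b|) => x.
    by rewrite normrM normrN ler_piMr.
  - exact: centered_mul_bound.
  rewrite RintegralZl//; last exact: iK.
  by rewrite -/(K b); ring.
pose H b := K b * expR (s ^+ 2 / 2 * b * b).
have dH (b : R) : is_derive b (1 : R) H 0.
  have A := is_derive_affine (s ^+ 2 / 2) 0 b.
  have B := is_derive_mul A (is_derive_id b 1).
  have D := is_derive_mul (dK b) (is_derive_expR_comp B).
  have -> : H = fun y => K y * expR ((s ^+ 2 / 2 * y + 0) * id y).
    by apply/funext => y; rewrite addr0.
  by apply: (is_derive_eq D); rewrite /= addr0; set e := expR _; field.
have := is_derive_0_is_cst 1 0 dH; rewrite /H !mulr0 expR0 !mulr1.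
have -> : K 0 = k 0.
  have N1 : N setT = 1%E by exact: integral_normal_pdf.
  rewrite /K; under eq_Rintegral do rewrite mul0r.
  by rewrite Rintegral_cst//= N1 mulr1.
have -> : K 1 = \int[N]_x k (x - m) by apply: eq_Rintegral => x _; rewrite mul1r.
by move=> <-; rewrite -mulrA -expRD mulNr subrr expR0 mulr1.
Qed.

Lemma normal_char : \int[N]_x cos (x - m) = expR (- s ^+ 2 / 2) /\
  \int[N]_x sin (x - m) = 0.
Proof.
split.
  rewrite (@normal_char_ode _ (fun x => - sin x)) ?cos0 ?mul1r//.
  - by move=> x; exact: cos_max.
  - by move=> x; rewrite normrN sin_max.
rewrite (@normal_char_ode _ cos) ?sin0 ?mul0r//.
- by move=> x; exact: sin_max.
- by move=> x; exact: cos_max.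
Qed.

End normal_law.

Section gaussian_variables.
Context (R : realType).

(** The facts about a real Gaussian law that matter here, in a form that also
    covers point masses. *)
Definition gaussian_moments d (T : measurableType d) (P : probability T R)
    (Z : T -> R) (m v : R) : Prop :=
  [/\ [/\ 0 <= v, P.-integrable setT (EFin \o Z) &
          P.-integrable setT (EFin \o (fun x => Z x ^+ 2))],
      \int[P]_x Z x = m /\ \int[P]_x (Z x ^+ 2) = m ^+ 2 + v,
      (\int[P]_x (expR (Z x))%:E = (expR (m + v / 2))%:E)%E &
      \int[P]_x cos (Z x - m) = expR (- v / 2) /\ \int[P]_x sin (Z x - m) = 0].

Lemma normal_gaussian_moments (m s : R) : 0 < s ->
  gaussian_moments (normal_prob m s) id m (s ^+ 2).
Proof.
move=> s0; have i1 := normal_integrable_id m s0; have i2 := normal_integrable_sqr m s0.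
have ic : (normal_prob m s).-integrable setT (EFin \o cst m).
  exact: finite_measure_integrable_cst.
have N1 : normal_prob m s setT = 1%E by exact: integral_normal_pdf.
have cstE (c : R) : \int[normal_prob m s]_x (cst c x) = c.
  by rewrite Rintegral_cst//= N1 mulr1.
have mean : \int[normal_prob m s]_x x = m.
  have := normal_mean m s0; rewrite RintegralB// => /subr0_eq ->.
  exact: cstE.
split.
- by split => //; exact: sqr_ge0.
- split => //.
  have := normal_variance m s0.
  have -> : \int[normal_prob m s]_x ((x - m) * (x - m)) =
      \int[normal_prob m s]_x ((x ^+ 2 - (2 * m) * x) + cst (m ^+ 2) x).
    by apply: eq_Rintegral => x _ /=; ring.
  have i3 := integrable_scale (2 * m) i1.
  have i4 := integrable_sub i2 i3.
  have i5 : (normal_prob m s).-integrable setT (EFin \o cst (m ^+ 2)).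
    exact: finite_measure_integrable_cst.
  rewrite RintegralD// RintegralB//.
  rewrite RintegralZl// mean cstE => h.
  by apply/eqP; rewrite addrC -subr_eq; apply/eqP; rewrite -h; ring.
- rewrite (_ : m + s ^+ 2 / 2 = 1 * m + 1 ^+ 2 * s ^+ 2 / 2); last first.
    by rewrite mul1r expr1n mul1r.
  rewrite -normal_expR//.
  by apply: eq_integral => x _; rewrite mul1r.
- exact: normal_char.
Qed.

Lemma dirac_gaussian_moments (m : R) :
  gaussian_moments (@dirac _ (measurableTypeR R) m R : probability _ R) id m 0.
Proof.
have E (f : R -> R) : measurable_fun setT f ->
    \int[@dirac _ (measurableTypeR R) m R]_x f x = f m.
  move=> mf; rewrite /Rintegral integral_dirac//; last exact/measurable_EFinP.
  by rewrite diracT mul1e.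
have I (f : R -> R) : measurable_fun setT f ->
    (@dirac _ (measurableTypeR R) m R).-integrable setT (EFin \o f).
  move=> mf; apply/integrableP; split; first exact/measurable_EFinP.
  rewrite integral_dirac//; last by apply: measurableT_comp => //; exact/measurable_EFinP.
  by rewrite diracT mul1e ltry.
split.
- by split => //; apply: I => //; exact: measurable_funX.
- by rewrite !E// addr0.
- rewrite integral_dirac//; last by apply/measurable_EFinP; exact: measurable_expR.
  by rewrite diracT mul1e mul0r addr0.
- rewrite !E//; first by rewrite subrr cos0 sin0 oppr0 mul0r expR0.
  + apply: (measurableT_comp (continuous_measurable_fun (@continuous_sin R))).
    exact: measurable_funB.
  + apply: (measurableT_comp (continuous_measurable_fun (@continuous_cos R))).
    exact: measurable_funB.
Qed.

Lemma real_gaussian_moments d (T : measurableType d) (P : probability T R) (Z : T -> R) :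
  measurable_fun setT Z -> real_gaussian P Z -> exists m v, gaussian_moments P Z m v.
Proof.
move=> mZ gZ.
have transfer (nu : probability (measurableTypeR R) R) m v :
    (forall A, measurable A -> nu A = P (Z @^-1` A)) ->
    gaussian_moments nu id m v -> gaussian_moments P Z m v.
  move=> PZ.
  have mB : measurable_fun setT (fun x : R => x - m) by exact: measurable_funB.
  have mcos := measurableT_comp (continuous_measurable_fun (@continuous_cos R)) mB.
  have msin := measurableT_comp (continuous_measurable_fun (@continuous_sin R)) mB.
  have m2 : measurable_fun setT (fun x : R => x ^+ 2) by exact: measurable_funX.
  have L := @Rintegral_law _ _ T (measurableTypeR R) R P nu Z mZ PZ.
  have I := @integrable_law _ _ T (measurableTypeR R) R P nu Z mZ PZ.
  have G := @ge0_integral_law _ _ T (measurableTypeR R) R P nu Z mZ PZ.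
  move=> [[v0 i1 i2] [e1 e2] e3 [e4 e5]]; split.
  - split=> //; first exact: (I id _).1.
    exact: (I (fun x => x ^+ 2) _).1.
  - by rewrite -(L id)// -(L (fun x => x ^+ 2)).
  - rewrite -(G (EFin \o @expR R))//; last by move=> x; rewrite lee_fin expR_ge0.
    by apply/measurable_EFinP; exact: measurable_expR.
  - rewrite -(L (fun x => cos (x - m)))//; last first.
      by apply: (@integrable_bounded _ _ _ _ _ 1) => // x; exact: cos_max.
    rewrite -(L (fun x => sin (x - m)))//.
    by apply: (@integrable_bounded _ _ _ _ _ 1) => // x; exact: sin_max.
case: gZ => m [Zd|[s s0 Zn]].
- exists m, 0; have := @transfer (@dirac _ (measurableTypeR R) m R : probability (measurableTypeR R) R) m 0.
  apply=> [A mA|]; rewrite ?Zd//; exact: dirac_gaussian_moments.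
- exists m, (s ^+ 2); have := @transfer (normal_prob m s) m (s ^+ 2).
  by apply=> [A mA|]; rewrite ?Zn//; exact: normal_gaussian_moments.
Qed.

End gaussian_variables.

(** * Uniqueness of characteristic functionals *)

Section sign_iteration.
Context (R : realType).
Implicit Types w : R.

(** A polynomial map of [-1, 1] with attracting fixed points -1 and 1: its
    iterates converge to the sign function, so that the sign of a bounded
    function is a bounded pointwise limit of polynomials in that function. *)
Definition smoothstep w : R := (3 * w - w ^+ 3) / 2.

Lemma smoothstep_itv w : `|w| <= 1 -> `|smoothstep w| <= 1.
Proof.
rewrite !ler_norml /smoothstep => /andP[wl wr].
have h1 : 0 <= (1 - w) ^+ 2 * (2 + w) by rewrite mulr_ge0 ?sqr_ge0//; lra.
have h2 : 0 <= (1 + w) ^+ 2 * (2 - w) by rewrite mulr_ge0 ?sqr_ge0//; lra.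
by apply/andP; split; lra.
Qed.

Lemma iter_smoothstep_itv n w : `|w| <= 1 -> `|iter n smoothstep w| <= 1.
Proof. by move=> w1; elim: n => //= n; exact: smoothstep_itv. Qed.

Lemma iter_smoothstepN n w : iter n smoothstep (- w) = - iter n smoothstep w.
Proof. by elim: n => //= n ->; rewrite /smoothstep; ring. Qed.

(** From a starting point $w$ in $(0, 1]$ the iterates $a$ stay above $w$, and a step
    multiplies $1 - a$ by $(1 - a)(2 + a)/2 \le 1 - w/2$. *)
Lemma cvg_iter_smoothstep w : `|w| <= 1 ->
  iter n smoothstep w @[n --> \oo] --> Num.sg w.
Proof.
have pos v : 0 < v -> `|v| <= 1 -> iter n smoothstep v @[n --> \oo] --> (1 : R).
  move=> v0 v1; pose q := 1 - v / 2.
  have v1' : v <= 1 by rewrite -(gtr0_norm v0).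
  have bounds n : v <= iter n smoothstep v /\ 1 - q ^+ n <= iter n smoothstep v.
    elim: n => [|n [IH1 IH2]] /=; first by rewrite expr0 subrr; split=> //; exact: ltW.
    have := iter_smoothstep_itv n v1.
    move: IH1 IH2; set a := iter n _ _ => av aq; rewrite ler_norml => /andP[_ a1].
    split; first by rewrite /smoothstep; nra.
    have -> : smoothstep a = 1 - (1 - a) * ((1 - a) * (2 + a) / 2).
      by rewrite /smoothstep; field.
    rewrite lerD2l lerN2 exprSr.
    apply: ler_pM; rewrite ?subr_ge0//; first by nra.
      by rewrite lerBlDr -lerBlDl.
    by rewrite /q; nra.
  apply: (@squeeze_cvgr _ _ _ _ (fun n => 1 - q ^+ n) (cst 1)).
  - apply: nearW => n; rewrite (bounds n).2 /=.
    by have := iter_smoothstep_itv n v1; rewrite ler_norml => /andP[].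
  - rewrite -[X in _ --> X]subr0; apply: (@cvgB _ R^o); first exact: cvg_cst.
    by apply: cvg_expr; rewrite /q ger0_norm; lra.
  - exact: cvg_cst.
move=> w1; have [w0|w0|->] := ltgtP w 0.
- rewrite ltr0_sg//.
  have -> : (fun n => iter n smoothstep w) = (fun n => - iter n smoothstep (- w)).
    by apply/funext => n; rewrite iter_smoothstepN opprK.
  by apply: (@cvgN _ R^o); apply: pos; rewrite ?oppr_gt0 ?normrN.
- by rewrite gtr0_sg//; exact: pos.
- rewrite sgr0.
  have -> : (fun n => iter n smoothstep (0 : R)) = cst 0.
    by apply/funext => n; elim: n => //= n ->; rewrite /smoothstep /= mulr0 expr0n /= subrr mul0r.
  exact: cvg_cst.
Qed.

End sign_iteration.

Section char_fun_uniqueness.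
Context d (T : measurableType d) (R : realType) (P Q : probability T R).
Variable F : set (T -> R).
Hypothesis F_measurable : forall f, F f -> measurable_fun setT f.
Hypothesis FD : forall f g, F f -> F g -> F (fun x => f x + g x).
Hypothesis FZ : forall (c : R) f, F f -> F (fun x => c * f x).
Hypothesis PQ : forall f, F f ->
  \int[P]_x cos (f x) = \int[Q]_x cos (f x) /\
  \int[P]_x sin (f x) = \int[Q]_x sin (f x).

Definition bounded_measurable (u : T -> R) : Prop :=
  measurable_fun setT u /\ exists C, forall x, `|u x| <= C.

Local Notation bm := bounded_measurable.

Let agree (h : T -> R) : Prop := [/\ bm h,
  forall f, F f -> \int[P]_x (h x * cos (f x)) = \int[Q]_x (h x * cos (f x)) &
  forall f, F f -> \int[P]_x (h x * sin (f x)) = \int[Q]_x (h x * sin (f x))].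

(** Multiplication by such a u preserves the coincidence of all the integrals
    against the trigonometric functions of F.  These multipliers form an algebra
    closed under bounded pointwise limits; it contains the trigonometric functions
    of F, hence also the indicators of the sets that F generates. *)
Definition multiplier (u : T -> R) : Prop :=
  bm u /\ forall h, agree h -> agree (fun x => h x * u x).

Let bmM u v : bm u -> bm v -> bm (fun x => u x * v x).
Proof.
move=> [mu [C uC]] [mv [D vD]]; split; first exact: measurable_funM.
by exists (C * D) => x; rewrite normrM; apply: ler_pM.
Qed.

Let bmD u v : bm u -> bm v -> bm (fun x => u x + v x).
Proof.
move=> [mu [C uC]] [mv [D vD]]; split; first exact: measurable_funD.
by exists (C + D) => x; rewrite (le_trans (ler_normD _ _))// lerD.
Qed.

Let bm_cst (c : R) : bm (fun=> c).
Proof. by split=> //; exists `|c|. Qed.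

Let bm_cos f : F f -> bm (fun x => cos (f x)).
Proof.
move=> Ff; split; last by exists 1 => x; exact: cos_max.
exact: (measurableT_comp (continuous_measurable_fun (@continuous_cos R)) (F_measurable Ff)).
Qed.

Let bm_sin f : F f -> bm (fun x => sin (f x)).
Proof.
move=> Ff; split; last by exists 1 => x; exact: sin_max.
exact: (measurableT_comp (continuous_measurable_fun (@continuous_sin R)) (F_measurable Ff)).
Qed.

Let bm_integrable (S : probability T R) u : bm u -> S.-integrable setT (EFin \o u).
Proof. by move=> [mu [C uC]]; exact: integrable_bounded mu uC. Qed.

Let FB f g : F f -> F g -> F (fun x => f x - g x).
Proof.
move=> Ff Fg; have := FD Ff (FZ (-1) Fg).
by under eq_fun do rewrite mulN1r.
Qed.

Let intD (S : probability T R) u v : bm u -> bm v ->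
  \int[S]_x (u x + v x) = \int[S]_x u x + \int[S]_x v x.
Proof. by move=> bu bv; rewrite RintegralD//; exact: bm_integrable. Qed.

Let agreeD h k : agree h -> agree k -> agree (fun x => h x + k x).
Proof.
move=> [bh h1 h2] [bk k1 k2]; split=> [|f Ff|f Ff]; first exact: bmD.
- have bhc := bmM bh (bm_cos Ff); have bkc := bmM bk (bm_cos Ff).
  have e : (fun x => (h x + k x) * cos (f x)) = (fun x => h x * cos (f x) + k x * cos (f x)).
    by apply/funext => x; rewrite mulrDl.
  by rewrite e (intD P bhc bkc) (intD Q bhc bkc) (h1 _ Ff) (k1 _ Ff).
- have bhc := bmM bh (bm_sin Ff); have bkc := bmM bk (bm_sin Ff).
  have e : (fun x => (h x + k x) * sin (f x)) = (fun x => h x * sin (f x) + k x * sin (f x)).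
    by apply/funext => x; rewrite mulrDl.
  by rewrite e (intD P bhc bkc) (intD Q bhc bkc) (h2 _ Ff) (k2 _ Ff).
Qed.

Let agreeZ (c : R) h : agree h -> agree (fun x => h x * c).
Proof.
move=> [bh h1 h2]; split=> [|f Ff|f Ff]; first exact: bmM.
- have bhc S := bm_integrable S (bmM bh (bm_cos Ff)).
  have e : (fun x => h x * c * cos (f x)) = (fun x => c * (h x * cos (f x))).
    by apply/funext => x; rewrite mulrAC mulrC.
  by rewrite e (RintegralZl c measurableT (bhc P)) (RintegralZl c measurableT (bhc Q)) (h1 _ Ff).
- have bhc S := bm_integrable S (bmM bh (bm_sin Ff)).
  have e : (fun x => h x * c * sin (f x)) = (fun x => c * (h x * sin (f x))).
    by apply/funext => x; rewrite mulrAC mulrC.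
  by rewrite e (RintegralZl c measurableT (bhc P)) (RintegralZl c measurableT (bhc Q)) (h2 _ Ff).
Qed.

Lemma multiplier_const (c : R) : multiplier (fun=> c).
Proof. by split=> // h; exact: agreeZ. Qed.

Lemma multiplierM u v : multiplier u -> multiplier v -> multiplier (fun x => u x * v x).
Proof.
move=> [bu mu] [bv mv]; split; first exact: bmM.
by move=> h /mu/mv; under eq_fun do rewrite -mulrA.
Qed.

Lemma multiplierD u v : multiplier u -> multiplier v -> multiplier (fun x => u x + v x).
Proof.
move=> [bu mu] [bv mv]; split; first exact: bmD.
move=> h ah; have := agreeD (mu _ ah) (mv _ ah).
by under eq_fun do rewrite -mulrDr.
Qed.

Lemma multiplierZ (c : R) u : multiplier u -> multiplier (fun x => c * u x).
Proof. exact: multiplierM (multiplier_const c). Qed.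

Lemma multiplierB u v : multiplier u -> multiplier v -> multiplier (fun x => u x - v x).
Proof.
move=> mu mv; have := multiplierD mu (multiplierZ (-1) mv).
by under eq_fun do rewrite mulN1r.
Qed.

Lemma multiplier_lim (u : nat -> T -> R) (v : T -> R) (C : R) :
  (forall n, multiplier (u n)) -> (forall n x, `|u n x| <= C) ->
  (forall x, u n x @[n --> \oo] --> v x) -> multiplier v.
Proof.
move=> mu uC uv.
have mv : measurable_fun setT v.
  by apply: (measurable_fun_cvg (fun n => (mu n).1.1)) => x _; exact: uv.
have vC x : `|v x| <= C.
  by apply: (cvgr_to_le (cvg_norm (uv x))); apply: nearW => n.
split; first by split=> //; exists C.
move=> h ah; have [[mh [D hD]] _ _] := ah.
have lim (S : probability T R) (k : T -> R) : bm k ->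
    \int[S]_x (h x * u n x * k x) @[n --> \oo] --> \int[S]_x (h x * v x * k x).
  move=> [mk [B kB]]; apply: (@bounded_convergence _ _ _ _ _ _ (D * C * B)).
  - by move=> n; do 2 apply: measurable_funM => //; exact: (mu n).1.1.
  - by do 2 apply: measurable_funM => //.
  - by move=> n x; rewrite !normrM !ler_pM// mulr_ge0.
  - by move=> x; apply: cvgMl; apply: cvgMr; exact: uv.
split.
- by apply: bmM; [split=> //; exists D|split=> //; exists C].
- move=> f Ff; have bk := bm_cos Ff.
  apply: (cvg_unique _ (lim P _ bk)) => //; rewrite (_ : (fun n => _) = (fun n =>
    \int[Q]_x (h x * u n x * cos (f x)))); first exact: lim.
  by apply/funext => n; have [_ + _] := (mu n).2 _ ah; exact.
- move=> f Ff; have bk := bm_sin Ff.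
  apply: (cvg_unique _ (lim P _ bk)) => //; rewrite (_ : (fun n => _) = (fun n =>
    \int[Q]_x (h x * u n x * sin (f x)))); first exact: lim.
  by apply/funext => n; have [_ _ +] := (mu n).2 _ ah; exact.
Qed.

Let agree_cos_sin h f : agree h -> F f ->
  agree (fun x => h x * cos (f x)) /\ agree (fun x => h x * sin (f x)).
Proof.
move=> [bh h1 h2] Ff.
have bhc := bmM bh (bm_cos Ff); have bhs := bmM bh (bm_sin Ff).
(* the product formulas reduce a product of two trigonometric functions to the
   sum and the difference of their arguments *)
have split2 (S : probability T R) (u v : T -> R) : bm u -> bm v ->
    \int[S]_x (2^-1 * (h x * u x) + 2^-1 * (h x * v x)) =
    2^-1 * \int[S]_x (h x * u x) + 2^-1 * \int[S]_x (h x * v x).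
  move=> bu bv; have i1 := bmM bh bu; have i2 := bmM bh bv.
  rewrite (intD S (bmM (bm_cst 2^-1) i1) (bmM (bm_cst 2^-1) i2)).
  by rewrite !RintegralZl//; exact: bm_integrable.
have splitN (S : probability T R) (u v : T -> R) : bm u -> bm v ->
    \int[S]_x (2^-1 * (h x * u x) + - 2^-1 * (h x * v x)) =
    2^-1 * \int[S]_x (h x * u x) + - 2^-1 * \int[S]_x (h x * v x).
  move=> bu bv; have i1 := bmM bh bu; have i2 := bmM bh bv.
  rewrite (intD S (bmM (bm_cst 2^-1) i1) (bmM (bm_cst (- 2^-1)) i2)).
  by rewrite !RintegralZl//; exact: bm_integrable.
split; split => // g Fg.
- have Fp := FD Ff Fg; have Fm := FB Ff Fg.
  rewrite (_ : (fun x => _) = (fun x => 2^-1 * (h x * cos (f x + g x)) +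
      2^-1 * (h x * cos (f x - g x)))); last first.
    by apply/funext => x; rewrite cosB cosD; field.
  rewrite (split2 P _ _ (bm_cos Fp) (bm_cos Fm)) (split2 Q _ _ (bm_cos Fp) (bm_cos Fm)).
  by rewrite (h1 _ Fp) (h1 _ Fm).
- have Fp := FD Ff Fg; have Fm := FB Ff Fg.
  rewrite (_ : (fun x => _) = (fun x => 2^-1 * (h x * sin (f x + g x)) +
      - 2^-1 * (h x * sin (f x - g x)))); last first.
    by apply/funext => x; rewrite sinB sinD; field.
  rewrite (splitN P _ _ (bm_sin Fp) (bm_sin Fm)) (splitN Q _ _ (bm_sin Fp) (bm_sin Fm)).
  by rewrite (h2 _ Fp) (h2 _ Fm).
- have Fp := FD Ff Fg; have Fm := FB Ff Fg.
  rewrite (_ : (fun x => _) = (fun x => 2^-1 * (h x * sin (f x + g x)) +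
      2^-1 * (h x * sin (f x - g x)))); last first.
    by apply/funext => x; rewrite sinB sinD; field.
  rewrite (split2 P _ _ (bm_sin Fp) (bm_sin Fm)) (split2 Q _ _ (bm_sin Fp) (bm_sin Fm)).
  by rewrite (h2 _ Fp) (h2 _ Fm).
- have Fp := FD Ff Fg; have Fm := FB Ff Fg.
  rewrite (_ : (fun x => _) = (fun x => 2^-1 * (h x * cos (f x - g x)) +
      - 2^-1 * (h x * cos (f x + g x)))); last first.
    by apply/funext => x; rewrite cosB cosD; field.
  rewrite (splitN P _ _ (bm_cos Fm) (bm_cos Fp)) (splitN Q _ _ (bm_cos Fm) (bm_cos Fp)).
  by rewrite (h1 _ Fp) (h1 _ Fm).
Qed.

Lemma multiplier_sin f (c : R) : F f -> multiplier (fun x => sin (f x - c)).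
Proof.
move=> Ff.
have mc : multiplier (fun x => cos (f x)).
  by split; [exact: bm_cos|move=> h /agree_cos_sin/(_ Ff)[]].
have ms : multiplier (fun x => sin (f x)).
  by split; [exact: bm_sin|move=> h /agree_cos_sin/(_ Ff)[]].
have := multiplierB (multiplierZ (cos c) ms) (multiplierZ (sin c) mc).
by congr multiplier; apply/funext => x; rewrite sinB mulrC [sin c * _]mulrC.
Qed.

(** The iterates of smoothstep are polynomials in u. *)
Lemma multiplier_sg u : multiplier u -> (forall x, `|u x| <= 1) ->
  multiplier (fun x => Num.sg (u x)).
Proof.
move=> mu u1.
apply: (@multiplier_lim (fun n x => iter n (@smoothstep R) (u x)) _ 1).
- elim=> [//|n IH] /=.
  have := multiplierZ 2^-1 (multiplierB (multiplierZ 3 IH) (multiplierM IH (multiplierM IH IH))).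
  by congr multiplier; apply/funext => x; rewrite /smoothstep; field.
- by move=> n x; exact: iter_smoothstep_itv.
- by move=> x; exact: cvg_iter_smoothstep.
Qed.

Lemma multiplier_half_space f (c : R) : F f -> multiplier (\1_[set x | f x <= c]).
Proof.
move=> Ff.
(* rescaling brings every value of f - c into the range where the sine has the
   sign of its argument *)
pose s n x := Num.sg (sin (n.+1%:R^-1 * f x - n.+1%:R^-1 * c)).
have ms n : multiplier (s n).
  apply: multiplier_sg => [|x]; last exact: sin_max.
  exact: multiplier_sin (FZ _ Ff).
have slim x : s n x @[n --> \oo] --> Num.sg (f x - c).
  apply: cvg_near_cst; near=> n; rewrite /s -mulrBr.
  have n0 : (0 : R) < n.+1%:R^-1 by rewrite invr_gt0.
  have small : n.+1%:R^-1 * `|f x - c| < pi.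
    rewrite mulrC ltr_pdivrMr// mulrC; apply: (@lt_le_trans _ _ (n.+1%:R * 1)).
      rewrite mulr1; apply: (@le_lt_trans _ _ n%:R); last by rewrite ltr_nat.
      by near: n; exact: nbhs_infty_ger.
    by apply: ler_wpM2l => //; exact: le_trans (ler1n _ 2) (pi_ge2 R).
  have [y0|y0|->] := ltgtP (f x - c) 0; last by rewrite mulr0 sin0.
  - rewrite (ltr0_sg y0); rewrite (ltr0_norm y0) mulrN in small.
    apply: ltr0_sg; rewrite -oppr_gt0 -sinN; apply: sin_gt0_pi.
    by rewrite oppr_gt0 nmulr_llt0// n0.
  - rewrite (gtr0_sg y0); rewrite (gtr0_norm y0) in small.
    by apply: gtr0_sg; apply: sin_gt0_pi; rewrite mulr_gt0.
have s1 n x : `|s n x| <= 1.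
  by rewrite /s normr_sg; case: (_ == _); rewrite ?lexx ?ler01.
have msg := multiplier_lim ms s1 slim.
have := multiplierB (multiplier_const 1) (multiplierZ 2^-1 (multiplierM msg
  (multiplierD (multiplier_const 1) msg))).
congr multiplier; apply/funext => x; rewrite indicE.
have [y0|y0|y0] := ltgtP (f x - c) 0.
- by rewrite mem_set/= ?ltr0_sg//; [ring|rewrite -subr_le0 ltW].
- by rewrite memNset/= ?gtr0_sg//; [field|rewrite -subr_le0 leNgt y0].
- by rewrite mem_set/= ?y0 ?sgr0; [ring|rewrite -subr_le0 y0].
Unshelve. all: by end_near. Qed.

(** Complements and intersections are differences and products; a countable union
    is the bounded limit of finite unions. *)
Lemma multiplier_sigma_algebra :
  sigma_algebra setT [set A | multiplier (\1_A : T -> R)].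
Proof.
have mC A : multiplier (\1_A : T -> R) -> multiplier (\1_(~` A) : T -> R).
  move=> mA; rewrite (_ : \1_(~` A) = fun x => 1 - \1_A x).
    exact: multiplierB (multiplier_const 1) mA.
  by apply/funext => x; rewrite !indicE in_setC; case: (x \in A); rewrite ?subrr ?subr0.
have mI A B : multiplier (\1_A : T -> R) -> multiplier (\1_B : T -> R) ->
    multiplier (\1_(A `&` B) : T -> R).
  by move=> mA mB; rewrite indicI; exact: multiplierM.
have m0 : multiplier (\1_set0 : T -> R).
  by rewrite indic0; exact: multiplier_const.
split=> /=.
- exact: m0.
- by move=> A; rewrite setTD; exact: mC.
- move=> A mA.
  pose B n := \big[setU/set0]_(i < n) A i.
  have mB n : multiplier (\1_(B n) : T -> R).
    elim: n => [|n IH]; rewrite /B ?big_ord0//.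
    rewrite big_ord_recr /= -[X in \1_X]setCK setCU.
    by apply: (mC); apply: mI; exact: (mC).
  apply: (multiplier_lim mB (C := 1)).
    by move=> n x; rewrite indicE; case: (_ \in _); rewrite ?normr1 ?normr0.
  move=> x; apply: cvg_near_cst; have [[k _ Akx]|nA] := pselect ((\bigcup_k A k) x).
    exists k.+1 => // n /= kn; rewrite !indicE !mem_set//; first by exists k.
    by rewrite /B -bigcup_mkord; exists k.
  apply: nearW => n; rewrite !indicE !memNset//.
  by rewrite /B -bigcup_mkord => -[i _ Aix]; apply: nA; exists i.
Qed.

(** The multiplier is applied to the constant 1 and tested against the zero element
    of F, whose cosine is 1. *)
Lemma multiplier_integral u : F !=set0 -> multiplier u -> \int[P]_x u x = \int[Q]_x u x.
Proof.
move=> [f0 Ff0] [bu mu].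
have a1 : agree (fun=> 1).
  split=> // f Ff; have [c s] := PQ Ff.
  - by under eq_Rintegral do rewrite mul1r; under [RHS]eq_Rintegral do rewrite mul1r.
  - by under eq_Rintegral do rewrite mul1r; under [RHS]eq_Rintegral do rewrite mul1r.
have [_ + _] := mu _ a1; move=> /(_ _ (FZ 0 Ff0)).
under eq_Rintegral do rewrite mul0r cos0 mul1r mulr1.
by under [RHS]eq_Rintegral do rewrite mul0r cos0 mul1r mulr1.
Qed.

End char_fun_uniqueness.

(** * Rotation invariance of centered Gaussian laws *)

Section product_integrals.
Context d1 d2 (T1 : measurableType d1) (T2 : measurableType d2) (R : realType).
Context (P1 : probability T1 R) (P2 : probability T2 R).

Lemma Rintegral_prod (f : T1 -> R) (g : T2 -> R) (C D : R) :
  measurable_fun setT f -> measurable_fun setT g ->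
  (forall x, `|f x| <= C) -> (forall y, `|g y| <= D) ->
  \int[(P1 \x P2)%E]_z (f z.1 * g z.2) = \int[P1]_x f x * \int[P2]_y g y.
Proof.
move=> mf mg fC gD.
have mf1 : measurable_fun setT (fun z : T1 * T2 => f z.1) by exact: measurableT_comp.
have mg2 : measurable_fun setT (fun z : T1 * T2 => g z.2) by exact: measurableT_comp.
have i12 : (P1 \x P2)%E.-integrable setT (EFin \o (fun z : T1 * T2 => f z.1 * g z.2)).
  apply: (@integrable_bounded _ _ _ (P1 \x P2)%E _ (C * D)).
    exact: measurable_funM.
  by move=> z; rewrite normrM ler_pM.
have gi := integrable_bounded P2 mg gD.
have fi := integrable_bounded P1 mf fC.
rewrite [LHS]/Rintegral -(integral12_prod_meas1 i12).
rewrite (_ : (\int[P1]_x _)%E = (\int[P1]_x f x * \int[P2]_y g y)%:E)//.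
transitivity (\int[P1]_x ((\int[P2]_y g y)%R * f x)%:E)%E.
  apply: eq_integral => x _; rewrite /fubini_F/= mulrC.
  rewrite -(RintegralZl (f x) measurableT gi) Rintegral_EFin//.
  exact: integrable_scale.
rewrite Rintegral_EFin; last exact: integrable_scale.
by rewrite RintegralZl// mulrC.
Qed.

End product_integrals.

Section rotation.
Context (R : realType) (E : completeNormedModType R) (sepE : separable E).
Context (nu : probability (borel E) R) (V : (E -> R) -> R).

(** A centered Gaussian law, described by its characteristic functional; the
    quadratic nature of the covariance V is all that the rotation needs. *)
Definition centered_gaussian_law : Prop :=
  [/\ forall f, dual f -> \int[nu]_x cos (f x) = expR (- V f / 2),
      forall f, dual f -> \int[nu]_x sin (f x) = 0,
      forall f g, dual f -> dual g ->
        V (fun x => f x + g x) + V (fun x => f x - g x) = 2 * V f + 2 * V g &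
      forall c f, dual f -> V (fun x => c * f x) = c ^+ 2 * V f].

Hypothesis gnu : centered_gaussian_law.

Let r : R := (Num.sqrt 2)^-1.

Let r2 : r * r = 2^-1.
Proof. by rewrite -expr2 exprVn sqr_sqrtr. Qed.

Definition rotation (z : borel E * borel E) : borel E * borel E :=
  (r *: (z.1 - z.2 : E), r *: (z.1 + z.2 : E)).

Lemma measurable_rotation : measurable_fun setT rotation.
Proof.
apply: measurable_fun_pair; apply: weakly_measurable => // g dg.
- rewrite (_ : _ \o _ = fun z : borel E * borel E => r * (g z.1 - g z.2)).
    apply: measurable_funM => //; apply: measurable_funB.
      by apply: (measurableT_comp (dual_measurable dg)).
    by apply: (measurableT_comp (dual_measurable dg)).
  by apply/funext => z /=; rewrite dualZ// dualB.
- rewrite (_ : _ \o _ = fun z : borel E * borel E => r * (g z.1 + g z.2)).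
    apply: measurable_funM => //; apply: measurable_funD.
      by apply: (measurableT_comp (dual_measurable dg)).
    by apply: (measurableT_comp (dual_measurable dg)).
  by apply/funext => z /=; rewrite dualZ// dualD.
Qed.

HB.instance Definition _ := isMeasurableFun.Build _ _ _ _ rotation measurable_rotation.

Let nu2 : probability (borel E * borel E)%type R := (nu \x nu)%E.

Let F : set (borel E * borel E -> R) :=
  [set k | exists f g, [/\ dual f, dual g & k = fun z => f z.1 + g z.2]].

Let F_measurable k : F k -> measurable_fun setT k.
Proof.
move=> [f [g [df dg ->]]]; apply: measurable_funD.
  by apply: (measurableT_comp (dual_measurable df)).
by apply: (measurableT_comp (dual_measurable dg)).
Qed.

Let mcos f : dual f -> measurable_fun [set: borel E] (fun x : borel E => cos (f x)).
Proof.
move=> df; exact: (measurableT_comp (continuous_measurable_fun (@continuous_cos R))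
  (dual_measurable df)).
Qed.

Let msin f : dual f -> measurable_fun [set: borel E] (fun x : borel E => sin (f x)).
Proof.
move=> df; exact: (measurableT_comp (continuous_measurable_fun (@continuous_sin R))
  (dual_measurable df)).
Qed.

Lemma product_char f g : dual f -> dual g ->
  \int[nu2]_z cos (f z.1 + g z.2) = expR (- (V f + V g) / 2) /\
  \int[nu2]_z sin (f z.1 + g z.2) = 0.
Proof.
move=> df dg; have [C S _ _] := gnu.
have prod (u v : borel E -> R) : measurable_fun setT u -> measurable_fun setT v ->
    (forall x, `|u x| <= 1) -> (forall x, `|v x| <= 1) ->
    nu2.-integrable setT (EFin \o (fun z => u z.1 * v z.2)) /\
    \int[nu2]_z (u z.1 * v z.2) = \int[nu]_x u x * \int[nu]_x v x.
  move=> mu mv u1 v1; split; last exact: (Rintegral_prod nu nu mu mv u1 v1).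
  apply: (@integrable_bounded _ _ _ nu2 _ (1 * 1)).
    by apply: measurable_funM; exact: measurableT_comp.
  by move=> z; rewrite normrM ler_pM.
have [cc1 cc2] := prod _ _ (mcos df) (mcos dg) (fun x => cos_max _) (fun x => cos_max _).
have [ss1 ss2] := prod _ _ (msin df) (msin dg) (fun x => sin_max _) (fun x => sin_max _).
have [sc1 sc2] := prod _ _ (msin df) (mcos dg) (fun x => sin_max _) (fun x => cos_max _).
have [cs1 cs2] := prod _ _ (mcos df) (msin dg) (fun x => cos_max _) (fun x => sin_max _).
split.
  under eq_Rintegral do rewrite cosD.
  rewrite RintegralB// cc2 ss2 !C// !S// mulr0 subr0 -expRD; congr expR; lra.
under eq_Rintegral do rewrite sinD.
by rewrite RintegralD// sc2 cs2 !S// mul0r mulr0 addr0.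
Qed.

(** The product law and its image under the rotation have the same characteristic
    functional, by the parallelogram identity for V; the indicators of rectangles are
    therefore multipliers. *)
Lemma rotation_invariance (A B : set (borel E)) : measurable A -> measurable B ->
  nu2 (rotation @^-1` (A `*` B)) = (nu A * nu B)%E.
Proof.
move=> mA mB; have [_ _ Vpar VZ] := gnu.
pose Q : probability _ R := distribution nu2 rotation.
have FD k l : F k -> F l -> F (fun x => k x + l x).
  move=> [f [g [df dg ->]]] [f' [g' [df' dg' ->]]].
  exists (fun x => f x + f' x), (fun x => g x + g' x).
  by split; [exact: dual_add|exact: dual_add|apply/funext => z; rewrite addrACA].
have FZ c k : F k -> F (fun x => c * k x).
  move=> [f [g [df dg ->]]]; exists (fun x => c * f x), (fun x => c * g x).
  by split; [exact: dual_scale|exact: dual_scale|apply/funext => z; rewrite mulrDr].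
have FPQ k : F k -> \int[nu2]_x cos (k x) = \int[Q]_x cos (k x) /\
    \int[nu2]_x sin (k x) = \int[Q]_x sin (k x).
  move=> Fk; have mk := F_measurable Fk.
  have mck := measurableT_comp (continuous_measurable_fun (@continuous_cos R)) mk.
  have msk := measurableT_comp (continuous_measurable_fun (@continuous_sin R)) mk.
  have QE (h : borel E * borel E -> R) : measurable_fun setT h -> (forall x, `|h x| <= 1) ->
      \int[Q]_x h x = \int[nu2]_x h (rotation x).
    move=> mh h1; apply: (Rintegral_law (P' := Q) (P := nu2) measurable_rotation) => //.
    exact: (@integrable_bounded _ _ _ Q h 1 mh h1).
  have QC := QE (cos \o k) mck (fun x => cos_max _).
  have QS := QE (sin \o k) msk (fun x => sin_max _).
  move: Fk QC QS => [f [g [df dg ->]]] /= -> ->.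
  have rotE z : f (rotation z).1 + g (rotation z).2 =
      (fun x => r * (f x + g x)) z.1 + (fun x => r * (g x - f x)) z.2.
    by rewrite /= (dualZ _ _ df) (dualZ _ _ dg) (dualB _ _ df) (dualD _ _ dg); ring.
  under [X in _ = X /\ _]eq_Rintegral do rewrite rotE.
  under [X in _ /\ _ = X]eq_Rintegral do rewrite rotE.
  have d1 : dual (fun x => r * (f x + g x)) by exact/dual_scale/dual_add.
  have d2 : dual (fun x => r * (g x - f x)) by exact/dual_scale/dual_sub.
  have [-> ->] := product_char df dg.
  have [-> ->] := product_char d1 d2.
  split=> //; congr (expR (- _ / 2)).
  rewrite (VZ r (fun x => f x + g x))//; last exact: dual_add.
  rewrite (VZ r (fun x => g x - f x))//; last exact: dual_sub.
  rewrite -mulrDr expr2 r2 (_ : (fun x => f x + g x) = (fun x => g x + f x)); last first.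
    by apply/funext => x; rewrite addrC.
  by rewrite Vpar//; field.
have Mhalf := @multiplier_half_space _ _ _ nu2 Q F F_measurable FD FZ.
have [M0 MC MU] := @multiplier_sigma_algebra _ _ _ nu2 Q F F_measurable.
have d0 : dual (fun _ : E => 0 : R).
  by split=> [a x y|x]; [rewrite mulr0 addr0|exact: cvg_cst].
have Mpre (pr : borel E * borel E -> borel E) (D : set (borel E)) :
    (forall f, dual f -> F (f \o pr)) -> measurable D -> multiplier nu2 Q F (\1_(pr @^-1` D)).
  move=> Fpr mD; have H := @half_spaces_generate_borel R E
    [set A | multiplier nu2 Q F (\1_(pr @^-1` (A : set (borel E))))] sepE.
  apply: (H _ _ _ mD); last by move=> f c df; exact: (Mhalf (f \o pr) c (Fpr f df)).
  split=> /=.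
  - by rewrite preimage_set0.
  - by move=> B0 mB0; rewrite setTD preimage_setC -setTD; exact: MC.
  - by move=> B0 mB0; rewrite preimage_bigcup; exact: MU.
have M1 : multiplier nu2 Q F (\1_(fst @^-1` A)).
  apply: Mpre => // f df; exists f, (fun=> 0); split=> //.
  by apply/funext => z /=; rewrite addr0.
have M2 : multiplier nu2 Q F (\1_(snd @^-1` B)).
  apply: Mpre => // f df; exists (fun=> 0), f; split=> //.
  by apply/funext => z /=; rewrite add0r.
have F0 : F !=set0.
  by exists (fun z => 0 + 0); exists (fun=> 0), (fun=> 0).
have AB : A `*` B = fst @^-1` A `&` snd @^-1` B by [].
have mAB : measurable (A `*` B) by exact: measurableX.
have M12 : multiplier nu2 Q F (\1_(A `*` B)).
  by rewrite AB indicI; exact: multiplierM M1 M2.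
have := multiplier_integral FZ FPQ F0 M12.
rewrite !Rintegral_indic// => PQ.
have mrAB : measurable (rotation @^-1` (A `*` B)).
  by rewrite -[X in measurable X]setTI; exact: measurable_rotation.
have /fineK <- : nu2 (rotation @^-1` (A `*` B)) \is a fin_num by exact: fin_num_measure.
have fAB : nu2 (A `*` B) \is a fin_num by exact: fin_num_measure.
apply: (etrans (y := nu2 (A `*` B))); last exact: product_measure1E.
by rewrite -(fineK fAB) PQ.
Qed.

End rotation.

(** * Fernique's theorem *)

Section absolutely_convex_sets.
Context (R : realType) (E : completeNormedModType R).
Implicit Types (A : set E) (x y : E).

Definition abs_convex A : Prop :=
  (forall x, A x -> A (- x)) /\
  forall x y (a b : R), A x -> A y -> 0 <= a -> 0 <= b -> a + b = 1 -> A (a *: x + b *: y).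

(** For $t > 0$ this is $tA$. *)
Definition dilate (t : R) A : set E := [set x | A (t^-1 *: x)].

Lemma dilateN t A x : abs_convex A -> dilate t A x -> dilate t A (- x).
Proof. by move=> [cA _]; rewrite /dilate /= scalerN; exact: cA. Qed.

Lemma dilateD s t A x y : abs_convex A -> 0 < s -> 0 < t ->
  dilate s A x -> dilate t A y -> dilate (s + t) A (x + y).
Proof.
move=> [_ cA] s0 t0 /= Ax Ay; rewrite /dilate /=.
have st0 : 0 < s + t by exact: addr_gt0.
have -> : (s + t)^-1 *: (x + y) = (s / (s + t)) *: (s^-1 *: x) + (t / (s + t)) *: (t^-1 *: y).
  by rewrite scalerDr !scalerA; congr (_ *: _ + _ *: _); field; rewrite !gt_eqF.
by apply: cA; rewrite ?divr_ge0 ?ltW// -mulrDl divff// gt_eqF.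
Qed.

Lemma dilateM s t A x : 0 < s -> 0 < t -> dilate t A x -> dilate (s * t) A (s *: x).
Proof.
by move=> s0 t0; rewrite /dilate /= scalerA invfM mulrAC mulVf ?gt_eqF// mul1r.
Qed.

Lemma dilate1 A : dilate 1 A = A.
Proof. by apply/funext => x; rewrite /dilate /= invr1 scale1r. Qed.

Lemma dilate_dilate s t A : dilate s (dilate t A) = dilate (s * t) A.
Proof. by apply/funext => x; rewrite /dilate /= scalerA invfM mulrC. Qed.

Lemma dilate_abs_convex t A : abs_convex A -> abs_convex (dilate t A).
Proof.
move=> cA; split; first by move=> x; exact: dilateN.
move=> x y a b; rewrite /dilate /= => Ax Ay a0 b0 ab.
rewrite scalerDr !scalerA (mulrC _ a) (mulrC _ b) -!scalerA.
exact: cA.2.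
Qed.

Lemma sub_dilate s t A : abs_convex A -> 0 < s -> s <= t -> dilate s A `<=` dilate t A.
Proof.
move=> cA s0; rewrite le_eqVlt => /orP[/eqP ->//|st] x sx.
have t0 : 0 < t by exact: lt_trans st.
have Ap : A (s^-1 *: x) by exact: sx.
have A0 : A 0.
  have := cA.2 _ _ 2^-1 2^-1 Ap (cA.1 _ Ap).
  rewrite scalerN subrr; apply; rewrite ?invr_ge0//; lra.
have := cA.2 _ _ (s / t) (1 - s / t) Ap A0.
rewrite scaler0 addr0 scalerA mulrAC divff ?gt_eqF// mul1r; apply.
- by rewrite divr_ge0// ltW.
- by rewrite subr_ge0 ler_pdivrMr// mul1r ltW.
- by rewrite addrC subrK.
Qed.

Lemma dilate_borel t A : measurable (A : set (borel E)) ->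
  measurable (dilate t A : set (borel E)).
Proof.
move=> mA; have mt : measurable_fun [set: borel E] (fun x : borel E => t^-1 *: (x : E) : borel E).
  apply: (@measurability _ _ (borel E) (borel E) _ _ (@open E)) => //.
  move=> _ [B oB <-]; rewrite setTI; apply: open_borel.
  by have /continuousP := @scaler_continuous R E t^-1; exact.
by rewrite -[X in measurable X]setTI; exact: mt.
Qed.

Lemma closed_ball_abs_convex (r : R) : abs_convex [set x : E | `|x| <= r].
Proof.
split=> [x /=|x y a b /= xr yr a0 b0 ab]; first by rewrite normrN.
apply: (le_trans (ler_normD _ _)); rewrite !normrZ !ger0_norm//.
rewrite -[leRHS]mul1r -ab mulrDl.
by apply: lerD; exact: ler_wpM2l.
Qed.

End absolutely_convex_sets.

Section fernique.
Context (R : realType) (E : completeNormedModType R) (sepE : separable E).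
Local Notation q := (Num.sqrt (2 : R)).

Let q0 : 0 < q. Proof. by rewrite sqrtr_gt0. Qed.
Let qq : q * q = 2. Proof. by rewrite -expr2 sqr_sqrtr. Qed.
Let q43 : 4 / 3 <= q.
Proof.
by rewrite leNgt; apply/negP => h; have := qq; have := q0; nra.
Qed.

Section centered.
Context (nu : probability (borel E) R) (V : (E -> R) -> R).
Hypothesis gnu : centered_gaussian_law nu V.
Context (A : set E) (mA : measurable (A : set (borel E))) (cA : abs_convex A).

Let tail (t : R) : R := fine (nu (~` dilate t A)).

Let mdil t : measurable (dilate t A : set (borel E)).
Proof. exact: dilate_borel. Qed.

(** For independent u, v with law nu, (u - v) / sqrt 2 and (u + v) / sqrt 2 are
    again independent with law nu.  If the first lies in A and the second outside
    t A, then both u and v are large. *)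
Lemma fernique_step (t : R) : 1 < t ->
  fine (nu A) * tail t <= tail ((t - 1) / q) ^+ 2.
Proof.
move=> t1; have t0 : 0 < t by lra.
have mC s : measurable (~` dilate s A : set (borel E)) by exact: measurableC.
have inv := rotation_invariance sepE gnu mA (mC t).
have prod s : (nu \x nu)%E (~` dilate s A `*` ~` dilate s A) =
  (nu (~` dilate s A) * nu (~` dilate s A))%E by exact: product_measure1E.
have fin B : measurable (B : set (borel E)) -> nu B \is a fin_num.
  by move=> mB; exact: fin_num_measure.
have finC s : nu (~` dilate s A) \is a fin_num by apply: fin; exact: mC.
rewrite /tail -lee_fin expr2 !EFinM (fineK (fin _ mA)) !(fineK (finC _)).
rewrite -inv -prod; apply: le_measure; rewrite ?inE.
- rewrite -[X in measurable X]setTI; apply: measurable_rotation => //.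
  by apply: measurableX => //; exact: mC.
- by apply: measurableX; exact: mC.
move=> [u v] [/= Auv ntuv].
have s0 : 0 < t - 1 by lra.
have h1 : dilate 1 A (q^-1 *: (u - v)) by rewrite dilate1.
have e1 : q * ((t - 1) / q) = t - 1 by rewrite mulrC divfK// gt_eqF.
have tE : t - 1 + 1 = t by rewrite subrK.
have s'0 : 0 < (t - 1) / q by exact: divr_gt0.
have half w z : q *: w - q^-1 *: (w - z) = q^-1 *: (w + z) :> E.
  have qn0 : q != 0 by rewrite gt_eqF.
  have qV : q = q^-1 * 2 by apply: (mulfI qn0); rewrite mulrA mulfV// mul1r.
  rewrite [X in X *: w]qV -scalerA -scalerBr; congr (_ *: _).
  by rewrite scaler_nat mulr2n opprB [z - w]addrC addrA addrK.
split=> /= du.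
- apply: ntuv; rewrite -half -tE; apply: (dilateD cA) => //; last exact: dilateN.
  by rewrite -e1; exact: dilateM.
- apply: ntuv; rewrite (addrC u) -half -tE; apply: (dilateD cA) => //.
    by rewrite -e1; exact: dilateM.
  by rewrite -scalerN opprB.
Qed.

(** The thresholds along which fernique_step can be iterated, because
    $(t_{k+1} - 1)/\sqrt2 = t_k$. *)
Let tk (k : nat) : R := iter k (fun t => 1 + q * t) 1.

Let tk_ge1 k : 1 <= tk k.
Proof.
elim: k => //= k IH; rewrite lerDl mulr_ge0// ?ltW//; exact: lt_le_trans IH.
Qed.

(** Each step squares the bound for twice the tail, and the thresholds stay below $4 \cdot 2^{k/2}$. *)
Lemma fernique_centered (e : R) (k : nat) : (nu (~` A) <= e%:E)%E -> e <= 2^-1 ->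
  (nu (~` dilate (4 * q ^+ k) A) <= ((2 * e) ^+ (2 ^ k))%:E)%E.
Proof.
move=> nuA e2.
have mCA : measurable (~` A : set (borel E)) by exact: measurableC.
have fin B : measurable (B : set (borel E)) -> nu B \is a fin_num.
  by move=> mB; exact: fin_num_measure.
have nuA2 : 2^-1 <= fine (nu A).
  rewrite -lee_fin fineK ?fin//.
  have := probability_setC nu mA => h.
  have : (fine (nu (~` A)))%:E = (1 - (fine (nu A)))%:E.
    by rewrite EFinB !fineK ?fin// -h.
  move=> [] h'; rewrite -(fineK (fin _ mA)) lee_fin.
  have : fine (nu (~` A)) <= e by rewrite -lee_fin fineK ?fin.
  lra.
have tail0 t : 0 <= tail t by rewrite /tail fine_ge0.
have rec k' : 2 * tail (tk k') <= (2 * e) ^+ (2 ^ k').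
  elim: k' => [|k' IH] /=.
    by rewrite expr1 ler_pM2l// /tail dilate1 -lee_fin fineK ?fin.
  have t1 : 1 < 1 + q * tk k'.
    by rewrite ltrDl mulr_gt0//; exact: lt_le_trans (tk_ge1 k').
  have := fernique_step t1.
  rewrite (addrC 1) addrK mulrAC divff ?gt_eqF// mul1r => step.
  rewrite expnS mulnC exprM.
  apply: (@le_trans _ _ ((2 * tail (tk k')) ^+ 2)).
    rewrite exprMn; set a := tail (tk k') in step *; set b := tail _ in step *.
    have : 2^-1 * b <= a ^+ 2 by apply: le_trans step; exact: (ler_wpM2r (tail0 _) nuA2).
    lra.
  have a0 : 0 <= 2 * tail (tk k') by rewrite mulr_ge0.
  by rewrite ler_pXn2r ?nnegrE// (le_trans a0 IH).
have bd : tk k <= 4 * q ^+ k - 3.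
  elim: k => [|k IH] /=; first by rewrite expr0; lra.
  rewrite exprS; have : q * tk k <= q * (4 * q ^+ k - 3) by rewrite ler_pM2l.
  have := q43; rewrite mulrBr; lra.
apply: (@le_trans _ _ (tail (tk k))%:E).
  rewrite /tail fineK; last by apply: fin; apply: measurableC.
  apply: le_measure; rewrite ?inE; [exact: measurableC|exact: measurableC|].
  apply: subsetC; apply: sub_dilate => //; first exact: lt_le_trans (tk_ge1 k).
  by apply: le_trans bd _; lra.
rewrite lee_fin; apply: le_trans (rec k); have := tail0 (tk k); lra.
Qed.

End centered.

Section gaussian.
Context (mu : probability (borel E) R).

Definition gaussian_law : Prop :=
  forall f, dual f -> exists m v, gaussian_moments mu f m v.

Definition law_mean (f : E -> R) : R := \int[mu]_x f x.
Definition law_var (f : E -> R) : R := \int[mu]_x (f x ^+ 2) - law_mean f ^+ 2.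

Hypothesis gmu : gaussian_law.

Lemma gaussian_law_moments f : dual f -> gaussian_moments mu f (law_mean f) (law_var f).
Proof.
move=> df; have [m [v g]] := gmu df.
have [_ [e1 e2] _ _] := g.
by rewrite /law_var /law_mean e1 e2 addrC addKr.
Qed.

Lemma law_meanD f g : dual f -> dual g ->
  law_mean (fun x => f x + g x) = law_mean f + law_mean g.
Proof.
move=> df dg; have [[_ fi _] _ _ _] := gaussian_law_moments df.
by have [[_ gi _] _ _ _] := gaussian_law_moments dg; rewrite /law_mean RintegralD.
Qed.

Lemma law_meanZ c f : dual f -> law_mean (fun x => c * f x) = c * law_mean f.
Proof.
move=> df; have [[_ fi _] _ _ _] := gaussian_law_moments df.
by rewrite /law_mean RintegralZl.
Qed.

Lemma law_varZ c f : dual f -> law_var (fun x => c * f x) = c ^+ 2 * law_var f.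
Proof.
move=> df; have [[_ _ fi] _ _ _] := gaussian_law_moments df.
rewrite /law_var law_meanZ// exprMn mulrBr; congr (_ - _).
by under eq_Rintegral do rewrite exprMn; rewrite RintegralZl.
Qed.

Lemma law_var_parallelogram f g : dual f -> dual g ->
  law_var (fun x => f x + g x) + law_var (fun x => f x - g x) =
  2 * law_var f + 2 * law_var g.
Proof.
move=> df dg.
have [[_ _ fi] _ _ _] := gaussian_law_moments df.
have [[_ _ gi] _ _ _] := gaussian_law_moments dg.
have [[_ _ pi] _ _ _] := gaussian_law_moments (dual_add df dg).
have [[_ _ mi] _ _ _] := gaussian_law_moments (dual_sub df dg).
have mB : law_mean (fun x => f x - g x) = law_mean f - law_mean g.
  rewrite -mulN1r -law_meanZ// -law_meanD//; last exact: dual_scale.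
  by apply: eq_Rintegral => x _; rewrite mulN1r.
have sumE : \int[mu]_x ((f x + g x) ^+ 2) + \int[mu]_x ((f x - g x) ^+ 2) =
    2 * \int[mu]_x (f x ^+ 2) + 2 * \int[mu]_x (g x ^+ 2).
  rewrite -RintegralD// -!RintegralZl// -RintegralD//; [|exact: integrable_scale|exact: integrable_scale].
  by apply: eq_Rintegral => x _; ring.
rewrite /law_var law_meanD// mB.
have -> (a b c d' : R) : a - b + (c - d') = (a + c) - (b + d') by ring.
by rewrite sumE; ring.
Qed.

Definition symmetrization (z : borel E * borel E) : borel E := q^-1 *: (z.1 - z.2 : E).

Lemma measurable_symmetrization : measurable_fun setT symmetrization.
Proof. exact: (measurableT_comp measurable_fst (measurable_rotation sepE)). Qed.

HB.instance Definition _ := isMeasurableFun.Build _ _ _ _ symmetrization measurable_symmetrization.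

Definition symmetrized_law : probability (borel E) R :=
  distribution (mu \x mu)%E symmetrization.

(** The difference of two independent copies has mean zero, and division by $\sqrt2$
    restores the variances. *)
Lemma symmetrized_law_centered : centered_gaussian_law symmetrized_law law_var.
Proof.
have bcos (f : E -> R) (m : R) : dual f -> measurable_fun [set: borel E] (fun x : borel E => cos (f x - m)).
  move=> df; apply: (measurableT_comp (continuous_measurable_fun (@continuous_cos R))).
  by apply: measurable_funB => //; exact: dual_measurable.
have bsin (f : E -> R) (m : R) : dual f -> measurable_fun [set: borel E] (fun x : borel E => sin (f x - m)).
  move=> df; apply: (measurableT_comp (continuous_measurable_fun (@continuous_sin R))).
  by apply: measurable_funB => //; exact: dual_measurable.
have key f : dual f -> \int[symmetrized_law]_x cos (f x) = expR (- law_var f / 2) /\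
    \int[symmetrized_law]_x sin (f x) = 0.
  move=> df; have dg := dual_scale q^-1 df; set g := (fun x => q^-1 * f x) in dg.
  have [_ _ _ [C S]] := gaussian_law_moments dg.
  set m := law_mean g in C S.
  have lawE (h : R -> R) : continuous h -> (forall x, `|h x| <= 1) ->
      \int[symmetrized_law]_x h (f x) = \int[(mu \x mu)%E]_z h ((g z.1 - m) - (g z.2 - m)).
    move=> ch h1.
    have mh : measurable_fun [set: borel E] (fun x : borel E => h (f x)).
      exact: (measurableT_comp (continuous_measurable_fun ch) (dual_measurable df)).
    rewrite (Rintegral_law (P' := symmetrized_law) (P := (mu \x mu)%E) measurable_symmetrization)//.
      by apply: eq_Rintegral => z _; rewrite /symmetrization dualZ// dualB// /g; congr h; ring.
    exact: (@integrable_bounded _ _ _ symmetrized_law _ 1 mh (fun x => h1 _)).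
  have prod (u v : borel E -> R) : measurable_fun setT u -> measurable_fun setT v ->
      (forall x, `|u x| <= 1) -> (forall x, `|v x| <= 1) ->
      (mu \x mu)%E.-integrable setT (EFin \o (fun z => u z.1 * v z.2)) /\
      \int[(mu \x mu)%E]_z (u z.1 * v z.2) = \int[mu]_x u x * \int[mu]_x v x.
    move=> mu1 mv u1 v1; split; last exact: (Rintegral_prod mu mu mu1 mv u1 v1).
    apply: (@integrable_bounded _ _ _ (mu \x mu)%E _ (1 * 1)).
      by apply: measurable_funM; exact: measurableT_comp.
    by move=> z; rewrite normrM ler_pM.
  have c1 x : `|cos (g x - m)| <= 1 by exact: cos_max.
  have s1 x : `|sin (g x - m)| <= 1 by exact: sin_max.
  have [cc1 cc2] := prod _ _ (bcos g m dg) (bcos g m dg) c1 c1.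
  have [ss1 ss2] := prod _ _ (bsin g m dg) (bsin g m dg) s1 s1.
  have [sc1 sc2] := prod _ _ (bsin g m dg) (bcos g m dg) s1 c1.
  have [cs1 cs2] := prod _ _ (bcos g m dg) (bsin g m dg) c1 s1.
  rewrite (lawE cos (@continuous_cos R) (@cos_max R)) (lawE sin (@continuous_sin R) (@sin_max R)).
  split.
    under eq_Rintegral do rewrite cosB.
    rewrite RintegralD// cc2 ss2 C S mulr0 addr0 -expRD; congr expR.
    by rewrite /g law_varZ// exprVn sqr_sqrtr//; field.
  under eq_Rintegral do rewrite sinB.
  by rewrite RintegralB// sc2 cs2 S mul0r mulr0 subr0.
split.
- by move=> f /key[].
- by move=> f /key[].
- exact: law_var_parallelogram.
- exact: law_varZ.
Qed.

(** Fernique's theorem for an absolutely convex set: the mass outside the dilates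
    of A decays like a Gaussian tail, with a rate that is as large as desired when
    the mass outside A is small enough.  The law is compared with its symmetrization:
    if the second of two independent copies lies in A and the first outside
    $9 \cdot 2^{k/2} A$, their difference lies outside $8 \cdot 2^{k/2} A$. *)
Theorem fernique (A : set E) (e : R) (k : nat) : measurable (A : set (borel E)) ->
  abs_convex A -> (mu (~` A) <= e%:E)%E -> 0 <= e <= 4^-1 ->
  (mu (~` dilate (9 * q ^+ k) A) <= (2 * (4 * e) ^+ (2 ^ k))%:E)%E.
Proof.
move=> mA cA muA /andP[e0 e4].
have mC t : measurable (~` dilate t A : set (borel E)).
  by apply: measurableC; exact: dilate_borel.
have mCA : measurable (~` A : set (borel E)) by exact: measurableC.
have fin B : measurable (B : set (borel E)) -> mu B \is a fin_num.
  by move=> mB; exact: fin_num_measure.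
have mlaw B : measurable (B : set (borel E)) -> measurable (symmetrization @^-1` B).
  by move=> mB; rewrite -[X in measurable X]setTI; exact: measurable_symmetrization.
have prodE (B D : set (borel E)) : measurable B -> measurable D ->
    (mu \x mu)%E (B `*` D) = (mu B * mu D)%E by exact: product_measure1E.
pose A' := dilate q A.
have cA' : abs_convex A' by exact: dilate_abs_convex.
have mA' : measurable (A' : set (borel E)) by exact: dilate_borel.
have mX1 : measurable ((~` A : set (borel E)) `*` [set: borel E]) by exact: measurableX.
have mX2 : measurable ([set: borel E] `*` (~` A : set (borel E))) by exact: measurableX.
have symA' : (symmetrized_law (~` A') <= (2 * e)%:E)%E.
  apply: (@le_trans _ _ ((mu \x mu)%E
    (((~` A : set (borel E)) `*` [set: borel E]) `|`
     ([set: borel E] `*` (~` A : set (borel E)))))).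
    apply: (@le_measure _ _ _ (mu \x mu)%E (symmetrization @^-1` (~` A')) _); rewrite ?inE.
    - by apply: mlaw; exact: measurableC.
    - exact: measurableU.
    move=> [x y] /= nxy; apply: contrapT => /not_orP[nx ny]; apply: nxy.
    have Ax : A x by apply: contrapT => h; apply: nx.
    have Ay : A (- y : E) by apply: cA.1; apply: contrapT => h; apply: ny.
    rewrite /A' /dilate /symmetrization /= scalerA -expr2 exprVn sqr_sqrtr//.
    rewrite scalerDr; apply: cA.2 => //; rewrite ?invr_ge0//; lra.
  apply: (le_trans (measureU2 (mu \x mu)%E mX1 mX2)).
  have -> : (2 * e)%:E = (e%:E + e%:E)%E by rewrite mulr_natl mulr2n.
  apply: leeD.
    by apply: le_trans muA; rewrite [leLHS]prodE// probability_setT mule1.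
  by apply: le_trans muA; rewrite [leLHS]prodE// probability_setT mul1e.
have := fernique_centered symmetrized_law_centered mA' cA' k symA'.
rewrite mulrA (_ : 2 * 2 = 4 :> R); last by ring.
move=> /(_ _)-/(_ _) tailA'.
have {tailA'} : (symmetrized_law (~` dilate (4 * q ^+ k) A') <= ((4 * e) ^+ (2 ^ k))%:E)%E.
  apply: tailA'; lra.
rewrite dilate_dilate => tailA'.
have qk : 1 <= q ^+ k by apply: exprn_ege1; have := q43; lra.
have step : (mu (~` dilate (9 * q ^+ k) A) * mu A <=
    symmetrized_law (~` dilate (4 * q ^+ k * q) A))%E.
  rewrite -prodE//; apply: (@le_measure _ _ _ (mu \x mu)%E _
    (symmetrization @^-1` (~` dilate (4 * q ^+ k * q) A))); rewrite ?inE.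
  - exact: measurableX.
  - by apply: mlaw; exact: mC.
  move=> [x y] /= [nx Ay] dxy; apply: nx.
  have := dilateM q0 _ dxy; rewrite /symmetrization scalerA divff ?gt_eqF// scale1r => /(_ _) d.
  have {}d : dilate (8 * q ^+ k) A (x - y : E).
    rewrite (_ : 8 * q ^+ k = q * (4 * q ^+ k * q)); last first.
      by transitivity (4 * q ^+ k * (q * q)); [rewrite qq; ring|ring].
    apply: d; rewrite !mulr_gt0// exprn_gt0//.
  have d1 : dilate 1 A y by rewrite dilate1.
  have k0 : 0 < 8 * q ^+ k by rewrite mulr_gt0// exprn_gt0.
  have := dilateD cA k0 ltr01 d d1; rewrite subrK; apply: sub_dilate => //.
  by lra.
have muA2 : 2^-1 <= fine (mu A).
  have : (fine (mu (~` A)))%:E = (1 - fine (mu A))%:E.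
    by rewrite EFinB !fineK ?fin// -probability_setC.
  move=> [] h; have : fine (mu (~` A)) <= e by rewrite -lee_fin fineK ?fin.
  lra.
have := le_trans step tailA'.
rewrite -(fineK (fin _ (mC _))) -(fineK (fin _ mA)) -EFinM !lee_fin => h.
have t0 : 0 <= fine (mu (~` dilate (9 * q ^+ k) A)) by rewrite fine_ge0.
have := ler_wpM2l t0 muA2.
lra.
Qed.

End gaussian.

End fernique.

(** * Tightness by absolutely convex compact sets *)

Section compactness.
Context (R : realType) (E : completeNormedModType R).

(** A set that is close to compact sets is totally bounded, so that every ultrafilter
    on it is Cauchy. *)
Lemma closed_near_compact (K : set E) : closed K ->
  (forall e : R, 0 < e -> exists2 B : set E, compact B &
     forall x, K x -> exists2 b, B b & `|x - b| < e) ->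
  compact K.
Proof.
move=> cK nK; rewrite compact_ultra => F FU FK.
have FF : ProperFilter F := ultra_proper.
suff : cauchy_ex F.
  move=> /cauchy_exP/cauchy_cvg /cvg_ex[l Fl]; exists l; split => //.
  by apply: (closed_cvg _ cK _ _ Fl); exact: FK.
move=> e e0; have e20 : 0 < e / 2 by exact: divr_gt0.
have [B cB nB] := nK _ e20.
have [D' _ BD'] : finite_subset_cover B (fun b => ball b (e / 2)) B.
  rewrite compact_cover in cB; apply: cB => [b _|b Bb]; first exact: ball_open.
  by exists b => //; exact: ballxx.
apply: contrapT => nF.
have : F (\bigcap_(b in [set` D']) ~` ball b e).
  apply: filter_bigI => b _; have [Fb|//] := in_ultra_setVsetC (ball b e) FU.
  by exfalso; apply: nF; exists b.
move=> FC; have [x [Kx xC]] := filter_ex (filterI FK FC).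
have [b Bb xb] := nB _ Kx; have [c /= cD' bc] := BD' _ Bb.
apply: (xC c cD'); rewrite -ball_normE /=; move: bc; rewrite -ball_normE /= => bc.
rewrite (splitr e) -(subrK b c) -addrA; apply: (le_lt_trans (ler_normD _ _)).
by apply: ltrD => //; rewrite distrC.
Qed.

End compactness.

Section absolutely_convex_hulls.
Context (R : realType) (E : completeNormedModType R) (D : nat -> E).

(** The combinations of D 0, ..., D (n - 1) with coefficients in $[-1, 1]$: an
    absolutely convex compact set that contains these points. *)
Fixpoint cube_hull (n : nat) : set E :=
  if n is n'.+1 then [set z | exists x c, [/\ cube_hull n' x, `|c| <= 1 & z = x + c *: D n']]
  else [set 0].

Lemma cube_hull_compact n : compact (cube_hull n).
Proof.
elim: n => [|n IH] /=; first exact: compact_set1.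
have -> : [set z | exists x c, [/\ cube_hull n x, `|c| <= 1 & z = x + c *: D n]] =
    (fun z : E * R => z.1 + z.2 *: D n) @` (cube_hull n `*` `[-1, 1]%classic).
  apply/seteqP; split=> [_ [x [c [hx c1 ->]]]|_ [[x c] [/= hx c1] <-]].
    by exists (x, c) => //; split => //=; rewrite in_itv /= -ler_norml.
  by exists x, c; split=> //; move: c1; rewrite in_itv /= -ler_norml.
apply: continuous_compact; last by apply: compact_setX => //; exact: segment_compact.
apply: continuous_subspaceT => z; apply: cvgD; first exact: cvg_fst.
by apply: cvgZr_tmp; exact: cvg_snd.
Qed.

Lemma cube_hull_abs_convex n : abs_convex (cube_hull n).
Proof.
elim: n => [|n [IH1 IH2]]; split=> /=.
- by move=> _ ->; rewrite oppr0.
- by move=> _ _ a b -> -> _ _ _; rewrite !scaler0 addr0.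
- move=> _ [x [c [hx c1 ->]]]; exists (- x), (- c); split; first exact: IH1.
    by rewrite normrN.
  by rewrite opprD scaleNr.
- move=> _ _ a b [x [c [hx c1 ->]]] [y [c' [hy c'1 ->]]] a0 b0 ab.
  exists (a *: x + b *: y), (a * c + b * c'); split; first exact: IH2.
    exact: (@closed_ball_abs_convex R R^o 1).2.
  by rewrite !scalerDr !scalerA scalerDl addrACA.
Qed.

Lemma cube_hull0 n : cube_hull n 0.
Proof. by elim: n => //= n IH; exists 0, 0; rewrite normr0 scale0r addr0. Qed.

Lemma cube_hull_vertex n i : (i < n)%N -> cube_hull n (D i).
Proof.
elim: n => // n IH; rewrite ltnS leq_eqVlt => /orP[/eqP ->|/IH Di] /=.
  exists 0, 1; rewrite normr1 scale1r add0r; split=> //; exact: cube_hull0.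
by exists (D i), 0; rewrite normr0 scale0r addr0.
Qed.

(** The points at distance at most r from A. *)
Definition thicken (r : R) (A : set E) : set E :=
  [set x | forall e, 0 < e -> exists2 y, A y & `|x - y| < r + e].

Lemma thicken_closed r A : closed (thicken r A).
Proof.
move=> x clx e e0.
have [y [Ay]] := clx (ball x (e / 2)) (nbhsx_ballx _ _ (divr_gt0 e0 (ltr0Sn _ 1))).
rewrite -ball_normE /= => xy.
have [z Az yz] := Ay _ (divr_gt0 e0 (ltr0Sn R 1)).
exists z => //; rewrite -(subrK y x) -addrA; apply: (le_lt_trans (ler_normD _ _)).
lra.
Qed.

Lemma thicken_abs_convex r A : abs_convex A -> abs_convex (thicken r A).
Proof.
move=> cA; split=> [x tx e e0|x y a b tx ty a0 b0 ab e e0].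
  have [y Ay xy] := tx _ e0; exists (- y); first exact: cA.1.
  by rewrite -opprD normrN.
have [u Au xu] := tx _ e0; have [v Av yv] := ty _ e0.
exists (a *: u + b *: v); first exact: cA.2.
rewrite opprD addrACA -!scalerBr; apply: (le_lt_trans (ler_normD _ _)).
rewrite !normrZ !ger0_norm// -[ltRHS]mul1r -ab mulrDl.
have [a0'|a0'] := ltP 0 a.
  by apply: ltr_leD; [rewrite ltr_pM2l|apply: ler_wpM2l => //; exact: ltW].
have az : a = 0 by apply/eqP; rewrite eq_le a0 a0'.
have b1 : b = 1 by rewrite -ab az add0r.
by rewrite az b1 !mul0r !add0r !mul1r.
Qed.

Lemma bigcap_abs_convex (A : nat -> set E) : (forall k, abs_convex (A k)) ->
  abs_convex (\bigcap_k A k).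
Proof.
move=> cA; split=> [x Ax k _|x y a b Ax Ay a0 b0 ab k _].
  by apply: (cA k).1; exact: Ax.
by apply: (cA k).2 => //; [exact: Ax|exact: Ay].
Qed.

End absolutely_convex_hulls.

Section uniform_tightness.
Context (R : realType) (E : completeNormedModType R) (sepE : separable E).
Context (mu : nat -> probability (borel E) R) (mu' : probability (borel E) R).

Definition weak_cvg : Prop := forall f : E -> R, continuous f ->
  (exists M : R, forall x, `|f x| <= M) ->
  \int[mu n]_x f x @[n --> \oo] --> \int[mu']_x f x.

Hypothesis cvgmu : weak_cvg.

Section covering.
Context (D : nat -> E) (dD : dense_seq D).

Let cov (N : nat) (r : R) : set E := \bigcup_(i in `I_N) [set x | `|x - D i| <= r].

Let mcov N r : measurable (cov N r : set (borel E)).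
Proof.
apply: (@bigcup_measurable _ (borel E) (fun i => [set x : E | `|x - D i| <= r])) => i _.
exact: (closed_borel (@closed_norm_ball _ _ (D i) r)).
Qed.

Let sub_cov N N' r : (N <= N')%N -> cov N r `<=` cov N' r.
Proof. by move=> NN x [i /= iN xi]; exists i => //=; exact: leq_trans NN. Qed.

Let tight1 (nu : probability (borel E) R) (r e : R) : 0 < r -> 0 < e ->
  exists N, (nu (~` cov N r) <= e%:E)%E.
Proof.
move=> r0 e0; pose F N : set (borel E) := ~` cov N r.
have mF N : measurable (F N) by exact: measurableC.
have capF : \bigcap_N F N = set0.
  apply/seteqP; split=> // x Fx; have [i xi] := dD x r0.
  by apply: (Fx i.+1 I); exists i => //=; exact: ltW.
have : (nu \o F) n @[n --> \oo] --> 0%E.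
  rewrite -(measure0 nu) -capF; apply: nonincreasing_cvg_mu => //.
  - by rewrite -ge0_fin_numE// fin_num_measure.
  - by rewrite capF.
  - by move=> a b ab; apply/subsetPset/subsetC/sub_cov.
move=> /fine_cvgP[_ /cvgr0_norm_le] => /(_ _ e0)[N _ /(_ N (leqnn N))] /= h.
exists N; rewrite (probability_le_fine _ _ (mF N)).
exact: le_trans (ler_norm _) h.
Qed.

(** Equal to 1 at distance at most r / 2 from D i, and to 0 beyond distance r. *)
Let ramp (r : R) (i : nat) (x : E) : R := Num.max 0 (Num.min 1 (2 - 2 / r * `|x - D i|)).

Let ramps (r : R) (N : nat) : E -> R := fun x =>
  iteri N (fun i u => Num.max u (ramp r i x)) 0.

Let ramp_itv r i x : 0 <= ramp r i x <= 1.
Proof. by rewrite /ramp le_max lexx/= ge_max ler01 ge_min lexx. Qed.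

Let ramps_itv r N x : 0 <= ramps r N x <= 1.
Proof.
elim: N => [|N /andP[IH1 IH2]]; rewrite /ramps /= ?lexx ?ler01//.
by rewrite le_max IH1/= ge_max IH2; have /andP[] := ramp_itv r N x.
Qed.

Let ramps_continuous r N : continuous (ramps r N).
Proof.
elim: N => [|N IH] x; first exact: cvg_cst.
apply: (@continuous_max _ _ (ramps r N : E -> R^o) (ramp r N : E -> R^o)); first exact: IH.
apply: (@continuous_max _ _ (fun=> 0 : R^o)); first exact: cvg_cst.
apply: (@continuous_min _ _ (fun=> 1 : R^o)); first exact: cvg_cst.
apply: (@cvgB _ R^o); first exact: cvg_cst.
apply: cvgM; first exact: cvg_cst.
by apply: cvg_norm; apply: cvgB; [exact: cvg_id|exact: cvg_cst].
Qed.

Let ramps_eq1 r N x : 0 < r -> cov N (r / 2) x -> ramps r N x = 1.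
Proof.
move=> r0; have le1 M : ramps r M x <= 1 by have /andP[] := ramps_itv r M x.
suff H M : (exists2 i, (i < M)%N & `|x - D i| <= r / 2) -> 1 <= ramps r M x.
  by move=> [i /= iN xi]; apply/eqP; rewrite eq_le le1 H//; exists i.
elim: M => [[]//|M IH [i]]; rewrite ltnS leq_eqVlt /ramps /= le_max => /orP[/eqP ->|iM] xi.
  apply/orP; right; rewrite /ramp le_max; apply/orP; right; rewrite le_min lexx/=.
  have : 2 / r * `|x - D M| <= 2 / r * (r / 2) by apply: ler_wpM2l => //; rewrite divr_ge0// ltW.
  by rewrite (_ : 2 / r * (r / 2) = 1); [lra|field; rewrite gt_eqF].
by apply/orP; left; apply: IH; exists i.
Qed.

Let ramps_eq0 r N x : 0 < r -> ~ cov N r x -> ramps r N x = 0.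
Proof.
move=> r0; elim: N => // N IH nx.
have nx' : ~ cov N r x by move=> h; apply: nx; exact: (sub_cov (leqnSn N) h).
rewrite /ramps /= -/(ramps r N x) IH//.
have xN : r < `|x - D N| by rewrite ltNge; apply/negP => h; apply: nx; exists N; rewrite /= ?ltnSn.
rewrite /ramp; have h : 2 - 2 / r * `|x - D N| <= 0.
  have : 2 / r * r <= 2 / r * `|x - D N|.
    by apply: ler_wpM2l; [rewrite divr_ge0// ltW|exact: ltW].
  by rewrite divfK ?gt_eqF//; lra.
rewrite (min_r (le_trans h ler01)) (max_l h) max_l//.
Qed.

(** Convergence in law controls all but finitely many of the laws at once, with a
    continuous function between the indicators of two coverings. *)
Lemma finite_covering_tight (r e : R) : 0 < r -> 0 < e ->
  exists N, forall n, (mu n (~` cov N r) <= e%:E)%E.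
Proof.
move=> r0 e0; have r20 : 0 < r / 2 by rewrite divr_gt0.
have e20 : 0 < e / 2 by rewrite divr_gt0.
have [N0 muN0] := tight1 mu' r20 e20.
have fbnd x : `|ramps r N0 x| <= 1.
  by have /andP[? ?] := ramps_itv r N0 x; rewrite ger0_norm.
have lim := cvgmu (@ramps_continuous r N0) (ex_intro _ 1 fbnd).
have mf : measurable_fun [set: borel E] (ramps r N0 : borel E -> R).
  exact: continuous_borel.
have fint (nu : probability (borel E) R) : nu.-integrable setT (EFin \o (ramps r N0 : borel E -> R)).
  exact: (@integrable_bounded _ _ _ nu _ 1 mf fbnd).
have Iint (nu : probability (borel E) R) r' : nu.-integrable setT (EFin \o (\1_(cov N0 r') : borel E -> R)).
  apply: (@integrable_bounded _ _ _ nu _ 1) => //.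
  by move=> x; rewrite indicE; case: (_ \in _); rewrite ?normr1 ?normr0.
have compl (nu : probability (borel E) R) r' : fine (nu (~` cov N0 r')) = 1 - fine (nu (cov N0 r')).
  exact: fine_probability_setC.
have mC N r' : measurable (~` cov N r' : set (borel E)) by exact: measurableC.
have low : 1 - e / 2 <= \int[mu']_x ramps r N0 x.
  apply: (@le_trans _ _ (\int[mu']_x (\1_(cov N0 (r / 2)) : borel E -> R) x)).
    rewrite Rintegral_indic//.
    have : fine (mu' (~` cov N0 (r / 2))) <= e / 2.
      by rewrite -probability_le_fine.
    by rewrite compl; lra.
  apply: (le_Rintegral measurableT (Iint _ _) (fint _)) => x _; rewrite indicE.
  have [xc|xc] := pselect (cov N0 (r / 2) x).
    by rewrite mem_set// ramps_eq1.
  by rewrite memNset//; have /andP[] := ramps_itv r N0 x.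
have [n0 _ Hn0] : \forall n \near \oo, 1 - e <= \int[mu n]_x ramps r N0 x.
  have := cvgr_ge _ lim; apply; lra.
have big n : (n0 <= n)%N -> (mu n (~` cov N0 r) <= e%:E)%E.
  move=> /Hn0 /= h; rewrite probability_le_fine// compl.
  suff : \int[mu n]_x ramps r N0 x <= fine (mu n (cov N0 r)) by lra.
  rewrite -Rintegral_indic//; apply: (le_Rintegral measurableT (fint _) (Iint _ _)) => x _; rewrite indicE.
  have [xc|xc] := pselect (cov N0 r x).
    by rewrite mem_set//; have /andP[] := ramps_itv r N0 x.
  by rewrite memNset// ramps_eq0.
have small : exists N, forall n, (n < n0)%N -> (mu n (~` cov N r) <= e%:E)%E.
  elim: (n0) => [|m [N HN]]; first by exists 0%N.
  have [N' HN'] := tight1 (mu m) r0 e0; exists (maxn N N') => n.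
  rewrite ltnS leq_eqVlt => /orP[/eqP ->|nm].
    apply: le_trans HN'; apply: le_measure; rewrite ?inE; [exact: measurableC..|].
    by apply/subsetC/sub_cov; exact: leq_maxr.
  apply: le_trans (HN _ nm); apply: le_measure; rewrite ?inE; [exact: measurableC..|].
  by apply/subsetC/sub_cov; exact: leq_maxl.
have [N1 HN1] := small; exists (maxn N0 N1) => n.
have [n0n|nn0] := leqP n0 n.
  apply: le_trans (big _ n0n); apply: le_measure; rewrite ?inE; [exact: measurableC..|].
  by apply/subsetC/sub_cov; exact: leq_maxl.
apply: le_trans (HN1 _ nn0); apply: le_measure; rewrite ?inE; [exact: measurableC..|].
by apply/subsetC/sub_cov; exact: leq_maxr.
Qed.

End covering.

(** Fernique's theorem needs compact sets that are absolutely convex.  At each scale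
    finitely many balls carry most of the mass; the thickened hulls of their centers
    are absolutely convex, and their intersection over all scales is compact. *)
Theorem abs_convex_tight (e : R) : 0 < e ->
  exists K : set E, [/\ compact K, closed K, abs_convex K &
    forall n, (mu n (~` K) <= e%:E)%E].
Proof.
move=> e0; have [D dD] := separable_dense_seq sepE.
pose r (k : nat) : R := k.+1%:R^-1.
have r0 k : 0 < r k by rewrite invr_gt0.
have ek0 (k : nat) : 0 < e / (2 ^ k.+1)%:R by rewrite divr_gt0// ltr0n expn_gt0.
pose N k := projT1 (cid (finite_covering_tight dD (r0 k) (ek0 k))).
have HN k n : (mu n (~` \bigcup_(i in `I_(N k)) [set x | (`|x - D i| <= r k)%R]) <=
    (e / (2 ^ k.+1)%:R)%:E)%E.
  by have := projT2 (cid (finite_covering_tight dD (r0 k) (ek0 k))) n.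
pose A k := thicken (r k) (cube_hull D (N k)).
pose K := \bigcap_k A k.
have cK : closed K by apply: closed_bigI => k _; exact: thicken_closed.
exists K; split => //.
- apply: closed_near_compact => // d d0.
  have [k kd] : exists k : nat, r k < d / 2.
    have := near_infty_natSinv_lt (PosNum (divr_gt0 d0 (@ltr0n R 2))).
    by move=> [j _ /(_ j (leqnn j))] ?; exists j.
  exists (cube_hull D (N k)); first exact: cube_hull_compact.
  move=> x /(_ k I) /(_ (d / 2)) [|b Bb xb]; first by rewrite divr_gt0.
  exists b => //; apply: (lt_trans xb).
  by rewrite [ltRHS]splitr ltrD2r.
- by apply: bigcap_abs_convex => k; apply: thicken_abs_convex; exact: cube_hull_abs_convex.
- move=> n; have mA k : measurable (~` A k : set (borel E)).
    by apply: measurableC; apply: closed_borel; exact: thicken_closed.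
  have mK : measurable (~` K : set (borel E)) by apply: measurableC; exact: closed_borel.
  have KA : ~` K `<=` \bigcup_k ~` A k by rewrite -setC_bigcap.
  apply: (le_trans (measure_sigma_subadditive (mu n) mA mK KA)).
  apply: le_trans (epsilon_trick0 xpredT (ltW e0)); apply: lee_nneseries => // k _.
  apply: le_trans (HN k n); apply: le_measure; rewrite ?inE//.
    apply: measurableC.
    apply: (@bigcup_measurable _ (borel E) (fun i => [set x : E | `|x - D i| <= r k])) => i _.
    exact: (closed_borel (@closed_norm_ball _ _ (D i) (r k))).
  apply: subsetC => x [i /= iN xi] d d0; exists (D i); first exact: cube_hull_vertex.
  by apply: (le_lt_trans xi); rewrite ltrDl.
Qed.

End uniform_tightness.

(** * Exponential tightness and convergence of moments *)

Section gaussian_sequence.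
Context (R : realType) (E : completeNormedModType R) (sepE : separable E).
Context (mu : nat -> probability (borel E) R) (mu' : probability (borel E) R).
Hypothesis cvgmu : weak_cvg mu mu'.
Hypothesis gmu : forall n, gaussian_law (mu n).
Local Notation q := (Num.sqrt (2 : R)).

Let q1 : 1 <= q.
Proof. by rewrite -[leLHS]sqrtr1 ler_sqrt// ler1n. Qed.

Let q0 : 0 < q. Proof. exact: lt_le_trans ltr01 q1. Qed.

Let qk (k : nat) : (q ^+ k) ^+ 2 = 2 ^+ k.
Proof. by rewrite exprAC sqr_sqrtr. Qed.

Lemma dyadic_interval (b y : R) : 1 < b -> 1 <= y -> exists k : nat, b ^+ k <= y < b ^+ k.+1.
Proof.
move=> b1 y1.
have ex : exists n : nat, y < b ^+ n.
  have : (b^-1) ^+ n @[n --> \oo] --> (0 : R).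
    by apply: cvg_expr; rewrite ger0_norm ?invr_ge0 ?invf_lt1//; lra.
  have y0 : 0 < y^-1 by rewrite invr_gt0; lra.
  move=> /cvgr0_norm_lt/(_ _ y0)[n _ /(_ n (leqnn n))] /= H; exists n.
  move: H; rewrite normrX ger0_norm ?invr_ge0; last lra.
  rewrite exprVn ltf_pV2// posrE ?exprn_gt0; lra.
case: (ex_minnP ex) => -[|k] yk kmin; first by rewrite expr0 ltNge y1 in yk.
by exists k; rewrite yk andbT leNgt; apply/negP => /kmin; rewrite ltnn.
Qed.

(** Choose k with $2^k \le g < 2^{k+1}$.  Then $\sqrt g\,9K$ contains $9 \cdot 2^{k/2} K$,
    outside which the mass is at most $2 (4e)^{2^k}$ where $2^k > g/2$; hence the
    choice $4e = \exp(-2a)$. *)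
Theorem exponential_tightness (a : R) : 0 <= a ->
  exists K : set E, [/\ compact K, closed K & forall n (g : R), 1 <= g ->
    (mu n [set x | ~ K ((Num.sqrt g)^-1 *: (x : E))] <= (2 * expR (- a * g))%:E)%E].
Proof.
move=> a0; pose e := expR (- (2 * a)) / 4.
have e0 : 0 < e by rewrite divr_gt0// expR_gt0.
have e4 : 4 * e = expR (- (2 * a)) by rewrite /e; field.
have [K [cK clK aK muK]] := abs_convex_tight sepE cvgmu e0.
exists (dilate 9 K); split.
- have -> : dilate 9 K = (fun x : E => (9 : R) *: x) @` K.
    apply/seteqP; split=> [x Kx|_ [x Kx <-]].
      by exists (9^-1 *: x) => //; rewrite scalerA divff// scale1r.
    by rewrite /dilate /= scalerA mulVf// scale1r.
  apply: continuous_compact => //; apply: continuous_subspaceT => x.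
  exact: scaler_continuous.
- rewrite /dilate; apply: (@closed_comp _ _ (fun x : E => 9^-1 *: x) K) => // x _.
  exact: scaler_continuous.
move=> n g g1; have [k /andP[kg gk]] := dyadic_interval (ltr1n R 2 : 1 < 2%:R) g1.
have g0 : 0 < g by lra.
have sg0 : 0 < Num.sqrt g by rewrite sqrtr_gt0.
have -> : [set x : E | ~ dilate 9 K ((Num.sqrt g)^-1 *: x)] = ~` dilate (9 * Num.sqrt g) K.
  by apply/seteqP; split=> x /=; rewrite /dilate /= scalerA invfM.
have mK : measurable (K : set (borel E)) by exact: closed_borel.
apply: (@le_trans _ _ (mu n (~` dilate (9 * q ^+ k) K))).
  apply: le_measure; rewrite ?inE.
  - by apply: measurableC; exact: dilate_borel.
  - by apply: measurableC; exact: dilate_borel.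
  apply: subsetC; apply: sub_dilate => //.
  rewrite ler_pM2l// -(@ler_pXn2r _ 2)// ?nnegrE ?exprn_ge0 ?(ltW q0) ?(ltW sg0)//.
  by rewrite qk sqr_sqrtr ?(ltW g0).
apply: le_trans (fernique sepE (gmu n) k mK aK (muK n) _) _.
  rewrite (ltW e0)/= /e ler_pdivrMr// mulVf// expR_le1; lra.
rewrite lee_fin ler_pM2l// e4 -expRM_natl ler_expR natrX.
have := ltW gk; rewrite exprS; nra.
Qed.

(** The fourth power of the norm grows by the factor 4 from one of the shells at
    radii $2^{k/2}$ to the next, whereas Fernique's estimate for a ball makes their
    masses decay doubly exponentially. *)
Theorem fourth_moment_bound : exists2 C : R, 0 <= C &
  forall n, (\int[mu n]_x ((`|x : E| ^+ 4)%:E) <= C%:E)%E.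
Proof.
have e0 : (0 : R) < 8^-1 by rewrite invr_gt0.
have [K [cK clK aK muK]] := abs_convex_tight sepE cvgmu e0.
have [M M0 KM] : exists2 M : R, 0 < M & forall x, K x -> `|x| <= M.
  have [M [_ MK]] := compact_bounded cK.
  exists (`|M| + 1); first by rewrite ltr_wpDl.
  by move=> x Kx; apply: (MK (`|M| + 1)) => //; rewrite (le_lt_trans (ler_norm M))// ltrDl.
pose A : set E := [set x | `|x| <= M].
have cA : closed A.
  have := @closed_norm_ball _ E 0 M; congr closed.
  by apply/seteqP; split=> x /=; rewrite subr0.
have mA : measurable (A : set (borel E)) by exact: closed_borel.
have muA n : (mu n (~` A) <= (8^-1)%:E)%E.
  apply: le_trans (muK n); apply: le_measure; rewrite ?inE.
  - exact: measurableC.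
  - by apply: measurableC; exact: closed_borel.
  - by apply: subsetC => x; exact: KM.
have tail n k : (mu n [set x : borel E | (9 * q ^+ k * M < `|x : E|)%R] <= (2 * 2^-1 ^+ (2 ^ k))%:E)%E.
  have := fernique sepE (gmu n) k mA (closed_ball_abs_convex E M) (muA n).
  rewrite (_ : 4 * 8^-1 = 2^-1 :> R); last by field.
  rewrite (_ : ~` dilate _ _ = [set x : borel E | (9 * q ^+ k * M < `|x : E|)%R]).
    by apply; apply/andP; split; lra.
  have t0 : 0 < 9 * q ^+ k by rewrite mulr_gt0// exprn_gt0.
  apply/seteqP; split=> x; rewrite /dilate /A /= normrZ gtr0_norm ?invr_gt0//.
    by move=> /negP; rewrite -ltNge ltr_pdivlMl.
  by move=> h; apply/negP; rewrite -ltNge ltr_pdivlMl.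
pose c := (18 * M) ^+ 4.
have c0 : 0 <= c by rewrite exprn_ge0// mulr_ge0// ltW.
pose I k : set (borel E) := [set x : borel E | (9 * q ^+ k * M < `|x : E|)%R].
have mI k : measurable (I k).
  rewrite (_ : I k = (fun x : borel E => `|x : E|) @^-1` `]9 * q ^+ k * M, +oo[%classic).
    by rewrite -[X in measurable X]setTI; apply: norm_measurable => //; exact: measurable_itv.
  by apply/seteqP; split=> x /=; rewrite in_itv /= andbT.
pose F k (x : borel E) : \bar R := (c * 4 ^+ k.+1 * \1_(I k) x)%:E.
have c4 k : 0 <= c * 4 ^+ k.+1 by rewrite mulr_ge0// exprn_ge0.
have F0 k x : (0 <= F k x)%E.
  by rewrite lee_fin mulr_ge0.
have mF k : measurable_fun setT (F k).
  by apply/measurable_EFinP; apply: measurable_funM => //; exact: measurable_indic.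
have q1' : 1 < q.
  by rewrite lt_neqAle q1 andbT; apply/eqP => h; have := qk 1; rewrite expr1 -h !expr1n expr1; lra.
have pointwise x : ((`|x : E| ^+ 4)%:E <= c%:E + \sum_(k <oo) F k x)%E.
  have S0 : (0 <= \sum_(k <oo) F k x)%E by exact: nneseries_ge0.
  have [xM|xM] := leP `|x : E| (18 * M).
    apply: (@le_trans _ _ c%:E); last exact: leeDl.
    by rewrite lee_fin /c; apply: lerXn2r; rewrite ?nnegrE// mulr_ge0// ltW.
  have M18 : 0 < 18 * M by rewrite mulr_gt0.
  have y1 : 1 <= `|x : E| / (18 * M) by rewrite ler_pdivlMr// mul1r ltW.
  have [k /andP[ky yk]] := dyadic_interval q1' y1.
  rewrite ler_pdivlMr// in ky; rewrite ltr_pdivrMr// in yk.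
  have qk0 : 0 < q ^+ k by exact: exprn_gt0.
  have Ikx : I k x.
    rewrite /I /=; apply: lt_le_trans ky.
    have : 0 < q ^+ k * M by exact: mulr_gt0.
    nra.
  apply: (@le_trans _ _ (F k x)).
    rewrite lee_fin indicE mem_set// mulr1.
    apply: (@le_trans _ _ ((q ^+ k.+1 * (18 * M)) ^+ 4)).
      have yk' := ltW yk.
      have yk0 : 0 <= q ^+ k.+1 * (18 * M) := le_trans (normr_ge0 _) yk'.
      by apply: lerXn2r; rewrite ?nnegrE.
    rewrite exprMn mulrC; apply: ler_wpM2l => //.
    have -> : (q ^+ k.+1) ^+ 4 = (q ^+ k.+1) ^+ 2 * (q ^+ k.+1) ^+ 2 by ring.
    by rewrite qk -exprMn -natrM.
  apply: (@le_trans _ _ (\sum_(k <oo) F k x)%E); last by apply: leeDr; rewrite lee_fin.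
  apply: le_trans (nneseries_lim_ge k.+1 _) => //.
  by rewrite big_mkord big_ord_recr /= leeDr// sume_ge0.
have pow k : 4 ^+ k.+1 * (2 * 2^-1 ^+ (2 ^ k)) <= 64 / (2 ^ k.+1)%:R :> R.
  have le3 : (3 * k <= 2 ^ k + 2)%N.
    case: k => [|[|k]] //; elim: k => // k IH.
    by rewrite expnS; move: IH; set m := (2 ^ _)%N; lia.
  have : (2 ^ (3 * k))%:R <= (2 ^ (2 ^ k + 2))%:R :> R by rewrite ler_nat leq_pexp2l.
  move=> h; rewrite expnD natrM expnM !natrX in h.
  rewrite [(2 ^ k.+1)%:R]natrX exprVn; set z := 2 ^+ (2 ^ k) in h *.
  have z0 : 0 < z by exact: exprn_gt0.
  have k2 : 0 < (2 : R) ^+ k by exact: exprn_gt0.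
  rewrite mulrA ler_pdivrMr// mulrAC ler_pdivlMr ?exprn_gt0//.
  have -> : 4 ^+ k.+1 = 4 * (2 ^+ k * 2 ^+ k) :> R.
    by rewrite exprS -exprMn -natrM.
  rewrite (_ : 2 ^+ 3 ^+ k = 2 ^+ k * 2 ^+ k * 2 ^+ k :> R) in h; last first.
    by rewrite -!exprMn -expr2 -exprSr.
  by rewrite exprS; nra.
exists (c + 64 * c); first by rewrite addr_ge0// mulr_ge0.
move=> n; apply: (@le_trans _ _ (\int[mu n]_x (c%:E + \sum_(k <oo) F k x)))%E.
  apply: ge0_le_integral => //.
  - by apply/measurable_EFinP; apply: measurable_funX; exact: norm_measurable.
  - by apply: emeasurable_funD => //; apply: ge0_emeasurable_sum.
rewrite ge0_integralD//; last 2 first.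
  - by move=> x _; exact: nneseries_ge0.
  - exact: ge0_emeasurable_sum.
rewrite integral_cst//= probability_setT mule1 EFinD; apply: leeD => //.
rewrite integral_nneseries//.
apply: (@le_trans _ _ (\sum_(k <oo) ((64 * c) / (2 ^ k.+1)%:R)%:E)%E); last first.
  by apply: epsilon_trick0; rewrite mulr_ge0.
apply: lee_nneseries => [k _ _|k _]; first by apply: integral_ge0 => x _; exact: F0.
rewrite /F; under eq_integral do rewrite EFinM.
rewrite ge0_integralZl//; last 2 first.
  - by apply/measurable_EFinP; exact: measurable_indic.
  - by rewrite lee_fin.
rewrite integral_indic// setIT; apply: (@le_trans _ _ ((c * 4 ^+ k.+1)%:E * (2 * 2^-1 ^+ (2 ^ k))%:E)%E).
  by apply: lee_wpmul2l; [rewrite lee_fin|exact: tail].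
rewrite -EFinM lee_fin; have := ler_wpM2l c0 (pow k).
have -> : c * (64 / (2 ^ k.+1)%:R) = 64 * c / (2 ^ k.+1)%:R by rewrite mulrCA mulrA.
by rewrite (mulrA c).
Qed.

End gaussian_sequence.

Section moment_convergence.
Context (R : realType) (E : completeNormedModType R).
Context (mu : nat -> probability (borel E) R) (mu' : probability (borel E) R).
Hypothesis cvgmu : weak_cvg mu mu'.

Let clamp (M : R) (h : E -> R) (x : E) : R := Num.max (- M) (Num.min M (h x)).

Let clamp_bounded M h x : 0 <= M -> `|clamp M h x| <= M.
Proof.
by move=> M0; rewrite ler_norml /clamp le_max lexx/= ge_max ge_min lexx andbT; lra.
Qed.

Let clamp_continuous M h : continuous h -> continuous (clamp M h).
Proof.
move=> ch x; apply: (@continuous_max _ _ (fun=> - M : R^o)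
  (fun x => Num.min M (h x) : R^o)); first exact: cvg_cst.
by apply: (@continuous_min _ _ (fun=> M : R^o) (h : E -> R^o)); [exact: cvg_cst|exact: ch].
Qed.

Let clamp_near M h x : 0 < M -> `|h x - clamp M h x| <= M^-1 * h x ^+ 2.
Proof.
move=> M0; have i0 : 0 < M^-1 by rewrite invr_gt0.
have iM : M^-1 * M = 1 by rewrite mulVf ?gt_eqF.
have s0 := sqr_ge0 (h x).
rewrite /clamp; have [hM|hM] := leP (h x) M; last first.
  have -> : Num.max (- M) M = M by apply/max_idPr; lra.
  rewrite gtr0_norm ?subr_gt0//.
  have : M^-1 * M * h x <= M^-1 * h x ^+ 2.
    by rewrite -mulrA ler_pM2l// expr2; apply: ler_wpM2r; lra.
  by rewrite iM; lra.
have [hN|hN] := leP (- M) (h x); first by rewrite subrr normr0 mulr_ge0// ltW.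
rewrite opprK ltr0_norm; last lra.
have : M^-1 * M * (- h x) <= M^-1 * h x ^+ 2.
  by rewrite -mulrA ler_pM2l//; nra.
by rewrite iM; lra.
Qed.

(** Truncation at height M changes the integrals by at most C / M, uniformly in n. *)
Lemma weak_cvg_moment (h : E -> R) (C : R) : continuous h ->
  (forall n, (\int[mu n]_x ((h x ^+ 2)%:E) <= C%:E)%E) ->
  [/\ (\int[mu']_x ((h x ^+ 2)%:E) <= C%:E)%E,
      (forall n, (mu n).-integrable setT (EFin \o (h : borel E -> R))),
      mu'.-integrable setT (EFin \o (h : borel E -> R)) &
      \int[mu n]_x h x @[n --> \oo] --> \int[mu']_x h x].
Proof.
move=> ch hC.
have mh : measurable_fun [set: borel E] (h : borel E -> R) by exact: continuous_borel.
have mh2 : measurable_fun [set: borel E] (fun x : borel E => h x ^+ 2).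
  exact: measurable_funX.
have int_of (nu : probability (borel E) R) : (\int[nu]_x ((h x ^+ 2)%:E) <= C%:E)%E ->
    nu.-integrable setT (EFin \o (fun x : borel E => h x ^+ 2)) /\
    nu.-integrable setT (EFin \o (h : borel E -> R)).
  move=> hnu.
  have i2 : nu.-integrable setT (EFin \o (fun x : borel E => h x ^+ 2)).
    apply/integrableP; split; first exact/measurable_EFinP.
    under eq_integral do rewrite /= ger0_norm ?sqr_ge0//.
    exact: le_lt_trans hnu (ltry _).
  split=> //; apply: (@integrable_dominated _ _ _ _ _ (fun x : borel E => 1 + h x ^+ 2)) => //.
    move=> x; rewrite -[X in _ <= 1 + X]real_normK ?num_real//.
    by have := sqr_ge0 (`|h x| - 1); nra.
  by apply: integrable_add => //; exact: integrable_const.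
have lim_bound : (\int[mu']_x ((h x ^+ 2)%:E) <= C%:E)%E.
  pose u (k : nat) (x : borel E) : R := Num.min k%:R (h x ^+ 2).
  have u0 k x : 0 <= u k x by rewrite /u le_min ler0n sqr_ge0.
  have mu_ k : measurable_fun setT (u k) by exact: measurable_minr.
  have ub k x : `|u k x| <= k%:R by rewrite ger0_norm// /u ge_min lexx.
  have ui (nu : probability (borel E) R) k : nu.-integrable setT (EFin \o u k).
    exact: (@integrable_bounded _ _ _ nu _ k%:R (mu_ k) (ub k)).
  have uC k : (\int[mu']_x (u k x)%:E <= C%:E)%E.
    rewrite (Rintegral_EFin (ui mu' k)) lee_fin.
    have cu : continuous (u k : E -> R).
      move=> x; apply: (@continuous_min _ _ (fun=> k%:R : R^o) (fun x : E => h x ^+ 2 : R^o)).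
        exact: cvg_cst.
      by apply: cvgM; exact: ch.
    apply: (cvgr_to_le (cvgmu cu (ex_intro _ k%:R (ub k)))).
    apply: nearW => n; rewrite -lee_fin -(Rintegral_EFin (ui (mu n) k)).
    apply: le_trans (hC n); apply: ge0_integral_le => // x.
    by rewrite /u ge_min lexx orbT.
  have ucvg x : (u k x)%:E @[k --> \oo] --> (h x ^+ 2)%:E.
    apply: cvg_near_cst; near=> k; congr EFin; rewrite /u; apply/min_idPr.
    by near: k; exact: nbhs_infty_ger.
  have -> : (\int[mu']_x (h x ^+ 2)%:E = limn (fun k => \int[mu']_x (u k x)%:E))%E.
    have -> : (fun x : borel E => (h x ^+ 2)%:E) = (fun x => limn (fun k => (u k x)%:E)).
      by apply/funext => x; apply/esym/cvg_lim.
    rewrite monotone_convergence//.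
    - by move=> k; exact/measurable_EFinP.
    - by move=> k x _; rewrite lee_fin.
    - move=> x _ a b ab; rewrite lee_fin /u le_min !ge_min lexx orbT andbT.
      by rewrite ler_nat ab.
  apply: lime_le; last by apply: nearW.
  apply: ereal_nondecreasing_is_cvgn => a b ab; apply: ge0_integral_le => // x.
  rewrite /u le_min !ge_min lexx orbT andbT.
  by rewrite ler_nat ab.
have C0 : 0 <= C.
  by rewrite -lee_fin; apply: le_trans lim_bound; apply: integral_ge0 => x _; rewrite lee_fin sqr_ge0.
have approx (nu : probability (borel E) R) M : 0 < M ->
    (\int[nu]_x ((h x ^+ 2)%:E) <= C%:E)%E ->
    `|\int[nu]_x h x - \int[nu]_x clamp M h x| <= M^-1 * C.
  move=> M0 hnu; have [i2 i1] := int_of _ hnu.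
  have mc : measurable_fun [set: borel E] (clamp M h : borel E -> R).
    by apply: continuous_borel; exact: clamp_continuous.
  have ic : nu.-integrable setT (EFin \o (clamp M h : borel E -> R)).
    exact: (@integrable_bounded _ _ _ nu _ M mc (fun x => clamp_bounded h x (ltW M0))).
  have id := integrable_sub i1 ic.
  rewrite -RintegralB//; apply: (le_trans (le_normr_Rintegral measurableT id)).
  apply: (@le_trans _ _ (\int[nu]_x (M^-1 * h x ^+ 2))).
    apply: le_Rintegral => //.
    - apply: (@integrable_dominated _ _ _ _ _ (fun x : borel E => M^-1 * h x ^+ 2)) => //.
      + by apply: measurableT_comp => //; exact: measurable_funB.
      + by move=> x; rewrite normr_id; exact: clamp_near.
      + exact: integrable_scale.
    - exact: integrable_scale.
    - by move=> x _; exact: clamp_near.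
  rewrite RintegralZl// ler_pM2l ?invr_gt0//.
  by rewrite -lee_fin -Rintegral_EFin.
split => //; [by move=> n; have [] := int_of _ (hC n)|by have [] := int_of _ lim_bound|].
apply/cvgrPdist_le => e e0.
pose M := 3 * (C + 1) / e.
have M0 : 0 < M by rewrite divr_gt0// mulr_gt0//; lra.
have MC : M^-1 * C <= e / 3.
  rewrite /M invf_div mulrAC ler_pdivrMr; last by rewrite mulr_gt0//; lra.
  by rewrite (_ : e / 3 * (3 * (C + 1)) = e * (C + 1)); [rewrite ler_pM2l//; lra|field].
have := cvgmu (@clamp_continuous M h ch) (ex_intro _ M (fun x => clamp_bounded h x (ltW M0))).
have e30 : 0 < e / 3 by rewrite divr_gt0.
move=> /cvgrPdist_le/(_ _ e30); apply: filterS => n hn.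
have h1 := le_trans (approx _ _ M0 lim_bound) MC.
have h2 := le_trans (approx _ _ M0 (hC n)) MC.
move: hn h1 h2; rewrite !ler_norml => /andP[? ?] /andP[? ?] /andP[? ?].
by apply/andP; split; lra.
Unshelve. all: by end_near. Qed.

End moment_convergence.

Section gaussian_moment_convergence.
Context (R : realType) (E : completeNormedModType R) (sepE : separable E).
Context (mu : nat -> probability (borel E) R) (mu' : probability (borel E) R).
Hypothesis cvgmu : weak_cvg mu mu'.
Hypothesis gmu : forall n, gaussian_law (mu n).

Lemma limit_norm_sqr_integrable :
  mu'.-integrable setT (EFin \o (fun x : borel E => `|x : E| ^+ 2)).
Proof.
have [C C0 HC] := fourth_moment_bound sepE cvgmu gmu.
have c2 : continuous (fun x : E => `|x| ^+ 2).
  by move=> x; apply: cvgM; exact: norm_continuous.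
have [|_ _ //] := weak_cvg_moment cvgmu c2 (C := C).
by move=> n; under eq_integral do rewrite -exprM; exact: HC.
Qed.

(** The fourth moments of the norm control the second moments of f and of its
    square. *)
Lemma gaussian_moments_cvg (f : E -> R) : dual f ->
  law_mean (mu n) f @[n --> \oo] --> law_mean mu' f /\
  law_var (mu n) f @[n --> \oo] --> law_var mu' f.
Proof.
move=> df; have [C C0 HC] := fourth_moment_bound sepE cvgmu gmu.
have [c c0 fc] := dual_bounded df.
have f4 n : (\int[mu n]_x ((f x ^+ 4)%:E) <= (c ^+ 4 * C)%:E)%E.
  apply: (@le_trans _ _ (\int[mu n]_x ((c ^+ 4 * `|x : E| ^+ 4)%R%:E)))%E.
    apply: ge0_integral_le.
    - by apply: measurable_funX; exact: dual_measurable.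
    - by apply: measurable_funM => //; apply: measurable_funX; exact: norm_measurable.
    - by move=> x; rewrite exprn_even_ge0.
    - move=> x; rewrite -exprMn -[leLHS]ger0_norm ?exprn_even_ge0//.
      by rewrite normrX; apply: lerXn2r; rewrite ?nnegrE// mulr_ge0// ltW.
  under eq_integral do rewrite EFinM.
  have mn : measurable_fun [set: borel E] (fun x : borel E => (`|x : E| ^+ 4)%:E).
    by apply/measurable_EFinP; apply: measurable_funX; exact: norm_measurable.
  have c4 : (0 <= (c ^+ 4)%:E)%E by rewrite lee_fin exprn_ge0// ltW.
  rewrite ge0_integralZl//.
  by rewrite (EFinM (c ^+ 4) C); apply: lee_wpmul2l => //; exact: HC.
have cf2 : continuous (fun x : E => f x ^+ 2) by move=> x; apply: cvgM; exact: df.2.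
have f22 n : (\int[mu n]_x (((f x ^+ 2) ^+ 2)%:E) <= (c ^+ 4 * C)%:E)%E.
  by under eq_integral do rewrite -exprM; exact: f4.
have [_ i2 i2' L2] := weak_cvg_moment cvgmu cf2 f22.
have mf4 : measurable_fun [set: borel E] (fun x : borel E => f x ^+ 4).
  by apply: measurable_funX; exact: dual_measurable.
have f2 n : (\int[mu n]_x ((f x ^+ 2)%:E) <= (1 + c ^+ 4 * C)%:E)%E.
  apply: (@le_trans _ _ (\int[mu n]_x (1 + f x ^+ 4)%:E)%E).
    apply: ge0_integral_le => [||x|x].
    - by apply: measurable_funX; exact: dual_measurable.
    - exact: measurable_funD.
    - exact: sqr_ge0.
    - by have := sqr_ge0 (f x ^+ 2 - 1); rewrite (exprM _ 2 2); nra.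
  under eq_integral do rewrite EFinD.
  rewrite ge0_integralD//; last 2 first.
  - by move=> x _; rewrite lee_fin exprn_even_ge0.
  - exact/measurable_EFinP.
  rewrite integral_cst//= probability_setT mule1 EFinD; apply: leeD => //.
have [_ i1 i1' L1] := weak_cvg_moment cvgmu df.2 f2.
split => //; apply: (@cvgB _ R^o) => //.
by apply: cvgM.
Qed.

End gaussian_moment_convergence.

(** * Large deviations from Laplace transforms *)

Section gartner_ellis.
Context (R : realType) (E : completeNormedModType R).
Context (rho : nat -> probability (borel E) R) (g : nat -> R) (V : (E -> R) -> R).
Hypothesis speedg : speed g.

Definition laplace (n : nat) (f : E -> R) : \bar R :=
  (\int[rho n]_x (expR (g n * f x))%:E)%E.

Hypothesis laplace_cvg : forall f (e : R), dual f -> 0 < e -> \forall n \near \oo,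
  ((expR (g n * (V f / 2 - e)))%:E <= laplace n f <= (expR (g n * (V f / 2 + e)))%:E)%E.
Hypothesis exp_tight : forall a : R, 0 <= a -> exists K : set E,
  [/\ compact K, closed K &
      \forall n \near \oo, (rho n (~` K) <= (2 * expR (- a * g n))%:E)%E].

(** The strict inequality of rates leaves room for constant factors, so that sums
    of such sequences are again of this kind. *)
Definition exp_small (b0 : R) (u : nat -> \bar R) : Prop :=
  exists2 b, b0 < b & \forall n \near \oo, (u n <= (expR (- b * g n))%:E)%E.

Let g0 n : 0 < g n. Proof. exact: speedg.1. Qed.

Let g_ge (M : R) : \forall n \near \oo, M <= g n.
Proof. by have /cvgryPge := speedg.2; exact. Qed.

Lemma exp_smallD b0 u v : exp_small b0 u -> exp_small b0 v ->
  exp_small b0 (fun n => u n + v n)%E.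
Proof.
move=> [b b0b ub] [c b0c vc]; pose m := Num.min b c.
have b0m : b0 < m by rewrite lt_min b0b.
exists ((b0 + m) / 2); first lra.
have d0 : 0 < (m - b0) / 2 by lra.
near=> n.
have h : 2 <= expR ((m - b0) / 2 * g n).
  apply: le_trans (expR_ge1Dx _); rewrite -lerBlDl -ler_pdivrMl//.
  by near: n; exact: g_ge.
apply: (@le_trans _ _ ((expR (- m * g n))%:E + (expR (- m * g n))%:E)%E).
  apply: leeD.
    apply: (@le_trans _ _ (expR (- b * g n))%:E); first by near: n.
    by rewrite lee_fin ler_expR ler_pM2r// lerN2 ge_min lexx.
  apply: (@le_trans _ _ (expR (- c * g n))%:E); first by near: n.
  by rewrite lee_fin ler_expR ler_pM2r// lerN2 ge_min lexx orbT.
rewrite -EFinD lee_fin.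
have -> : - ((b0 + m) / 2) * g n = - m * g n + (m - b0) / 2 * g n by field.
rewrite expRD; have := expR_gt0 (- m * g n); nra.
Unshelve. all: by end_near. Qed.

Lemma exp_small_le b0 u v : exp_small b0 v -> (\forall n \near \oo, (u n <= v n)%E) ->
  exp_small b0 u.
Proof.
move=> [b b0b vb] uv; exists b => //; near=> n.
by apply: (@le_trans _ _ (v n)); near: n.
Unshelve. all: by end_near. Qed.

Lemma exp_small_expR b0 b u : b0 < b ->
  (\forall n \near \oo, (u n <= (expR (- b * g n))%:E)%E) -> exp_small b0 u.
Proof. by move=> b0b ub; exists b. Qed.

Let mexp f n : dual f -> measurable_fun [set: borel E] (fun x : borel E => expR (g n * f x)).
Proof.
move=> df; apply: measurableT_comp => //; apply: measurable_funM => //.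
exact: dual_measurable.
Qed.

(** The exponential Chebyshev bound for the mass of the half-space $\lambda \ge c$ under
    the measure with density $e^{g_n\theta}$. *)
Let half_space_term (th la : E -> R) (c : R) (n : nat) : \bar R :=
  ((expR (- c * g n))%:E * laplace n (fun x => (th x + la x)%R))%E.

Let half_space_term_small (th la : E -> R) (b0 c : R) : dual th -> dual la ->
  b0 + V (fun x => th x + la x) / 2 < c -> exp_small b0 (half_space_term th la c).
Proof.
move=> dth dla hc; set v := V _ in hc; pose e := (c - v / 2 - b0) / 2.
have e0 : 0 < e by rewrite /e; lra.
apply: (@exp_small_expR _ (b0 + e)); first lra.
have := laplace_cvg (dual_add dth dla) e0; apply: filterS => n /andP[_ hn].
apply: (@le_trans _ _ ((expR (- c * g n))%:E * (expR (g n * (v / 2 + e)))%:E)%E).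
  by apply: lee_wpmul2l; rewrite ?lee_fin ?expR_ge0.
rewrite -EFinM lee_fin -expRD ler_expR /e.
by rewrite (_ : - c * g n + _ = - (b0 + (c - v / 2 - b0) / 2) * g n)//; field.
Qed.

(** The exponential Chebyshev inequality for the tilted measures, over a finite
    cover by half-spaces of the part of C that lies in a compact set. *)
Lemma tilted_closed_small (th : E -> R) (C : set E) (b0 : R) :
  dual th -> closed C ->
  (forall x, C x -> exists2 la, dual la & b0 < la x - V (fun y => th y + la y) / 2) ->
  exp_small b0 (fun n => \int[rho n]_(x in (C : set (borel E))) (expR (g n * th x))%:E)%E.
Proof.
move=> dth clC HC.
pose W (f : E -> R) := V (fun y => th y + f y) / 2.
pose la x : E -> R := if pselect (C x) is left Cx then projT1 (cid2 (HC x Cx)) else fun=> 0.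
have d0 : dual (fun _ : E => 0 : R).
  by split=> [a x y|x]; [rewrite mulr0 addr0|exact: cvg_cst].
have dla x : dual (la x).
  by rewrite /la; case: pselect => // Cx; case: (cid2 (HC x Cx)).
have hla x : C x -> b0 < la x x - W (la x).
  by move=> Cx; rewrite /la; case: pselect => // Cx'; case: (cid2 (HC x Cx')).
(* the midpoint: U x below is then a neighbourhood of x, and the rate of its
   Chebyshev bound still exceeds b0 *)
pose c x := (b0 + la x x + W (la x)) / 2.
pose U x := [set y | c x < la x y].
have oU x : open (U x).
  by apply: (@open_comp _ _ (la x) [set r | c x < r]) => [y _|];
    [exact: (dla x).2|exact: open_gt].
pose v2 := V (fun y => 2 * th y) / 2.
have d2 := dual_scale 2 dth.
(* the weights exp (s g n) and exp (- s g n) balance the mass outside K against the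
   Laplace transform at 2 th *)
pose s := b0 + 1 + v2 + 1.
have [K [cK clK HK]] := exp_tight (a := Num.max 0 (s + b0 + 1)) ltac:(by rewrite le_max lexx).
have cCK : compact (C `&` K) by rewrite setIC; exact: compact_closedI.
have [D' D'C Dcov] : finite_subset_cover (C `&` K) U (C `&` K).
  rewrite compact_cover in cCK; apply: cCK => [x _|x [Cx Kx]]; first exact: oU.
  by exists x => //=; rewrite /U /= /c; have := hla x Cx; lra.
pose T n := ((expR (s * g n) / 2)%:E * rho n (~` K) +
   (expR (- s * g n) / 2)%:E * laplace n (fun y => (2 * th y)%R))%E.
have Tsmall : exp_small b0 T.
  apply: exp_smallD.
    apply: (@exp_small_expR _ (b0 + 1)); first lra.
    apply: filterS HK => n hn.
    apply: (@le_trans _ _ ((expR (s * g n) / 2)%:E * (2 * expR (- Num.max 0 (s + b0 + 1) * g n))%:E)%E).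
      by apply: lee_wpmul2l; rewrite ?lee_fin// divr_ge0// expR_ge0.
    rewrite -EFinM lee_fin mulrA divfK// -expRD ler_expR -mulrDl ler_pM2r//.
    have : s + b0 + 1 <= Num.max 0 (s + b0 + 1) by rewrite le_max lexx orbT.
    lra.
  apply: (@exp_small_expR _ (b0 + 1)); first lra.
  have := laplace_cvg d2 ltr01; apply: filterS => n /andP[_ hn].
  apply: (@le_trans _ _ ((expR (- s * g n) / 2)%:E * (expR (g n * (v2 + 1)))%:E)%E).
    by apply: lee_wpmul2l; rewrite ?lee_fin// divr_ge0// expR_ge0.
  rewrite -EFinM lee_fin mulrAC -expRD.
  rewrite (_ : - s * g n + g n * (v2 + 1) = - (b0 + 1) * g n); last by rewrite /s; ring.
  by have := expR_gt0 (- (b0 + 1) * g n); lra.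
have Ssmall (S : seq E) : (forall x, x \in S -> C x) ->
    exp_small b0 (fun n => \sum_(x <- S) half_space_term th (la x) (c x) n)%E.
  elim: S => [_|x S IH HS].
    apply: (@exp_small_expR _ (b0 + 1)); first lra.
    by apply: nearW => n; rewrite big_nil lee_fin expR_ge0.
  under eq_fun do rewrite big_cons; apply: exp_smallD.
    apply: half_space_term_small => //; rewrite /c.
    by have := hla x (HS x (mem_head _ _)); rewrite /W; lra.
  by apply: IH => y yS; apply: HS; rewrite inE yS orbT.
have HS : forall x, x \in enum_fset D' -> C x.
  by move=> x /D'C; rewrite inE => -[].
apply: exp_small_le (exp_smallD Tsmall (Ssmall _ HS)) _.
apply: nearW => n.
have mK : measurable (~` K : set (borel E)) by apply: measurableC; exact: closed_borel.
pose h1 (y : borel E) : \bar R := ((expR (s * g n) / 2)%:E * (\1_(~` K) y)%:E)%E.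
pose h2 (y : borel E) : \bar R := ((expR (- s * g n) / 2)%:E * (expR (g n * (2 * th y)))%:E)%E.
pose h3 (x : E) (y : borel E) : \bar R :=
  ((expR (- c x * g n))%:E * (expR (g n * (th y + la x y)))%:E)%E.
have h10 y : (0 <= h1 y)%E by rewrite mule_ge0// lee_fin// divr_ge0// expR_ge0.
have h20 y : (0 <= h2 y)%E by rewrite mule_ge0// lee_fin ?expR_ge0// divr_ge0// expR_ge0.
have h30 x y : (0 <= h3 x y)%E by rewrite mule_ge0// lee_fin expR_ge0.
have m1 : measurable_fun setT h1.
  by apply: emeasurable_funM => //; apply/measurable_EFinP; exact: measurable_indic.
have m2 : measurable_fun setT h2.
  by apply: emeasurable_funM => //; apply/measurable_EFinP; exact: (mexp n d2).
have m3 x : measurable_fun setT (h3 x).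
  apply: emeasurable_funM => //; apply/measurable_EFinP.
  exact: (mexp n (dual_add dth (dla x))).
have mS : measurable_fun setT (fun y => \sum_(x <- enum_fset D') h3 x y)%E.
  exact: emeasurable_sum.
have S0 y : (0 <= \sum_(x <- enum_fset D') h3 x y)%E by apply: sume_ge0.
have mC : measurable (C : set (borel E)) by exact: closed_borel.
apply: (@le_trans _ _ (\int[rho n]_y (h1 y + h2 y + \sum_(x <- enum_fset D') h3 x y))%E).
  apply: (@le_trans _ _ (\int[rho n]_(y in (C : set (borel E)))
      (h1 y + h2 y + \sum_(x <- enum_fset D') h3 x y))%E); last first.
    apply: ge0_subset_integral => //.
    - by apply: emeasurable_funD => //; exact: emeasurable_funD.
    - by move=> y _; rewrite !adde_ge0.
  apply: ge0_le_integral => //.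
  - by apply/measurable_EFinP; apply: measurable_funTS; exact: mexp.
  - by apply: measurable_funTS; apply: emeasurable_funD => //; exact: emeasurable_funD.
  move=> y Cy; have [Ky|nKy] := pselect (K y).
    have [x /= xD Uxy] := Dcov y (conj Cy Ky).
    apply: (@le_trans _ _ (h3 x y)).
      rewrite /h3 -EFinM lee_fin -expRD ler_expR.
      have : c x * g n <= la x y * g n by rewrite ler_pM2r// ltW.
      lra.
    apply: (@le_trans _ _ (\sum_(x <- enum_fset D') h3 x y)%E); last first.
      by apply: leeDr; rewrite adde_ge0.
    by rewrite (big_rem x)//= leeDl// sume_ge0.
  apply: (@le_trans _ _ (h1 y + h2 y)%E); last by rewrite leeDl.
  (* the arithmetic-geometric mean inequality absorbs the tilt outside K *)
  rewrite /h1 /h2 indicE mem_set// mule1 -EFinM -EFinD lee_fin.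
  rewrite mulrAC -expRD; set z := expR (g n * th y).
  have -> : expR (- s * g n + g n * (2 * th y)) = expR (- s * g n) * z ^+ 2.
    by rewrite expRD; congr (_ * _); rewrite /z -expRM_natl; congr expR; ring.
  have -> : expR (- s * g n) = (expR (s * g n))^-1 by rewrite mulNr expRN.
  have w0 := expR_gt0 (s * g n); set w := expR (s * g n) in w0 *.
  rewrite -subr_ge0.
  have -> : w / 2 + w^-1 * z ^+ 2 / 2 - z = w^-1 * (w - z) ^+ 2 / 2 by field; rewrite gt_eqF.
  by rewrite divr_ge0// mulr_ge0 ?sqr_ge0// invr_ge0 ltW.
have m12 : measurable_fun setT (fun y => h1 y + h2 y)%E by exact: emeasurable_funD.
rewrite ge0_integralD//; last by move=> y _; rewrite adde_ge0.
rewrite ge0_integralD//.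
rewrite ge0_integral_sum//.
have k0 (t : R) : 0 <= expR t / 2 by rewrite divr_ge0// expR_ge0.
apply: leeD.
  apply: leeD.
    by rewrite ge0_integral_scale// integral_indic// setIT.
  rewrite ge0_integral_scale//; first exact: (mexp n d2).
apply: lee_sum => x _; rewrite ge0_integral_scale ?expR_ge0//.
- exact: (mexp n (dual_add dth (dla x))).
Qed.

(** The case of a zero tilt. *)
Theorem closed_upper_bound (C : set E) (a : R) : closed C ->
  (forall x, C x -> exists2 la, dual la & a < la x - V la / 2) ->
  \forall n \near \oo, (rho n C <= (expR (- a * g n))%:E)%E.
Proof.
move=> clC HC.
have d0 : dual (fun _ : E => 0 : R).
  by split=> [c x y|x]; [rewrite mulr0 addr0|exact: cvg_cst].
have [|b ab] := @tilted_closed_small (fun=> 0) C a d0 clC.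
  move=> x /HC[la dla hla]; exists la => //.
  by rewrite (_ : (fun y => 0 + la y) = la)//; apply/funext => y; rewrite add0r.
apply: filterS => n.
under eq_integral do rewrite mulr0 expR0.
rewrite integral_cst//; last exact: closed_borel.
rewrite mul1e => /le_trans; apply.
by rewrite lee_fin ler_expR ler_pM2r// lerN2 ltW.
Qed.

Hypothesis V_ge0 : forall f, dual f -> 0 <= V f.
Hypothesis VZ : forall (c : R) f, dual f -> V (fun x => c * f x) = c ^+ 2 * V f.

(** The tilt by th concentrates the mass near the point x that represents the
    covariance with th, since the complement of a neighbourhood is closed and obeys
    the upper bound; undoing the tilt near x costs the exponent V th / 2. *)
Theorem exposed_lower_bound (th : E -> R) (x : E) (G : set E) (b : R) : dual th ->
  (forall la, dual la -> V (fun y => th y + la y) = V th + 2 * la x + V la) ->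
  open G -> G x -> V th / 2 < b ->
  \forall n \near \oo, ((expR (- b * g n))%:E <= rho n G)%E.
Proof.
move=> dth hx oG Gx hb.
have thx : th x = V th.
  have := hx _ dth; rewrite (_ : (fun y => th y + th y) = (fun y => 2 * th y)).
    by rewrite VZ//; lra.
  by apply/funext => y; rewrite mulr_natl mulr2n.
pose k := (b - V th / 2) / 3.
have k0 : 0 < k by rewrite /k; lra.
pose B := G `&` [set y | th y < th x + k].
have oB : open B.
  apply: openI => //; apply: (@open_comp _ _ th [set r | r < th x + k]) => [y _|].
    exact: dth.2.
  exact: open_lt.
have clC : closed (~` B) by exact: open_closedC.
(* a suitable multiple of a functional that separates y from x *)
have HC y : (~` B) y -> exists2 la, dual la & - (V th / 2) < la y - V (fun z => th z + la z) / 2.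
  move=> nBy; have yx : y <> x by move=> yx; apply: nBy; rewrite yx; split=> //=; rewrite ltrDl.
  have [f df fyx] : exists2 f, dual f & f y <> f x.
    apply: contrapT => h; apply: yx; apply: dual_separates => f df.
    by apply: contrapT => fyx; apply: h; exists f.
  pose d := f y - f x; have d0 : d != 0 by rewrite subr_eq0; apply/eqP.
  pose v := V f + 1; have v0 : 0 < v by rewrite /v; have := V_ge0 df; lra.
  exists (fun z => d / v * f z); first exact: dual_scale.
  rewrite hx ?VZ//; last exact: dual_scale.
  have dd : 0 < d ^+ 2 / v by rewrite divr_gt0// exprn_even_gt0.
  have e1 : (d / v) ^+ 2 * V f = d ^+ 2 / v * (V f / v) by field; rewrite gt_eqF.
  have e2 : d / v * f y - d / v * f x = d ^+ 2 / v by rewrite -mulrBr -/d; field; rewrite gt_eqF.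
  have e3 : V f / v < 1 by rewrite ltr_pdivrMr// /v; lra.
  rewrite e1; nra.
have [b1 hb1 Hb1] := tilted_closed_small dth clC HC.
pose e := Num.min k ((b1 + V th / 2) / 2).
have ek : e <= k by rewrite ge_min lexx.
have eb1 : e <= (b1 + V th / 2) / 2 by rewrite ge_min lexx orbT.
have e0 : 0 < e by rewrite lt_min k0; lra.
have LT := laplace_cvg dth e0.
have mB : measurable (B : set (borel E)) by exact: open_borel.
have mG : measurable (G : set (borel E)) by exact: open_borel.
near=> n.
have big : 2 <= expR (e * g n).
  apply: le_trans (expR_ge1Dx _); rewrite -lerBlDl -ler_pdivrMl//.
  by near: n; exact: g_ge.
apply: (@le_trans _ _ (rho n B)); last first.
  by apply: le_measure; rewrite ?inE// => y [].
have fB : rho n B \is a fin_num by exact: fin_num_measure.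
have onB : (\int[rho n]_(y in (B : set (borel E))) (expR (g n * th y))%:E <=
    (expR (g n * (V th + k)))%:E * rho n B)%E.
  rewrite -integral_cst//; apply: ge0_le_integral => //.
  - by apply/measurable_EFinP; apply: measurable_funTS; exact: mexp.
  - move=> y [_ /= hy]; rewrite lee_fin ler_expR ler_pM2l//.
    by rewrite -thx ltW.
have onC : (\int[rho n]_(y in (~` B : set (borel E))) (expR (g n * th y))%:E <=
    (expR (- b1 * g n))%:E)%E by near: n.
have tot : ((expR (g n * (V th / 2 - e)))%:E <= laplace n th)%E.
  by have : ((expR (g n * (V th / 2 - e)))%:E <= laplace n th
    <= (expR (g n * (V th / 2 + e)))%:E)%E; [near: n|case/andP].
have split : laplace n th = (\int[rho n]_(y in (B : set (borel E))) (expR (g n * th y))%:E +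
    \int[rho n]_(y in (~` B : set (borel E))) (expR (g n * th y))%:E)%E.
  rewrite -ge0_integral_setU//.
  - by rewrite setUv.
  - exact: measurableC.
  - by rewrite setUv; apply/measurable_EFinP; exact: mexp.
  - by apply/disj_setPS; rewrite setICr.
have := le_trans tot (eq_ind_r (fun z => (z <= _)%E) (leeD onB onC) split).
rewrite -(fineK fB) -EFinM -EFinD !lee_fin; set p := fine (rho n B) => h.
have w0 := expR_gt0 (g n * (V th / 2 - e)).
have h1 : 2 * expR (- b1 * g n) <= expR (g n * (V th / 2 - e)).
  apply: (@le_trans _ _ (expR (e * g n) * expR (- b1 * g n))).
    by apply: ler_wpM2r => //; exact: expR_ge0.
  rewrite -expRD ler_expR -mulrDl mulrC ler_pM2l//; lra.
have h2 : expR (g n * (V th / 2 - e)) <= 2 * (expR (g n * (V th + k)) * p) by lra.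
have u0 := expR_gt0 (g n * (V th + k)).
have p0 : 0 <= p by exact: fine_ge0.
rewrite -(ler_pM2l u0).
have h3 : 2 * (expR (g n * (V th + k)) * expR (- b * g n)) <= expR (g n * (V th / 2 - e)).
  apply: (@le_trans _ _ (expR (e * g n) * (expR (g n * (V th + k)) * expR (- b * g n)))).
    by apply: ler_wpM2r => //; rewrite mulr_ge0// expR_ge0.
  have bk : b = V th / 2 + 3 * k by rewrite /k; field.
  rewrite -!expRD ler_expR (_ : e * g n + _ = g n * (e + (V th + k) - b)); last by ring.
  rewrite ler_pM2l//; lra.
lra.
Unshelve. all: by end_near. Qed.

End gartner_ellis.

(** * Bochner integrals *)

Section bochner_theory.
Context d (T : measurableType d) (R : realType) (mu : probability T R).
Context (E : completeNormedModType R) (sepE : separable E).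
Implicit Types (f s : T -> E).

Let meas (f : T -> E) := measurable_fun [set: T] (f : T -> borel E).

Let meas_sub f s : meas f -> meas s -> meas (fun t => f t - s t).
Proof.
move=> mf ms; apply: weakly_measurable => // th dth.
rewrite (_ : th \o _ = fun t => th (f t) - th (s t)); last first.
  by apply/funext => t /=; rewrite dualB.
apply: measurable_funB.
  exact: (measurableT_comp (dual_measurable dth) mf).
exact: (measurableT_comp (dual_measurable dth) ms).
Qed.

Let meas_norm f : meas f -> measurable_fun setT (fun t => `|f t|).
Proof. by move=> mf; exact: (measurableT_comp (@norm_measurable _ E) mf). Qed.

Let meas_dual th f : dual th -> meas f -> measurable_fun setT (fun t => th (f t)).
Proof. by move=> dth mf; exact: (measurableT_comp (dual_measurable dth) mf). Qed.

Lemma dual_sum (I : Type) (r : seq I) (F : I -> E) (th : E -> R) : dual th ->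
  th (\sum_(i <- r) F i) = \sum_(i <- r) th (F i).
Proof. by move=> dth; apply: big_morph; [move=> x y; exact: dualD|exact: dual0]. Qed.

Lemma Rintegral_sum (I : Type) (r : seq I) (F : I -> T -> R) :
  (forall i, mu.-integrable setT (EFin \o F i)) ->
  mu.-integrable setT (EFin \o (fun t => \sum_(i <- r) F i t)) /\
  \int[mu]_t (\sum_(i <- r) F i t) = \sum_(i <- r) \int[mu]_t F i t.
Proof.
move=> Fi; elim: r => [|i r [IH1 IH2]].
  rewrite big_nil (_ : (fun t => _) = fun=> 0); last by apply/funext => t; rewrite big_nil.
  by split; [exact: integrable_const|rewrite Rintegral_const].
rewrite big_cons (_ : (fun t => _) = fun t => F i t + \sum_(j <- r) F j t); last first.
  by apply/funext => t; rewrite big_cons.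
by split; [exact: integrable_add|rewrite RintegralD// IH2].
Qed.

Lemma simple_integral_dual s th : simple_fun s -> dual th ->
  mu.-integrable setT (EFin \o (fun t => th (s t))) /\
  th (simple_integral mu s) = \int[mu]_t th (s t).
Proof.
move=> [ms fs] dth; rewrite /simple_integral fsbig_finite//.
set r := fset_set (range s).
have ms1 y : measurable (s @^-1` [set y]).
  rewrite -[X in measurable X]setTI; apply: ms => //; apply: closed_borel.
  exact: (accessible_closed_set1 (hausdorff_accessible (@norm_hausdorff _ E))).
pose F (y : E) (t : T) : R := th y * \1_(s @^-1` [set y]) t.
have Fi y : mu.-integrable setT (EFin \o F y).
  apply: integrable_scale; apply: (@integrable_bounded _ _ _ mu _ 1) => //.
  by move=> t; rewrite indicE; case: (_ \in _); rewrite ?normr1 ?normr0.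
have sE t : th (s t) = \sum_(y <- r) F y t.
  have sr : s t \in (r : seq E) by rewrite in_fset_set// inE; exists t.
  rewrite (big_rem _ sr) /= {1}/F indicE mem_set// mulr1 big1_seq ?addr0// => y /=.
  rewrite mem_rem_uniq ?fset_uniq// inE => /andP[/eqP ys _].
  by rewrite /F indicE memNset ?mulr0// => /esym.
have [iS eS] := Rintegral_sum r Fi.
split; first by move: iS; congr (_.-integrable _ (EFin \o _)); apply/funext => t; rewrite sE.
rewrite dual_sum//; under [RHS]eq_Rintegral do rewrite sE.
rewrite eS; apply: eq_bigr => y _.
rewrite RintegralZl//; last first.
  apply: (@integrable_bounded _ _ _ mu _ 1) => // t.
  by rewrite indicE; case: (_ \in _); rewrite ?normr1 ?normr0.
by rewrite Rintegral_indic// dualZ// mulrC.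
Qed.

Let dist f s : \bar R := (\int[mu]_t (`|f t - s t|)%:E)%E.

Let dual_approx f s th C : meas f -> simple_fun s -> dual th ->
  (forall x, `|th x| <= C * `|x|) -> 0 <= C -> (dist f s < +oo)%E ->
  mu.-integrable setT (EFin \o (fun t => th (f t))) /\
  `|\int[mu]_t th (f t) - th (simple_integral mu s)| <= C * fine (dist f s).
Proof.
move=> mf ss dth thC C0 fsoo; have [ms _] := ss.
have [is_ es] := simple_integral_dual ss dth.
have mfs := meas_sub mf ms.
have ifs : mu.-integrable setT (EFin \o (fun t => `|f t - s t|)).
  apply/integrableP; split; first by apply/measurable_EFinP; exact: meas_norm.
  by under eq_integral do rewrite /= normr_id.
have id : mu.-integrable setT (EFin \o (fun t => th (f t - s t))).
  apply: (integrable_dominated (g := fun t => C * `|f t - s t|)) => //.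
    exact: meas_dual.
  exact: integrable_scale.
have fE : (fun t => th (f t)) = fun t => th (f t - s t) + th (s t).
  by apply/funext => t; rewrite dualB// subrK.
have if_ : mu.-integrable setT (EFin \o (fun t => th (f t))).
  by rewrite fE; exact: integrable_add.
split=> //; rewrite es -RintegralB//.
have -> : \int[mu]_t (th (f t) - th (s t)) = \int[mu]_t th (f t - s t).
  by apply: eq_Rintegral => t _; rewrite dualB.
apply: (le_trans (le_normr_Rintegral measurableT id)).
apply: (@le_trans _ _ (\int[mu]_t (C * `|f t - s t|))).
  apply: le_Rintegral => //.
  - apply: (integrable_dominated (g := fun t => C * `|f t - s t|)) => //.
    + by apply: measurableT_comp => //; exact: meas_dual.
    + by move=> t; rewrite normr_id.
    + exact: integrable_scale.
  - exact: integrable_scale.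
by rewrite RintegralZl.
Qed.

(** Both sides are the limits of their values on the approximating simple functions. *)
Theorem bochner_integral_dual f y th : is_bochner_integral mu f y -> dual th ->
  mu.-integrable setT (EFin \o (fun t => th (f t))) /\ th y = \int[mu]_t th (f t).
Proof.
move=> [mf [s [ss s0 sy]]] dth.
have [C C0 thC] := dual_bounded dth.
have [finn lim0] := (fine_cvgP _ _).1 s0.
have near_fin : \forall n \near \oo, (dist f (s n) < +oo)%E.
  by apply: filterS finn => n; rewrite ge0_fin_numE// integral_ge0// => t _; rewrite lee_fin.
split.
  by have [n hn] := filter_ex near_fin; have [] := dual_approx mf (ss n) dth thC (ltW C0) hn.
have L1 : th (simple_integral mu (s n)) @[n --> \oo] --> th y.
  exact: (cvg_comp _ _ sy (dth.2 y)).
apply: (cvg_unique _ L1) => //.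
apply/cvgrPdist_le => e e0.
have eC : 0 < e / C by exact: divr_gt0.
move/cvgr0_norm_le : lim0 => /(_ _ eC) lim0.
near=> n.
have hn : (dist f (s n) < +oo)%E by near: n.
have [_ h] := dual_approx mf (ss n) dth thC (ltW C0) hn.
apply: (le_trans h); rewrite -ler_pdivlMl// mulrC.
apply: (le_trans (ler_norm _)); near: n; exact: lim0.
Unshelve. all: by end_near. Qed.

(** The values are rounded to points of a dense sequence; the part that the first N
    points fail to approximate tends to 0 by dominated convergence. *)
Lemma simple_approximation f (e : R) : meas f ->
  mu.-integrable setT (EFin \o (fun t => `|f t|)) -> 0 < e ->
  exists2 s, simple_fun s & (dist f s <= e%:E)%E.
Proof.
move=> mf fi e0; have [D dD] := separable_dense_seq sepE.
have e20 : 0 < e / 2 by exact: divr_gt0.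
(* the last of the first N points of D that is close to the value, and 0 if there
   is none *)
pose a := fix a (N : nat) (t : T) : E :=
  if N is n.+1 then if `|f t - D n| < e / 2 then D n else a n t else 0.
have ma1 n : measurable_fun setT (fun t => `|f t - D n| < e / 2).
  have msub : measurable_fun setT (fun t => `|f t - D n|).
    apply: meas_norm; apply: (meas_sub mf).
    by apply: weakly_measurable => // th dth; exact: (@measurable_cst _ _ T R setT (th (D n))).
  exact: measurable_fun_ltr.
have ma N : meas (a N).
  elim: N => [|N IH]; apply: weakly_measurable => // th dth.
    exact: (@measurable_cst _ _ T R setT (th 0)).
  rewrite (_ : th \o _ = fun t => if `|f t - D N| < e / 2 then th (D N) else th (a N t)).
    by apply: measurable_fun_ifT => //; exact: meas_dual.
  by apply/funext => t /=; case: ifP.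
have fa N : finite_set (range (a N)).
  elim: N => [|N IH].
    by apply: (@sub_finite_set _ _ [set 0]) => [_ [t _ <-]|] //; exact: finite_set1.
  apply: (@sub_finite_set _ _ ([set D N] `|` range (a N))).
    by move=> _ [t _ <-] /=; case: ifP => _; [left|right; exists t].
  by rewrite finite_setU; split=> //; exact: finite_set1.
have aP N t : `|f t - a N t| < e / 2 \/ a N t = 0.
  by elim: N => [|N IH] /=; [right|case: ifP => // h; left].
have aclose t : \forall N \near \oo, `|f t - a N t| < e / 2.
  have [k hk] := dD (f t) _ e20; exists k.+1 => //.
  move=> N /=; elim: N => // N IH; rewrite ltnS /= => kN; case: ifP => // h.
  move: kN; rewrite leq_eqVlt => /orP[/eqP kN|/IH//].
  by move: h; rewrite -kN hk.
pose u N t := if `|f t - a N t| < e / 2 then 0 else `|f t|.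
have mu_ N : measurable_fun setT (u N).
  apply: measurable_fun_ifT => //; last exact: meas_norm.
  by apply: measurable_fun_ltr => //; apply: meas_norm; exact: meas_sub.
have u0 N t : 0 <= u N t by rewrite /u; case: ifP.
have ule N t : u N t <= `|f t| by rewrite /u; case: ifP.
have ui N : mu.-integrable setT (EFin \o u N).
  by apply: (integrable_dominated (g := fun t => `|f t|)) => // t; rewrite ger0_norm.
have ulim : (\int[mu]_t (u N t)%:E)%E @[N --> \oo] --> 0%E.
  have [] := @dominated_convergence _ _ _ mu setT measurableT (fun N => EFin \o u N)
    (cst 0%E) (EFin \o (fun t => `|f t|)).
  - by move=> N; exact/measurable_EFinP.
  - exact: measurable_cst.
  - apply: aeW => t _; apply: cvg_near_cst.
    by apply: filterS (aclose t) => N h; rewrite /= /u h.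
  - exact: fi.
  - by apply: aeW => t N _ /=; rewrite lee_fin ger0_norm.
  by move=> _ _; rewrite integral0.
have [N HN] : exists N, (\int[mu]_t (u N t)%:E <= (e / 2)%:E)%E.
  move: ulim => /fine_cvgP[_ /cvgr0_norm_le/(_ _ e20)[N _ /(_ N (leqnn N))] h].
  exists N; rewrite Rintegral_EFin// lee_fin.
  exact: le_trans (ler_norm _) h.
exists (a N); first exact: (conj (ma N) (fa N)).
apply: (@le_trans _ _ (\int[mu]_t (e / 2 + u N t)%:E)%E).
  apply: ge0_integral_le => // [||t].
  - by apply: meas_norm; exact: meas_sub.
  - exact: measurable_funD.
  - rewrite /u; case: ifP => h; first by rewrite addr0 ltW.
    have [|->] := aP N t; first by rewrite h.
    by rewrite subr0 lerDr ltW.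
rewrite Rintegral_EFin; last by apply: integrable_add => //; exact: integrable_const.
rewrite RintegralD//; last exact: integrable_const.
rewrite Rintegral_const lee_fin [leRHS]splitr lerD2l.
by rewrite -lee_fin -Rintegral_EFin.
Qed.

(** Norming functionals transfer the Cauchy property from the simple functions to
    their integrals. *)
Theorem bochner_integrable f : meas f ->
  mu.-integrable setT (EFin \o (fun t => `|f t|)) -> exists y, is_bochner_integral mu f y.
Proof.
move=> mf fi.
have r0 (n : nat) : (0 : R) < n.+1%:R^-1 by rewrite invr_gt0.
pose s n := projT1 (cid2 (simple_approximation mf fi (r0 n))).
have ss n : simple_fun (s n) by rewrite /s; case: cid2.
have sd n : (dist f (s n) <= (n.+1%:R^-1)%:E)%E by rewrite /s; case: cid2.
have d0 n : (0 <= dist f (s n))%E by apply: integral_ge0 => t _; rewrite lee_fin.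
have dfin n : (dist f (s n) < +oo)%E by exact: le_lt_trans (sd n) (ltry _).
have sd' n : fine (dist f (s n)) <= n.+1%:R^-1.
  by rewrite -lee_fin fineK// ge0_fin_numE.
pose I n := simple_integral mu (s n).
(* testing against a norming functional of the difference *)
have Idist n m : `|I n - I m| <= n.+1%:R^-1 + m.+1%:R^-1.
  have [th [dth <- th1]] := norming_functional (I n - I m).
  have th1' x : `|th x| <= 1 * `|x| by rewrite mul1r.
  have [_ hn] := dual_approx mf (ss n) dth th1' ler01 (dfin n).
  have [_ hm] := dual_approx mf (ss m) dth th1' ler01 (dfin m).
  rewrite -/(I n) in hn; rewrite -/(I m) in hm; rewrite (dualB _ _ dth).
  move: hn hm (sd' n) (sd' m); rewrite !mul1r.
  move: (fine _) (fine _) (n.+1%:R^-1) (m.+1%:R^-1) (\int[mu]_t _) (th (I n)) (th (I m)).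
  by move=> p q r u J a b; rewrite !ler_norml => /andP[? ?] /andP[? ?] ? ?; lra.
have : cvg (I n @[n --> \oo]).
  apply: cauchy_cvg; apply: cauchy_exP => e e0.
  have e20 : 0 < e / 2 by exact: divr_gt0.
  have [N _ HN] := near_infty_natSinv_lt (PosNum e20).
  exists (I N); exists N => // n /= Nn; rewrite -ball_normE /=.
  apply: (le_lt_trans (Idist N n)); rewrite [ltRHS]splitr.
  by apply: ltrD; [exact: (HN N (leqnn N))|exact: (HN n Nn)].
move=> /cvg_ex[y Iy]; exists y; split=> //; exists s; split=> //.
apply: (@squeeze_cvge _ _ _ _ (cst 0%E) _ (fun n => (n.+1%:R^-1)%:E)).
- by apply: nearW => n; rewrite d0 sd.
- exact: cvg_cst.
- apply: cvg_EFin; first exact: nearW.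
  exact: cvg_harmonic.
Qed.

End bochner_theory.

(** * Square integrable functions *)

Section limits_of_extended_sequences.
Context (R : realType).
Implicit Types (u : nat -> \bar R) (c : \bar R).

Lemma limn_esup_le_near u c : (\forall n \near \oo, (u n <= c)%E) -> (limn_esup u <= c)%E.
Proof.
move=> uc; apply: ge_ereal_inf; exists (ereal_sup [set u n | n in [set n | (u n <= c)%E]]).
  by exists [set n | (u n <= c)%E].
by apply: ge_ereal_sup => _ [n nc <-].
Qed.

Lemma le_limn_einf_near u c : (\forall n \near \oo, (c <= u n)%E) -> (c <= limn_einf u)%E.
Proof.
move=> uc; rewrite leeNr; apply: limn_esup_le_near.
by apply: filterS uc => n; rewrite leeN2.
Qed.

End limits_of_extended_sequences.

Section square_integrable.
Context d (T : measurableType d) (R : realType) (mu : probability T R).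
Implicit Types (f g h : T -> R).
Local Notation intg f := (mu.-integrable [set: T] (EFin \o f)).

Definition L2 f := measurable_fun setT f /\ intg (fun x => f x ^+ 2).

Definition sqnorm f : R := \int[mu]_x (f x ^+ 2).

Lemma sqnorm_ge0 f : 0 <= sqnorm f.
Proof. by apply: Rintegral_ge0 => x _; exact: sqr_ge0. Qed.

Lemma L2_mul f g : L2 f -> L2 g -> intg (fun x => f x * g x).
Proof.
move=> [mf f2] [mg g2].
apply: (integrable_dominated (g := fun x => f x ^+ 2 + g x ^+ 2)).
- exact: measurable_funM.
- by move=> x; rewrite ler_norml; apply/andP; split; nra.
- exact: integrable_add.
Qed.

Lemma L2_scale (c : R) f : L2 f -> L2 (fun x => c * f x).
Proof.
move=> [mf f2]; split; first exact: measurable_funM.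
have -> : (fun x => (c * f x) ^+ 2) = (fun x => c ^+ 2 * f x ^+ 2).
  by apply/funext => x; rewrite exprMn.
exact: integrable_scale.
Qed.

Lemma L2_add f g : L2 f -> L2 g -> L2 (fun x => f x + g x).
Proof.
move=> Lf Lg; have fg := L2_mul Lf Lg; move: Lf Lg => [mf f2] [mg g2].
split; first exact: measurable_funD.
have -> : (fun x => (f x + g x) ^+ 2) = (fun x => f x ^+ 2 + (2 * (f x * g x) + g x ^+ 2)).
  by apply/funext => x; ring.
by do 2?apply: integrable_add => //; exact: integrable_scale.
Qed.

Lemma L2_sub f g : L2 f -> L2 g -> L2 (fun x => f x - g x).
Proof.
move=> Lf Lg; have -> : (fun x => f x - g x) = (fun x => f x + (-1) * g x).
  by apply/funext => x; rewrite mulN1r.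
by apply: L2_add => //; exact: L2_scale.
Qed.

Lemma sqnormD f g : L2 f -> L2 g ->
  sqnorm (fun x => f x + g x) = sqnorm f + 2 * (\int[mu]_x (f x * g x)) + sqnorm g.
Proof.
move=> Lf Lg; have fg := L2_mul Lf Lg; move: Lf Lg => [mf f2] [mg g2].
rewrite /sqnorm.
have -> : (\int[mu]_x (f x + g x) ^+ 2 =
    \int[mu]_x (f x ^+ 2 + 2 * (f x * g x) + g x ^+ 2))%R.
  by apply: eq_Rintegral => x _; ring.
have i2 : intg (fun x => 2 * (f x * g x)) by exact: integrable_scale.
by rewrite RintegralD ?RintegralD ?RintegralZl//; exact: integrable_add.
Qed.

Lemma sqnormZ (c : R) f : L2 f -> sqnorm (fun x => c * f x) = c ^+ 2 * sqnorm f.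
Proof.
move=> [mf f2]; rewrite /sqnorm -RintegralZl//.
by apply: eq_Rintegral => x _; rewrite exprMn.
Qed.

Lemma sqnormB f g : L2 f -> L2 g ->
  sqnorm (fun x => f x - g x) = sqnorm f - 2 * (\int[mu]_x (f x * g x)) + sqnorm g.
Proof.
move=> Lf Lg; have -> : (fun x => f x - g x) = (fun x => f x + (-1) * g x).
  by apply/funext => x; rewrite mulN1r.
rewrite sqnormD//; last exact: L2_scale.
rewrite sqnormZ// sqrrN expr1n mul1r.
have -> : \int[mu]_x (f x * (-1 * g x)) = -1 * \int[mu]_x (f x * g x).
  rewrite -RintegralZl//; last exact: L2_mul.
  by apply: eq_Rintegral => x _; rewrite mulrCA.
by rewrite mulN1r mulrN.
Qed.

(** Cauchy-Schwarz in the form that is used below: an inner product with a fixed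
   function is small as soon as the other factor is. *)
Lemma inner_product_small (A e : R) : 0 <= A -> 0 < e -> exists2 r, 0 < r &
  forall f g, L2 f -> L2 g -> sqnorm f <= A -> sqnorm g <= r ->
    `|\int[mu]_x (f x * g x)| <= e.
Proof.
move=> A0 e0; have A10 : 0 < A + 1 by rewrite ltr_wpDl.
pose s := e / (A + 1); have s0 : 0 < s by exact: divr_gt0.
exists (s * e); first exact: mulr_gt0.
have half (f g : T -> R) : L2 f -> L2 g -> sqnorm f <= A -> sqnorm g <= s * e ->
    \int[mu]_x (f x * g x) <= e.
  move=> Lf Lg fA gr; have := sqnorm_ge0 (fun x => s * f x - g x).
  rewrite sqnormB//; last exact: L2_scale.
  rewrite sqnormZ//.
  have -> : \int[mu]_x (s * f x * g x) = s * \int[mu]_x (f x * g x).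
    rewrite -RintegralZl//; last exact: L2_mul.
    by apply: eq_Rintegral => x _; rewrite mulrA.
  have sA : s * A <= e by rewrite /s mulrAC ler_pdivrMr// ler_wpM2l ?(ltW e0)// lerDl.
  move=> h; rewrite -(ler_pM2l s0).
  have h1 : s ^+ 2 * sqnorm f <= s * e.
    rewrite expr2 -mulrA ler_pM2l//; apply: le_trans sA; exact: ler_wpM2l (ltW s0) _ _ fA.
  lra.
move=> f g Lf Lg fA gr; rewrite ler_norml half// andbT lerNl.
have -> : - (\int[mu]_x (f x * g x)) = \int[mu]_x ((-1 * f x) * g x).
  rewrite -[LHS]mulN1r -RintegralZl//; last exact: L2_mul.
  by apply: eq_Rintegral => x _; rewrite mulrA.
by apply: half => //; [exact: L2_scale|rewrite sqnormZ// sqrrN expr1n mul1r].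
Qed.

(** Completeness of $L^2$, for sequences that are Cauchy at a geometric rate: the
   increments are then summable almost everywhere, so that the sequence converges
   almost everywhere, and Fatou's lemma compares the limit with each term. *)
Theorem fast_cauchy_L2 (u : nat -> T -> R) : (forall n, L2 (u n)) ->
  (forall n m, (n <= m)%N -> sqnorm (fun x => u m x - u n x) <= (4 ^+ n)^-1) ->
  exists2 f, L2 f & forall n, sqnorm (fun x => f x - u n x) <= (4 ^+ n)^-1.
Proof.
move=> Lu uC; have mu_ n : measurable_fun setT (u n) by have [] := Lu n.
pose a k x := u k.+1 x - u k x.
have ma k : measurable_fun setT (a k) by exact: measurable_funB.
have ia k : (\int[mu]_x (`|a k x|)%:E <= (2 / (2 ^ k.+1)%:R)%:E)%E.
  have p0 : (0 : R) < 2 ^+ k by rewrite exprn_gt0.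
  have La : L2 (a k) by exact: L2_sub.
  apply: (@le_trans _ _ (\int[mu]_x (2^-1 * (2 ^+ k * a k x ^+ 2 + (2 ^+ k)^-1))%:E)%E).
    apply: ge0_integral_le => // [||x].
    - exact: measurableT_comp.
    - by apply: measurable_funM => //; apply: measurable_funD => //;
        apply: measurable_funM => //; exact: measurable_funX.
    - rewrite -(real_normK (num_real (a k x))); move: (`|a k x|) => y.
      have : 0 <= 2 ^+ k * (y - (2 ^+ k)^-1) ^+ 2 by rewrite mulr_ge0 ?sqr_ge0// ltW.
      have -> : (2 : R) ^+ k * (y - (2 ^+ k)^-1) ^+ 2 =
          2 ^+ k * y ^+ 2 - 2 * y + (2 ^+ k)^-1.
        by field; rewrite gt_eqF.
      lra.
  have i1 : intg (fun x => 2 ^+ k * a k x ^+ 2) by apply: integrable_scale; case: La.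
  have i2 : intg (fun x => 2 ^+ k * a k x ^+ 2 + (2 ^+ k)^-1).
    by apply: integrable_add => //; exact: integrable_const.
  rewrite Rintegral_EFin; last exact: integrable_scale.
  rewrite RintegralZl// RintegralD//; last exact: integrable_const.
  rewrite RintegralZl//; last by case: La.
  rewrite Rintegral_const lee_fin natrX.
  have h := uC k k.+1 (leqnSn k); rewrite -/(sqnorm _).
  have h2 : 2 ^+ k * sqnorm (a k) <= (2 ^+ k)^-1.
    apply: (le_trans (ler_wpM2l (ltW p0) h)).
    have -> : (4 : R) = 2 ^+ 2 by rewrite expr2; ring.
    by rewrite -exprM mulnC muln2 -addnn exprD invfM mulrA mulfV ?mul1r// gt_eqF.
  rewrite exprS invfM mulrA mulfV ?mul1r//.
  by move: h2; lra.
pose S x := (\sum_(0 <= k <oo) (`|a k x|)%:E)%E.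
have mak k : measurable_fun setT (fun x => (`|a k x|)%:E).
  by apply/measurable_EFinP; exact: measurableT_comp.
have S0 x : (0 <= S x)%E by apply: nneseries_ge0 => *; rewrite lee_fin.
have mS : measurable_fun setT S.
  by apply: ge0_emeasurable_sum => // k x _ _; rewrite lee_fin.
have iS : mu.-integrable setT S.
  apply/integrableP; split=> //.
  under eq_integral do rewrite gee0_abs//.
  rewrite integral_nneseries//.
  apply: (@le_lt_trans _ _ (\sum_(0 <= k <oo) (2 / (2 ^ k.+1)%:R)%:E)%E).
    by apply: lee_nneseries => // k _ _; apply: integral_ge0.
  exact: le_lt_trans (@epsilon_trick0 R 2 xpredT _) (ltry _).
pose f x := fine (limn_esup (fun n => (u n x)%:E)).
have mf : measurable_fun setT f.
  apply: measurableT_comp => //; apply: measurable_fun_limn_esup => n.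
  exact/measurable_EFinP.
have uf x : S x \is a fin_num -> u n x @[n --> \oo] --> f x.
  move=> Sx; suff : cvg (u n x @[n --> \oo]).
    move=> /cvg_ex[l ul]; rewrite /f.
    have /cvg_limn_einf_sup[_ ->//] : (u n x)%:E @[n --> \oo] --> l%:E.
    by apply: cvg_EFin => //; exact: nearW.
  have : cvg (series (telescope (fun n => u n x)) n @[n --> \oo]).
    apply: normed_cvg; apply: nondecreasing_is_cvgn.
      by apply: nondecreasing_series => k _ _; exact: normr_ge0.
    exists (fine (S x)) => _ [n _ <-]; rewrite -lee_fin fineK//.
    rewrite /series /= -sumEFin; apply: nneseries_lim_ge => k _ _.
    by rewrite lee_fin.
  rewrite telescopeK => /cvg_ex[l ul]; apply/cvg_ex; exists (l + u 0%N x).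
  have -> : (fun n => u n x) = (fun n => (u n x - u 0%N x) + u 0%N x).
    by apply/funext => n; rewrite subrK.
  by apply: cvgD; [exact: ul|exact: cvg_cst].
have fatou_u n : (\int[mu]_x ((f x - u n x) ^+ 2)%:E <= ((4 ^+ n)^-1)%:E)%E.
  have mfl l : measurable_fun setT (fun x => ((u l x - u n x) ^+ 2)%:E).
    by apply/measurable_EFinP; apply: measurable_funX; exact: measurable_funB.
  have -> : (\int[mu]_x ((f x - u n x) ^+ 2)%:E =
      \int[mu]_x limn_einf (fun l => ((u l x - u n x) ^+ 2)%:E))%E.
    apply: ae_eq_integral => //.
    - by apply/measurable_EFinP; apply: measurable_funX; exact: measurable_funB.
    - apply: (@measurableT_comp _ _ _ _ _ _ (@oppe R)) => //.
      by apply: measurable_fun_limn_esup => l; exact: measurableT_comp.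
    have := integrable_ae measurableT iS.
    apply: filterS => x /(_ Logic.I) /uf ux _.
    apply/esym/(cvg_limn_einf_sup _).1.
    apply: cvg_EFin; first exact: nearW.
    by rewrite !expr2; apply: cvgM; (apply: cvgB; [exact: ux|exact: cvg_cst]).
  apply: (le_trans (@fatou _ _ _ mu setT measurableT
    (fun l x => ((u l x - u n x) ^+ 2)%:E) mfl _)).
    by move=> l x _; rewrite lee_fin sqr_ge0.
  apply: (le_trans (limn_einf_sup _)); apply: limn_esup_le_near.
  exists n => // m /= nm; rewrite Rintegral_EFin; last by have [] := L2_sub (Lu m) (Lu n).
  by rewrite lee_fin; exact: uC.
have Lfu n : L2 (fun x => f x - u n x).
  split; first exact: measurable_funB.
  apply/integrableP; split.
    by apply/measurable_EFinP; apply: measurable_funX; exact: measurable_funB.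
  apply: (@le_lt_trans _ _ ((4 ^+ n)^-1)%:E); last exact: ltry.
  apply: le_trans (fatou_u n); rewrite le_eqVlt; apply/orP; left; apply/eqP.
  by apply: eq_integral => x _; rewrite /= ger0_norm// sqr_ge0.
exists f.
  have -> : f = fun x => (f x - u 0%N x) + u 0%N x by apply/funext => x; rewrite subrK.
  exact: L2_add.
by move=> n; rewrite -lee_fin -Rintegral_EFin//; case: (Lfu n).
Qed.

Local Open Scope ereal_scope.

Lemma Lnorm2E f : 'N[mu]_2%:E[EFin \o f] = sqrte (\int[mu]_x (f x ^+ 2)%:E).
Proof.
rewrite unlock -poweR12_sqrt; last by apply: integral_ge0 => x _; rewrite lee_fin sqr_ge0.
congr (_ `^ _); apply: eq_integral => x _ /=.
by rewrite powR_mulrn ?normr_ge0// real_normK// num_real.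
Qed.

Lemma Lnorm2_sqr f : L2 f -> 'N[mu]_2%:E[EFin \o f] ^+ 2 = (sqnorm f)%:E.
Proof.
move=> [mf f2]; rewrite Lnorm2E Rintegral_EFin//=.
by rewrite -EFinM -expr2 sqr_sqrtr// sqnorm_ge0.
Qed.

Lemma Lfun2P f : f \in Lfun mu 2%:E <-> L2 f.
Proof.
split=> [f2|[mf f2]].
  by split; [have /andP[/[!inE]] := f2|exact: Lfun2_integrable_sqr f2].
apply/andP; split; rewrite !inE//=.
rewrite /finite_norm Lnorm2E Rintegral_EFin//=; exact: ltry.
Qed.

Lemma Lnorm2_lt f (e : R) : L2 f -> (0 < e)%R ->
  ('N[mu]_2%:E[EFin \o f] < e%:E) = (sqnorm f < e ^+ 2)%R.
Proof.
move=> [mf f2] e0; rewrite Lnorm2E Rintegral_EFin//= lte_fin.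
by rewrite -[in LHS](ger0_norm (ltW e0)) -sqrtr_sqr ltr_sqrt// exprn_gt0.
Qed.

End square_integrable.

(** * The reproducing kernel Hilbert space *)

Section rkhs_theory.
Context (R : realType) (E : completeNormedModType R) (sepE : separable E).
Variable mu : probability (borel E) R.
Hypothesis norm_sqr_integrable :
  mu.-integrable setT (EFin \o (fun z : borel E => `|z : E| ^+ 2)).
Implicit Types (th la : E -> R) (x : E) (phi : borel E -> R).

Local Notation q th := (sqnorm mu (th : borel E -> R)).

Lemma dual_L2 th : dual th -> L2 mu (th : borel E -> R).
Proof.
move=> dth; have mth := dual_measurable dth; split=> //.
have [C C0 thC] := dual_bounded dth.
apply: (integrable_dominated (g := fun z : borel E => C ^+ 2 * `|z : E| ^+ 2)).
- exact: measurable_funX.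
- move=> z; rewrite ger0_norm ?sqr_ge0// -exprMn -(real_normK (num_real (th z))).
  by rewrite ler_sqr ?nnegrE// ?mulr_ge0// ltW.
- exact: integrable_scale.
Qed.

Lemma dual_closureP phi : dual_closure mu phi <->
  L2 mu phi /\ forall r : R, 0 < r ->
    exists2 th, dual th & sqnorm mu (fun z : borel E => phi z - th z) < r.
Proof.
split=> [[/Lfun2P Lphi near]|[Lphi near]].
  split=> // r r0; have s0 : 0 < Num.sqrt r by rewrite sqrtr_gt0.
  have [th cth] := near _ s0; have dth := linear_dual cth.
  rewrite Lnorm2_lt//; last exact: L2_sub Lphi (dual_L2 dth).
  by rewrite sqr_sqrtr ?(ltW r0)//; exists th.
rewrite /dual_closure /=; split=> [|e e0]; first exact/Lfun2P.
have [|th dth lth] := near (e ^+ 2); first by rewrite exprn_gt0.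
have [F FE] := dual_linear dth; subst th; exists F; first exact: dth.2.
by rewrite Lnorm2_lt//; exact: L2_sub Lphi (dual_L2 dth).
Qed.

Lemma bochner_integral_L2 phi : L2 mu phi ->
  exists y, is_bochner_integral mu (fun z : borel E => phi z *: (z : E)) y.
Proof.
move=> Lphi; have [mphi phi2] := Lphi.
have mf : measurable_fun setT (fun z : borel E => phi z *: (z : E) : borel E).
  apply: weakly_measurable => // th dth.
  rewrite (_ : th \o _ = fun z : borel E => phi z * th z); last first.
    by apply/funext => z /=; rewrite dualZ.
  by apply: measurable_funM => //; exact: dual_measurable.
apply: bochner_integrable => //.
apply: (integrable_dominated (g := fun z : borel E => phi z ^+ 2 + `|z : E| ^+ 2)).
- exact: (measurableT_comp (@norm_measurable _ E) mf).
- move=> z; rewrite normr_id normrZ -(real_normK (num_real (phi z))).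
  have := normr_ge0 (phi z); have := normr_ge0 (z : E).
  by move: (`|phi z|) (`|z : E|) => a b; nra.
- exact: integrable_add.
Qed.

Lemma bochner_integral_L2_dual phi y th :
  is_bochner_integral mu (fun z : borel E => phi z *: (z : E)) y -> dual th ->
  th y = \int[mu]_z (phi z * th z).
Proof.
move=> phiy dth; have [_ ->] := bochner_integral_dual sepE phiy dth.
by apply: eq_Rintegral => z _; rewrite dualZ.
Qed.

(** Completing the square: this exhibits half the squared norm of $\phi$ as the
   supremum of $\theta(x) - q(\theta)/2$, because functionals approximate $\phi$. *)
Lemma rkhs_repr_square x phi th : rkhs_repr mu x phi -> dual th ->
  th x - q th / 2 = sqnorm mu phi / 2 - sqnorm mu (fun z : borel E => phi z - th z) / 2.
Proof.
move=> [/dual_closureP[Lphi _] phix] dth.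
rewrite (bochner_integral_L2_dual phix dth) sqnormB//; last exact: dual_L2.
by lra.
Qed.

(** Riesz representation: a maximizing sequence of $\theta(x) - q(\theta)/2$ is
   Cauchy in $L^2$ by the parallelogram identity, and the vanishing of the first
   variation at the limit $\phi$ says that $\phi$ represents $x$. *)
Lemma riesz_rkhs x (C : R) : (forall th, dual th -> th x - q th / 2 <= C) -> rkhs mu x.
Proof.
move=> JC; pose J th := th x - q th / 2.
pose A := [set J th | th in [set th | dual th]].
have A_sup : has_sup A.
  split; last by exists C => _ [th dth <-]; exact: JC.
  exists (J (fun=> 0)), (fun=> 0) => //; split; last exact: cst_continuous.
  by move=> a y z; rewrite mulr0 addr0.
have J_sup th : dual th -> J th <= sup A.
  by move=> dth; apply: sup_upper_bound => //; exists th.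
have e0 n : 0 < (4 ^+ n)^-1 / 8 :> R by rewrite divr_gt0// invr_gt0 exprn_gt0.
have thP n : exists th, dual th /\ sup A - (4 ^+ n)^-1 / 8 <= J th.
  have [_ [th dth <-] h] := sup_adherent (e0 n) A_sup.
  by exists th; split=> //; exact: ltW.
have [u uP] := choice thP.
have du n : dual (u n) by have [] := uP n.
have Lu n := dual_L2 (du n).
have uC n m : (n <= m)%N -> q (fun z => u m z - u n z) <= (4 ^+ n)^-1.
  move=> nm; have dmid := dual_scale 2^-1 (dual_add (du m) (du n)).
  have := J_sup _ dmid; rewrite /J sqnormZ; last exact: L2_add.
  rewrite sqnormD// sqnormB//.
  have [_] := uP n; have [_] := uP m; rewrite /J.
  have : (4 ^+ m)^-1 <= (4 ^+ n)^-1 :> R.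
    by rewrite lef_pV2 ?posrE ?exprn_gt0// ler_eXn2l// ltr1n.
  move: (sqnorm _ _) (sqnorm _ _) (\int[mu]_z _) ((4 ^+ m)^-1) ((4 ^+ n)^-1) (sup A) => a b c.
  by move=> p r s; lra.
have [phi Lphi uphi] := fast_cauchy_L2 Lu uC.
have geom (r : R) : 0 < r -> exists n, (4 ^+ n)^-1 <= r.
  move=> r0; have : (fun n => (4^-1 : R) ^+ n) @ \oo --> 0.
    by apply: cvg_expr; rewrite ger0_norm// invf_lt1// ltr1n.
  move=> /cvgr0_norm_le/(_ _ r0)[N _ /(_ N (leqnn N))] h; exists N.
  by rewrite -exprVn; exact: le_trans (ler_norm _) h.
have [y phiy] := bochner_integral_L2 Lphi.
suff -> : x = y.
  exists phi; split=> //; apply/dual_closureP; split=> // r r0.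
  have r20 : 0 < r / 2 by exact: divr_gt0.
  have [n hn] := geom _ r20; exists (u n) => //.
  apply: le_lt_trans (uphi n) _; apply: (le_lt_trans hn).
  by rewrite ltr_pdivrMr// ltr_pMr// ltr1n.
apply: dual_separates => la dla.
have Lla := dual_L2 dla.
set Q := q la; have Q0 : 0 <= Q by exact: sqnorm_ge0.
set D := la x - la y.
have key (t e : R) : 0 < e -> t * D <= t ^+ 2 * Q / 2 + e * (`|t| + 1).
  move=> e0'; have [r r0 small] := inner_product_small mu Q0 e0'.
  have rm : 0 < Num.min r e by rewrite lt_min r0.
  have [n] := geom _ rm; rewrite le_min => /andP[nr ne].
  have := small _ _ Lla (L2_sub Lphi (Lu n)) (lexx _) (le_trans (uphi n) nr).
  have -> : \int[mu]_z (la z * (phi z - u n z)) = la y - \int[mu]_z (u n z * la z).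
    rewrite (bochner_integral_L2_dual phiy dla) -RintegralB//; [|exact: L2_mul|exact: L2_mul].
    by apply: eq_Rintegral => z _; ring.
  have := J_sup _ (dual_add (du n) (dual_scale t dla)).
  rewrite /J sqnormD//; last exact: L2_scale.
  rewrite sqnormZ//.
  have -> : \int[mu]_z (u n z * (t * la z)) = t * \int[mu]_z (u n z * la z).
    rewrite -RintegralZl//; last exact: L2_mul.
    by apply: eq_Rintegral => z _; rewrite mulrCA.
  have [_] := uP n; rewrite /J -/Q /D; move: (sup A) ne.
  move: (\int[mu]_z _) (4 ^+ n)^-1 => I p s ne h1 h2 h3.
  have h4 : - (t * (la y - I)) <= `|t| * e.
    apply: (le_trans (ler_norm _)); rewrite normrN normrM.
    by apply: ler_wpM2l.
  by lra.
have {}key (t : R) : t * D <= t ^+ 2 * Q / 2.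
  apply/ler_addgt0Pr => e e0'; have t0 : 0 < `|t| + 1 by rewrite ltr_wpDl.
  have := key t (e / (`|t| + 1)) (divr_gt0 e0' t0).
  by rewrite divfK// gt_eqF.
have := key (D / (Q + 1)); rewrite -(ler_pM2r (_ : 0 < (Q + 1) ^+ 2)); last first.
  by rewrite exprn_gt0// ltr_wpDl.
have Q1 : Q + 1 != 0 by rewrite gt_eqF// ltr_wpDl.
have -> : D / (Q + 1) * D * (Q + 1) ^+ 2 = D ^+ 2 * (Q + 1) by field.
have -> : (D / (Q + 1)) ^+ 2 * Q / 2 * (Q + 1) ^+ 2 = D ^+ 2 * Q / 2 by field.
move=> h; apply/eqP; rewrite -subr_eq0 -/D -sqrf_eq0 eq_le sqr_ge0 andbT.
by have := sqr_ge0 D; nra.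
Qed.

Definition rkhs_rate x : \bar R := ((2^-1)%:E * rkhs_norm mu x ^+ 2)%E.

(** The choice made in the definition of the norm returns the norm of some
    representing function. *)
Lemma rkhs_rate_repr x phi : rkhs_repr mu x phi ->
  exists2 psi, rkhs_repr mu x psi & rkhs_rate x = (sqnorm mu psi / 2)%:E.
Proof.
move=> xphi; have h := xgetPex +oo%E (ex_intro _ _ (imageP
  (fun phi => 'N[mu]_2%:E[EFin \o phi]%E) xphi)).
move: h => [psi xpsi psiE]; rewrite /rkhs_rate /rkhs_norm -psiE.
exists psi => //; have [/dual_closureP[Lpsi _] _] := xpsi.
by rewrite Lnorm2_sqr// -EFinM mulrC.
Qed.

Lemma rkhs_rate_y x : ~ rkhs mu x -> rkhs_rate x = +oo%E.
Proof.
move=> nx; rewrite /rkhs_rate /rkhs_norm xgetPN => [|y [phi xphi _]]; last first.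
  by apply: nx; exists phi.
by rewrite /= mulyy gt0_muley// lte_fin.
Qed.

Lemma rkhs_rate_ge0 x : (0 <= rkhs_rate x)%E.
Proof.
have [[phi /rkhs_rate_repr[psi _ ->]]|/rkhs_rate_y->//] := pselect (rkhs mu x).
by rewrite lee_fin divr_ge0// sqnorm_ge0.
Qed.

Lemma dual_le_rkhs_rate x th : dual th -> ((th x - q th / 2)%:E <= rkhs_rate x)%E.
Proof.
move=> dth; have [[phi /rkhs_rate_repr[psi xpsi ->]]|/rkhs_rate_y->] := pselect (rkhs mu x).
  by rewrite lee_fin (rkhs_repr_square xpsi dth) gerBl divr_ge0// sqnorm_ge0.
exact: leey.
Qed.

(** Together with dual_le_rkhs_rate this identifies the rate with the Legendre
    transform of $q/2$; at points outside the RKHS the supremum is infinite, by the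
    Riesz representation. *)
Lemma lt_rkhs_rate_dual x (a : R) : (a%:E < rkhs_rate x)%E ->
  exists2 th, dual th & a < th x - q th / 2.
Proof.
have [[phi /rkhs_rate_repr[psi xpsi ->]]|nx _] := pselect (rkhs mu x).
  rewrite lte_fin -subr_gt0 => a_lt.
  have [/dual_closureP[_ /(_ _ a_lt)[th dth near]] _] := xpsi.
  exists th => //; rewrite (rkhs_repr_square xpsi dth).
  by move: near a_lt; lra.
apply: contrapT => no; apply: nx; apply: (@riesz_rkhs _ a) => th dth.
by rewrite leNgt; apply/negP => h; apply: no; exists th.
Qed.

(** The points $x_\theta = \int z\,\theta(z)\,d\mu$ with $\theta$ in the dual are
   dense in the RKHS, both for the norm of $E$ and for the rate. *)
Lemma exposed_points_dense (G : set E) x (b : R) : open G -> G x ->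
  (rkhs_rate x < b%:E)%E ->
  exists th y, [/\ dual th, G y, q th / 2 < b &
    forall la, dual la -> la y = \int[mu]_z (th z * la z)].
Proof.
move=> oG Gx; have [[phi /rkhs_rate_repr[psi xpsi ->]]|/rkhs_rate_y->//] :=
  pselect (rkhs mu x).
rewrite lte_fin => psib.
have [/dual_closureP[Lpsi near] psix] := xpsi.
have /nbhs_ballP[e /= e0 eG] : nbhs x G by exact: open_nbhs_nbhs.
pose M := \int[mu]_z (`|z : E| ^+ 2).
have M0 : 0 <= M by apply: Rintegral_ge0 => z _; exact: sqr_ge0.
have N0 : 0 <= sqnorm mu psi := sqnorm_ge0 mu psi.
have A0 : 0 <= M + sqnorm mu psi by exact: addr_ge0.
pose c := b - sqnorm mu psi / 2.
have c0 : 0 < c by rewrite subr_gt0.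
pose d := Num.min (e / 2) (c / 2).
have d0 : 0 < d by rewrite lt_min !divr_gt0.
have [r r0 small] := inner_product_small mu A0 d0.
have rc0 : 0 < Num.min r c by rewrite lt_min r0.
have [th dth] := near _ rc0; rewrite lt_min => /andP[thr thc].
have Lth := dual_L2 dth; have Ld := L2_sub Lpsi Lth.
have [y thy] := bochner_integral_L2 Lth.
exists th, y; split=> //; last by move=> la dla; exact: bochner_integral_L2_dual thy dla.
- apply: eG; rewrite -ball_normE /=.
  have [la [dla <- la1]] := norming_functional (x - y).
  have Lla := dual_L2 dla.
  have laM : q la <= M + sqnorm mu psi.
    apply: ler_wpDr => //; apply: le_Rintegral => //; first by case: Lla.
    move=> z _; rewrite -(real_normK (num_real (la z))).
    by rewrite ler_sqr ?nnegrE.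
  have -> : la (x - y) = \int[mu]_z (la z * (psi z - th z)).
    rewrite dualB// (bochner_integral_L2_dual psix dla) (bochner_integral_L2_dual thy dla).
    rewrite -RintegralB//; [|exact: L2_mul|exact: L2_mul].
    by apply: eq_Rintegral => z _; ring.
  apply: (le_lt_trans (ler_norm _)).
  apply: (le_lt_trans (small _ _ Lla Ld laM (ltW thr))).
  by rewrite gt_min; apply/orP; left; rewrite ltr_pdivrMr// ltr_pMr// ltr1n.
have pM : sqnorm mu psi <= M + sqnorm mu psi by rewrite lerDr.
have := small _ _ Lpsi Ld pM (ltW thr).
have -> : q th = sqnorm mu (fun z : borel E => psi z - (psi z - th z)).
  by congr (sqnorm mu _); apply/funext => z; ring.
rewrite sqnormB// le_min => /andP[_]; rewrite ler_norml => /andP[h _].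
by move: h thc; rewrite /c; lra.
Qed.

(** A supremum of continuous functions. *)
Lemma rkhs_rate_lsc : lower_semicontinuous rkhs_rate.
Proof.
move=> x a ax; have [th dth h] := lt_rkhs_rate_dual ax.
exists [set y | a < th y - q th / 2] => [|y ay].
  have : (fun y => th y - q th / 2) @ x --> th x - q th / 2.
    by apply: cvgB; [exact: dth.2|exact: cvg_cst].
  by move=> /cvgr_gt/(_ _ h).
by apply: lt_le_trans (dual_le_rkhs_rate y dth); rewrite lte_fin.
Qed.

End rkhs_theory.

(** * Large deviations of scaled Gaussian laws *)

Section logarithmic_scale.
Context (R : realType).
Implicit Types (x y p : \bar R) (a g : R).

Lemma le_of_lt_real x y : (forall a, a%:E < x -> a%:E <= y)%E -> (x <= y)%E.
Proof.
move=> H; rewrite leNgt; apply/negP => yx.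
have [a ya ax] : exists2 a, (y < a%:E)%E & (a%:E < x)%E.
  move: x y yx {H} => [s| |] [r| |]//.
  - rewrite lte_fin => rs; exists ((r + s) / 2); rewrite lte_fin; lra.
  - by move=> _; exists (s - 1); rewrite ?ltNyr// lte_fin; lra.
  - by move=> _; exists (r + 1); rewrite ?ltry// lte_fin; lra.
  - by move=> _; exists 0; rewrite ?ltNyr ?ltry.
by have := H a ax; rewrite leNgt ya.
Qed.

Lemma lne_upper p a g : 0 < g -> (0 <= p)%E -> (p <= (expR (- a * g))%:E)%E ->
  (g^-1%:E * lne p <= (- a)%:E)%E.
Proof.
move=> g0 p0 pa; rewrite lee_pdivrMl// -EFinM mulrC.
have <- : lne (expR (- a * g))%:E = (- a * g)%:E by rewrite lne_EFin ?expR_gt0// expRK.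
by rewrite lee_lne// in_itv/= leey andbT// lee_fin expR_ge0.
Qed.

Lemma lne_lower p a g : 0 < g -> ((expR (- a * g))%:E <= p)%E ->
  ((- a)%:E <= g^-1%:E * lne p)%E.
Proof.
move=> g0 pa; have e0 : (0 <= (expR (- a * g))%:E :> \bar R)%E by rewrite lee_fin expR_ge0.
rewrite lee_pdivlMl// -EFinM mulrC.
have <- : lne (expR (- a * g))%:E = (- a * g)%:E by rewrite lne_EFin ?expR_gt0// expRK.
by rewrite lee_lne// in_itv/= leey andbT//; exact: le_trans pa.
Qed.

End logarithmic_scale.

Section ldp_of_laws.
Context (R : realType) (E : completeNormedModType R) (sepE : separable E).
Context (rho : nat -> probability (borel E) R) (g : nat -> R).
Variable nu : probability (borel E) R.
Hypothesis nu_norm_sqr :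
  nu.-integrable setT (EFin \o (fun z : borel E => `|z : E| ^+ 2)).
Hypothesis speedg : speed g.
Let V (f : E -> R) := sqnorm nu (f : borel E -> R).
Hypothesis laplace_cvg : forall f (e : R), dual f -> 0 < e -> \forall n \near \oo,
  ((expR (g n * (V f / 2 - e)))%:E <= laplace rho g n f <= (expR (g n * (V f / 2 + e)))%:E)%E.
Hypothesis exp_tight : forall a : R, 0 <= a -> exists K : set E,
  [/\ compact K, closed K &
      \forall n \near \oo, (rho n (~` K) <= (2 * expR (- a * g n))%:E)%E].

Theorem rkhs_ldp_upper (F : set E) : closed F ->
  (limn_esup (fun n => (g n)^-1%:E * lne (rho n F)) <=
   - ereal_inf [set rkhs_rate nu x | x in F])%E.
Proof.
move=> clF; rewrite leeNr; apply: le_of_lt_real => a aF; rewrite leeNr.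
apply: limn_esup_le_near.
have := closed_upper_bound speedg laplace_cvg exp_tight (a := a) clF.
case=> [x Fx|N _ HN].
  apply: (lt_rkhs_rate_dual sepE nu_norm_sqr); apply: (lt_le_trans aF).
  by apply: ereal_inf_lbound; exists x.
by exists N => // n /HN; apply: lne_upper; [exact: speedg.1|exact: measure_ge0].
Qed.

(** It is enough to treat the exposed points of G, by density. *)
Theorem rkhs_ldp_lower (G : set E) : open G ->
  (- ereal_inf [set rkhs_rate nu x | x in G] <=
   limn_einf (fun n => (g n)^-1%:E * lne (rho n G)))%E.
Proof.
move=> oG; rewrite leeNl; apply: le_ereal_inf_tmp => _ [x Gx <-].
rewrite leeNl; apply: le_of_lt_real => a; rewrite lteNr -EFinN => xa.
apply: le_limn_einf_near.
have [th [y [dth Gy thb yE]]] := exposed_points_dense sepE nu_norm_sqr oG Gx xa.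
have L2d f : dual f -> L2 nu (f : borel E -> R) by move=> df; exact: dual_L2.
have Vge f : dual f -> 0 <= V f by move=> _; exact: sqnorm_ge0.
have VZ (c : R) f : dual f -> V (fun x => c * f x) = c ^+ 2 * V f.
  by move=> df; apply: sqnormZ; exact: L2d.
have VD la : dual la -> V (fun y => th y + la y) = V th + 2 * la y + V la.
  by move=> dla; rewrite /V sqnormD ?yE//; exact: L2d.
have := exposed_lower_bound speedg laplace_cvg exp_tight Vge VZ dth VD oG Gy thb.
by apply: filterS => n /(lne_lower (speedg.1 n)); rewrite opprK.
Qed.

End ldp_of_laws.

Section scaled_gaussian_laws.
Context (R : realType) (E : completeNormedModType R) (sepE : separable E).
Context (mu : nat -> probability (borel E) R) (mu' : probability (borel E) R).
Hypothesis cvgmu : weak_cvg mu mu'.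
Hypothesis gmu : forall n, gaussian_law (mu n).
Context (g : nat -> R) (speedg : speed g) (rho : nat -> probability (borel E) R).
Hypothesis rhoE : forall n A, measurable A ->
  rho n A = mu n [set x : borel E | A ((Num.sqrt (g n))^-1 *: (x : E))].
Context (m : E) (nu : probability (borel E) R).
Hypothesis mE : forall th, dual th -> th m = \int[mu']_x th x.
Hypothesis nuE : forall A, measurable A -> nu A = mu' [set x : borel E | A ((x : E) - m)].

Let measurable_scale (c : R) :
  measurable_fun setT (fun x : borel E => c *: (x : E) : borel E).
Proof.
apply: weakly_measurable => // th dth.
rewrite (_ : th \o _ = fun x : borel E => c * th x); last first.
  by apply/funext => z /=; rewrite dualZ.
by apply: measurable_funM => //; exact: dual_measurable.
Qed.

Let measurable_shift : measurable_fun setT (fun x : borel E => (x : E) - m : borel E).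
Proof.
apply: weakly_measurable => // th dth.
rewrite (_ : th \o _ = fun x : borel E => th x - th m); last first.
  by apply/funext => z /=; rewrite dualB.
by apply: measurable_funB => //; exact: dual_measurable.
Qed.

Let mu'_norm_sqr : mu'.-integrable setT (EFin \o (fun x : borel E => `|x : E| ^+ 2)).
Proof. exact: limit_norm_sqr_integrable cvgmu gmu. Qed.

Lemma centered_norm_sqr_integrable :
  nu.-integrable setT (EFin \o (fun z : borel E => `|z : E| ^+ 2)).
Proof.
apply/(integrable_law measurable_shift nuE); first by apply: measurable_funX; exact: norm_measurable.
apply: (integrable_dominated (g := fun x : borel E => 2 * `|x : E| ^+ 2 + 2 * `|m| ^+ 2)).
- apply: measurable_funX; exact: (measurableT_comp (@norm_measurable _ E) measurable_shift).
- move=> x; rewrite ger0_norm ?sqr_ge0//=.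
  apply: (@le_trans _ _ ((`|x : E| + `|m|) ^+ 2)); last first.
    by have := sqr_ge0 (`|x : E| - `|m|); lra.
  by rewrite ler_sqr ?nnegrE ?addr_ge0// ler_normB.
- by apply: integrable_add; [exact: integrable_scale|exact: integrable_const].
Qed.

Lemma centered_sqnorm th : dual th -> sqnorm nu (th : borel E -> R) = law_var mu' th.
Proof.
move=> dth; have mth := dual_measurable dth.
have [_ th2] := dual_L2 centered_norm_sqr_integrable dth.
have Lth := dual_L2 mu'_norm_sqr dth; have [_ th2'] := Lth.
have L1 : L2 mu' (fun=> 1 : R).
  by split; [exact: measurable_cst|exact: integrable_const].
have ith : mu'.-integrable setT (EFin \o (th : borel E -> R)).
  have := L2_mul L1 Lth.
  by congr (_.-integrable _ (EFin \o _)); apply/funext => x; rewrite mul1r.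
rewrite /sqnorm (Rintegral_law measurable_shift nuE)//; last exact: measurable_funX.
transitivity (\int[mu']_x (th x ^+ 2 - (2 * th m) * th x + th m ^+ 2)).
  by apply: eq_Rintegral => x _; rewrite dualB//; ring.
have i1 := integrable_scale (2 * th m) ith; have i2 := integrable_sub th2' i1.
rewrite RintegralD//; last exact: integrable_const.
by rewrite RintegralB// RintegralZl// Rintegral_const /law_var /law_mean -(mE dth); ring.
Qed.

(** At $g_n f$ the exponent is $\sqrt{g_n}$ times the mean of f plus $g_n$ times half its
    variance; the means are bounded, so that the first term is negligible relative to
    $g_n$. *)
Lemma scaled_laplace_cvg f (e : R) : dual f -> 0 < e -> \forall n \near \oo,
  ((expR (g n * (sqnorm nu (f : borel E -> R) / 2 - e)))%:E <= laplace rho g n f <=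
   (expR (g n * (sqnorm nu (f : borel E -> R) / 2 + e)))%:E)%E.
Proof.
move=> df e0; rewrite centered_sqnorm//.
have [mean_cvg var_cvg] := gaussian_moments_cvg sepE cvgmu gmu df.
pose B := `|law_mean mu' f| + 1; have B0 : 0 < B by rewrite ltr_wpDl.
have e20 : 0 < e / 2 by exact: divr_gt0.
near=> n.
have g0 : 0 < g n := speedg.1 n.
set s := Num.sqrt (g n); have s0 : 0 < s by rewrite sqrtr_gt0.
have gs : g n = s ^+ 2 by rewrite sqr_sqrtr// ltW.
have meanB : `|law_mean (mu n) f| <= B.
  have h : `|law_mean mu' f - law_mean (mu n) f| <= 1.
    by near: n; move/cvgrPdist_le : mean_cvg; exact.
  rewrite -(subKr (law_mean mu' f) (law_mean (mu n) f)).
  by apply: (le_trans (ler_normB _ _)); rewrite lerD2l.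
have varE : `|law_var mu' f - law_var (mu n) f| <= e.
  by near: n; move/cvgrPdist_le : var_cvg; exact.
have gB : (2 * B / e) ^+ 2 <= g n.
  by near: n; have [_ /cvgryPge] := speedg; exact.
have sB : B <= s * e / 2.
  have : 2 * B / e <= s.
    rewrite -(ger0_norm (ltW s0)) -(ger0_norm (_ : 0 <= 2 * B / e)).
      by rewrite -ler_sqr ?nnegrE// !real_normK ?num_real// -gs.
    by rewrite divr_ge0 ?mulr_ge0// ltW.
  by rewrite ler_pdivrMr// => h; lra.
have -> : laplace rho g n f = (expR (s * law_mean (mu n) f + g n * law_var (mu n) f / 2))%:E.
  rewrite /laplace (ge0_integral_law (measurable_scale _) (rhoE n)); last 2 first.
  - apply/measurable_EFinP; apply: measurableT_comp => //.
    by apply: measurable_funM => //; exact: dual_measurable.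
  - by move=> x; rewrite lee_fin expR_ge0.
  have [_ _ E1 _] := gaussian_law_moments (gmu n) (dual_scale s df).
  rewrite -/s gs -(law_meanZ (gmu n))// -(law_varZ (gmu n))// -E1.
  apply: eq_integral => x _; congr (expR _)%:E.
  by rewrite /= dualZ//; field; rewrite gt_eqF.
rewrite !lee_fin !ler_expR gs.
move: meanB varE; rewrite !ler_norml => /andP[m1 m2] /andP[v1 v2].
have ss : s * B <= s ^+ 2 * e / 2 by rewrite expr2 -!mulrA ler_pM2l// mulrA.
have sm1 : - (s * B) <= s * law_mean (mu n) f by rewrite -mulrN ler_pM2l.
have sm2 : s * law_mean (mu n) f <= s * B by rewrite ler_pM2l.
have s20 : 0 <= s ^+ 2 by exact: sqr_ge0.
apply/andP; split; nra.
Unshelve. all: by end_near. Qed.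

Lemma scaled_exp_tight (a : R) : 0 <= a -> exists K : set E,
  [/\ compact K, closed K &
      \forall n \near \oo, (rho n (~` K) <= (2 * expR (- a * g n))%:E)%E].
Proof.
move=> a0; have [K [cK clK HK]] := exponential_tightness sepE cvgmu gmu a0.
exists K; split=> //.
have [_ /cvgryPge/(_ 1)] := speedg; apply: filterS => n gn1.
rewrite rhoE; first exact: HK.
by apply: open_borel; exact: closed_openC.
Qed.

End scaled_gaussian_laws.

(** * From laws to random variables *)

Section laws_of_random_variables.
Context (R : realType) (E : completeNormedModType R).

Lemma law_Rintegral d (Omega : measurableType d) (P : probability Omega R)
    (X : {RV P >-> borel E}) (f : E -> R) : continuous f ->
  (exists M : R, forall x, `|f x| <= M) ->
  'E_P[fun w => f (X w)]%E = (\int[distribution P X]_x f x)%:E.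
Proof.
move=> cf [M fM]; have mf := continuous_borel cf.
have mX : measurable_fun setT X by exact: measurable_funPT.
have lawE A : measurable A -> distribution P X A = P (X @^-1` A) by [].
rewrite unlock (Rintegral_law mX lawE)//; last exact: (@integrable_bounded _ _ _ _ _ M).
rewrite -Rintegral_EFin//.
apply: (@integrable_bounded _ _ _ P _ M); last by move=> w; exact: fM.
exact: measurableT_comp mf mX.
Qed.

Lemma gaussian_distribution d (Omega : measurableType d) (P : probability Omega R)
    (X : {RV P >-> borel E}) : gaussian X -> gaussian_law (distribution P X).
Proof.
move=> gX f df; have [F FE] := dual_linear df; subst f.
apply: real_gaussian_moments; first exact: dual_measurable.
by have [z [h|[s s0 h]]] := gX F df.2; exists z; [left|right; exists s].
Qed.

Lemma dual_expectation d (Omega : measurableType d) (P : probability Omega R)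
    (X : {RV P >-> borel E}) th : separable E ->
  (distribution P X).-integrable setT (EFin \o (fun x : borel E => `|x : E| ^+ 2)) ->
  dual th -> th (bochner_integral P X) = \int[distribution P X]_x th x.
Proof.
move=> sepE X2 dth; have mX : measurable_fun setT X by exact: measurable_funPT.
have lawE A : measurable A -> distribution P X A = P (X @^-1` A) by [].
have X1 : (distribution P X).-integrable setT (EFin \o (fun x : borel E => `|x : E|)).
  apply: (integrable_dominated (g := fun x : borel E => 1 + `|x : E| ^+ 2)).
  - exact: norm_measurable.
  - by move=> x; rewrite normr_id; have := sqr_ge0 (`|x : E| - 1); nra.
  - by apply: integrable_add => //; exact: integrable_const.
have [y Xy] := bochner_integrable sepE mX
  ((integrable_law mX lawE (@norm_measurable _ E)).1 X1).
have Xm := xgetPex 0 (ex_intro _ y Xy).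
have [ith ->] := bochner_integral_dual sepE Xm dth.
have mth := dual_measurable dth.
by rewrite (Rintegral_law mX lawE)//; exact/(integrable_law mX lawE).
Qed.

End laws_of_random_variables.

Theorem theorem1p1 (R : realType) (E : completeNormedModType R)
    (sepE : separable E)
    (d : nat -> measure_display) (Omega : forall n, measurableType (d n))
    (P : forall n, probability (Omega n) R)
    (X : forall n, {RV (P n) >-> borel E})
    (d' : measure_display) (Omega' : measurableType d')
    (P' : probability Omega' R) (X' : {RV P' >-> borel E})
    (gaussX : forall n, gaussian (X n))
    (cvgX : cvg_in_law X X')
    (g : nat -> R) (speedg : speed g) :
  LDP (fun n => rv_scale (g n `^ (- 2^-1)) (X n) : {RV (P n) >-> borel E}) g
    (fun x => (2^-1)%:E *
       rkhs_norm (distribution P'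
         (rv_sub X' (bochner_integral P' X') : {RV P' >-> borel E})) x ^+ 2)%E.
Proof.
pose mu n : probability (borel E) R := distribution (P n) (X n).
pose mu' : probability (borel E) R := distribution P' X'.
have gmu n : gaussian_law (mu n) by exact: gaussian_distribution.
have cvgmu : weak_cvg mu mu'.
  move=> f cf fM; have := cvgX f cf fM; rewrite law_Rintegral//.
  under eq_fun do rewrite law_Rintegral//.
  by move=> /fine_cvg.
have mu'2 := limit_norm_sqr_integrable sepE cvgmu gmu.
pose m := bochner_integral P' X'.
have mE th : dual th -> th m = \int[mu']_x th x.
  by move=> dth; exact: dual_expectation.
pose Y n : {RV (P n) >-> borel E} := rv_scale (g n `^ (- 2^-1)) (X n).
pose rho n : probability (borel E) R := distribution (P n) (Y n).
pose nu : probability (borel E) R :=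
  distribution P' (rv_sub X' m : {RV P' >-> borel E}).
have rhoE n A : measurable A ->
    rho n A = mu n [set x : borel E | A ((Num.sqrt (g n))^-1 *: (x : E))].
  move=> _; rewrite -powR12_sqrt -?powRN// ltW//; exact: speedg.1.
have nuE A : measurable A -> nu A = mu' [set x : borel E | A ((x : E) - m)] by [].
have nu2 := centered_norm_sqr_integrable sepE cvgmu gmu nuE.
have lap f e := @scaled_laplace_cvg _ _ sepE _ _ cvgmu gmu _ speedg _ rhoE _ _ mE nuE f e.
have tight := scaled_exp_tight sepE cvgmu gmu speedg rhoE.
split.
- exact: rkhs_rate_ge0.
- exact: (rkhs_rate_lsc sepE nu2).
- exact: (rkhs_ldp_upper sepE nu2 speedg lap tight).
- exact: (rkhs_ldp_lower sepE nu2 speedg lap tight).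
Qed.
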